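(* Let $(\varGamma,C)$ be a one-dimensional split-step SUSYQW whose coin $C$ is anisotropic, and suppose both limit coins $C(\mathrm{L})$ and $C(\mathrm{R})$ are nontrivial. Then: (A1) $(\varGamma,C)$ is Fredholm if and only if $|p|\neq|a(\mathrm{L})|$ and $|p|\neq |a(\mathrm{R})|$. (A2) In this case \[ \operatorname{ind}(\varGamma,C)=\begin{cases} +\operatorname{sgn} p, & |a(\mathrm{R})|<|p|<|a(\mathrm{L})|,\\ -\operatorname{sgn} p, & |a(\mathrm{L})|<|p|<|a(\mathrm{R})|,\\ 0, & \text{otherwise.}\end{cases} \]
   Context: Let $\mathcal H=\ell^2(\mathbb Z,\mathbb C^2)$, identified with $\ell^2(\mathbb Z)\oplus\ell^2(\mathbb Z)$. Let $L$ be the left shift on $\ell^2(\mathbb Z)$, $(L\Psi)(x)=\Psi(x+1)$, so $(L^*\Psi)(x)=\Psi(x-1)$. A (one-dimensional) split-step SUSYQW is the pair $(\varGamma,C)$ of operators on $\mathcal H$ given in block form by $\varGamma=\begin{pmatrix} p & qL\\ \overline{q}L^* & -p\end{pmatrix}$, $C=\begin{pmatrix} a_1 & \overline{b}\\ b & a_2\end{pmatrix}$, where $p\in\mathbb R$, $q\in\mathbb C\setminus\{0\}$, $p^2+|q|^2=1$, $\theta=\operatorname{Arg} q$, and $a_1,a_2:\mathbb Z\to\mathbb R$, $b:\mathbb Z\to\mathbb C$ are sequences (identified with multiplication operators) satisfying $a_j(x)^2+|b(x)|^2=1$ ($j=1,2$) and $b(x)(a_1(x)+a_2(x))=0$ for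 all $x\in\mathbb Z$. Then $\varGamma$ and $C$ are unitary involutions. The supercharge is $Q=[\varGamma,C]/(2i)$ and $H=Q^2$. With $\mathcal H_\pm=\ker(\varGamma\mp1)$, $Q$ anticommutes with $\varGamma$, so $Q_\pm:=Q|_{\mathcal H_\pm}:\mathcal H_\pm\to\mathcal H_\mp$ and $H_\pm:=H|_{\mathcal H_\pm}$. $(\varGamma,C)$ is called Fredholm if $Q_+$ is a Fredholm operator, and its Witten index is $\operatorname{ind}(\varGamma,C)=\dim\ker H_+-\dim\ker H_-$. The coin $C$ is anisotropic if the limits $C(\mathrm L)=\lim_{x\to-\infty}C(x)$ and $C(\mathrm R)=\lim_{x\to+\infty}C(x)$ exist, where $C(x)=\begin{pmatrix} a_1(x)&\overline{b(x)}\\ b(x)&a_2(x)\end{pmatrix}$; write $a_j(\sharp),b(\sharp)$ for the entries of $C(\sharp)$, $\sharp\in\{\mathrm L,\mathrm R\}$. A $2\times 2$ unitary Hermitian matrix is trivial if it equals $\pm I$. If $C(\sharp)$ is nontrivial then $a_1(\sharp)=-a_2(\sharp)$, and one writes $a(\sharp):=a_1(\sharp)$, so $a(\sharp)^2+|b(\sharp)|^2=1$. *)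

(* Defs.v *)
From Stdlib Require Import Reals Lra ZArith List.
Open Scope R_scope.

Record Cx := mkCx { re : R; im : R }.
Definition C0 : Cx := mkCx 0 0.
Definition Cr (r : R) : Cx := mkCx r 0.
Definition Cadd (z w : Cx) : Cx := mkCx (re z + re w) (im z + im w).
Definition Copp (z : Cx) : Cx := mkCx (- re z) (- im z).
Definition Csub (z w : Cx) : Cx := Cadd z (Copp w).
Definition Cmul (z w : Cx) : Cx :=
  mkCx (re z * re w - im z * im w) (re z * im w + im z * re w).
Definition Cconj (z : Cx) : Cx := mkCx (re z) (- im z).
Definition Cnorm2 (z : Cx) : R := re z * re z + im z * im z.

Definition V := Z -> (Cx * Cx).
Definition vzero : V := fun _ => (C0, C0).
Definition vadd (u v : V) : V := fun x => (Cadd (fst (u x)) (fst (v x)), Cadd (snd (u x)) (snd (v x))).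
Definition vscale (c : Cx) (v : V) : V := fun x => (Cmul c (fst (v x)), Cmul c (snd (v x))).
Definition vsub (u v : V) : V := vadd u (vscale (Cr (-1)) v).
Definition vnorm2 (w : Cx * Cx) : R := Cnorm2 (fst w) + Cnorm2 (snd w).

Definition l2_partial (psi : V) (N : nat) : R :=
  sum_f_R0 (fun k => vnorm2 (psi (Z.of_nat k - Z.of_nat N)%Z)) (2 * N).
Definition in_l2 (psi : V) : Prop := exists M, forall N, l2_partial psi N <= M.
Definition l2_conv (s : nat -> V) (phi : V) : Prop :=
  forall eps, 0 < eps -> exists K, forall k, (K <= k)%nat ->
    forall N, l2_partial (vsub (s k) phi) N <= eps.

Fixpoint lincomb (cs : list Cx) (vs : list V) : V :=
  match cs, vs with
  | c :: cs', v :: vs' => vadd (vscale c v) (lincomb cs' vs')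
  | _, _ => vzero
  end.
Definition in_span (vs : list V) (phi : V) : Prop :=
  exists cs, length cs = length vs /\ forall x, phi x = lincomb cs vs x.
Definition lin_indep (vs : list V) : Prop :=
  forall cs, length cs = length vs -> (forall x, lincomb cs vs x = vzero x) ->
    Forall (fun c => c = C0) cs.
Definition dim_eq (S : V -> Prop) (n : nat) : Prop :=
  exists vs, length vs = n /\ Forall S vs /\ lin_indep vs /\
    forall phi, S phi -> in_span vs phi.
Definition finite_dim (S : V -> Prop) : Prop :=
  exists vs, Forall S vs /\ forall phi, S phi -> in_span vs phi.

(* Gamma = [[p, qL],[conj(q) L^*, -p]], (L psi)(x) = psi(x+1) *)
Definition Gam (p : R) (q : Cx) (psi : V) : V := fun x =>
  (Cadd (Cmul (Cr p) (fst (psi x))) (Cmul q (snd (psi (x + 1)%Z))),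
   Cadd (Cmul (Cconj q) (fst (psi (x - 1)%Z))) (Cmul (Cr (- p)) (snd (psi x)))).
(* C = [[a1, conj b],[b, a2]] (multiplication operators) *)
Definition Coin (a1 a2 : Z -> R) (b : Z -> Cx) (psi : V) : V := fun x =>
  (Cadd (Cmul (Cr (a1 x)) (fst (psi x))) (Cmul (Cconj (b x)) (snd (psi x))),
   Cadd (Cmul (b x) (fst (psi x))) (Cmul (Cr (a2 x)) (snd (psi x)))).
(* Q = [Gamma, C] / (2i) ;  1/(2i) = -i/2 *)
Definition Qop p q a1 a2 b (psi : V) : V :=
  vscale (mkCx 0 (- / 2))
    (vsub (Gam p q (Coin a1 a2 b psi)) (Coin a1 a2 b (Gam p q psi))).
Definition Hop p q a1 a2 b (psi : V) : V := Qop p q a1 a2 b (Qop p q a1 a2 b psi).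

Definition Hplus p q (psi : V) : Prop := in_l2 psi /\ forall x, Gam p q psi x = psi x.
Definition Hminus p q (psi : V) : Prop :=
  in_l2 psi /\ forall x, Gam p q psi x = vscale (Cr (-1)) psi x.

(* Q_+ : H_+ -> H_- is Fredholm: finite-dimensional kernel, closed range,
   finite-dimensional cokernel (range + finite span = H_-). *)
Definition fredholm p q a1 a2 b : Prop :=
  finite_dim (fun psi => Hplus p q psi /\ forall x, Qop p q a1 a2 b psi x = vzero x) /\
  (forall (s : nat -> V) (phi : V),
     (forall k, Hplus p q (s k)) -> l2_conv (fun k => Qop p q a1 a2 b (s k)) phi ->
     exists psi, Hplus p q psi /\ forall x, phi x = Qop p q a1 a2 b psi x) /\
  (exists ws : list V, Forall (Hminus p q) ws /\
     forall phi, Hminus p q phi ->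
       exists psi, Hplus p q psi /\ in_span ws (vsub phi (Qop p q a1 a2 b psi))).

Definition kerHplus p q a1 a2 b (psi : V) : Prop :=
  Hplus p q psi /\ forall x, Hop p q a1 a2 b psi x = vzero x.
Definition kerHminus p q a1 a2 b (psi : V) : Prop :=
  Hminus p q psi /\ forall x, Hop p q a1 a2 b psi x = vzero x.

Definition witten_index_is p q a1 a2 b (k : Z) : Prop :=
  exists np nm : nat, dim_eq (kerHplus p q a1 a2 b) np /\
    dim_eq (kerHminus p q a1 a2 b) nm /\ (Z.of_nat np - Z.of_nat nm)%Z = k.

Definition lim_plus (f : Z -> R) (l : R) : Prop :=
  forall eps, 0 < eps -> exists N, forall x, (N <= x)%Z -> Rabs (f x - l) < eps.
Definition lim_minus (f : Z -> R) (l : R) : Prop :=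
  forall eps, 0 < eps -> exists N, forall x, (x <= N)%Z -> Rabs (f x - l) < eps.

Definition coin_trivial (a1 a2 : R) (b : Cx) : Prop :=
  (a1 = 1 /\ a2 = 1 /\ b = C0) \/ (a1 = -1 /\ a2 = -1 /\ b = C0).

Definition sgnZ (x : R) : Z :=
  if Rlt_dec 0 x then 1%Z else if Rlt_dec x 0 then (-1)%Z else 0%Z.

Definition index_formula (p aL aR : R) : Z :=
  if Rlt_dec (Rabs aR) (Rabs p) then
    (if Rlt_dec (Rabs p) (Rabs aL) then sgnZ p else 0%Z)
  else if Rlt_dec (Rabs aL) (Rabs p) then
    (if Rlt_dec (Rabs p) (Rabs aR) then (- sgnZ p)%Z else 0%Z)
  else 0%Z.

(* Main.v *)
(* The eigenspaces H_+ and H_- of Gamma are copies of l2(Z): with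
   k = conj q / (1 + p), every psi in H_+ is (u(x), k u(x-1)) and every psi in
   H_- is (- conj k w(x), w(x-1)).  In these coordinates Q_+ is a tridiagonal
   operator T, and Q_- is its adjoint T*.

   Where the coin is nontrivial, C + 1 is twice a rank-one projection, so T is
   the composition of two first-order difference operators.  Near +oo each
   factor is dominated by one of its two coefficients (this is |p| <> |a(R)|),
   so it is either solvable forward from one free initial value or uniquely
   solvable backward in l2.  Counting free values gives the index of T on the
   right half-line; reflecting x to -x gives the left one.  The finitely many
   sites in between contribute only finite-dimensional linear algebra, whence
   a finite index for T and the opposite one for T*.  Since ker T* embeds in
   coker T and ker T in coker T*, the two indices being opposite forces both
   embeddings to be isomorphisms; this yields the Witten index and shows that
   the range of T is the orthogonal complement of ker T*, hence closed.

   If |p| = |a(R)| the limit symbol vanishes at a point of the unit circle, and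
   wide plane-wave packets moving to infinity show that the range is not
   closed. *)
From Stdlib Require Import Reals ZArith Lra Lia List FunctionalExtensionality ClassicalEpsilon.
From Coquelicot Require Import Rcomplements Hierarchy Rbar Lim_seq Series.
From HB Require Import structures.
From mathcomp Require ssreflect ssrfun ssrbool eqtype choice ssrnat fintype bigop ssralg matrix mxalgebra boolp.
Require Import Defs.
Open Scope R_scope.

(** * Linear algebra over the complex numbers *)

(* Towards either end the symbol of [T], up to a constant factor, tends to
   [b z - 2 k a - k^2 conj b / z]. Since [a^2 + |b|^2 = 1], its roots are [k (a - 1) / b] and
   [k (a + 1) / b], and each first-order factor carries one of them. A root inside the unit disc
   gives a decaying solution, hence a free value; a root outside gives none. As
   [|k|^2 = (1 - p) / (1 + p)], some root has modulus 1 exactly when [|p| = |a|]. The number of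
   roots inside is [1 + sgn p] if [|a| < |p|] and 1 if [|p| < |a|]; the index is this number at the
   right end minus the one at the left end. The obstacle is that [b] may vanish, even at infinity
   when [a(R)] or [a(L)] is 1 or -1, so the three-term recurrence cannot be solved site by site.
   Domination of one coefficient by the other in each factor survives this case. Reflection and
   adjunction stay within the same family of operators, with [k] replaced by [1 / k] and by
   [- 1 / conj k], so one statement about right half-lines serves both ends of [T] and of [T*]. *)
Declare Scope Cx_scope.
Delimit Scope Cx_scope with Cx.
Bind Scope Cx_scope with Cx.
Infix "+" := Cadd : Cx_scope.
Infix "-" := Csub : Cx_scope.
Infix "*" := Cmul : Cx_scope.
Notation "- x" := (Copp x) : Cx_scope.

Definition C1 : Cx := Cr 1.
Definition Cinv (z : Cx) : Cx := mkCx (re z / Cnorm2 z) (- im z / Cnorm2 z).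
Definition Cdiv (z w : Cx) : Cx := Cmul z (Cinv w).
Infix "/" := Cdiv : Cx_scope.

Lemma Cx_ext (z w : Cx) : re z = re w -> im z = im w -> z = w.
Proof. destruct z, w; simpl; intros -> ->; reflexivity. Qed.

Lemma Cnorm2_ge0 (z : Cx) : 0 <= Cnorm2 z.
Proof. unfold Cnorm2; nra. Qed.

Lemma Cnorm2_eq0 (z : Cx) : Cnorm2 z = 0 -> z = C0.
Proof. unfold Cnorm2; intros H; apply Cx_ext; simpl; nra. Qed.

Lemma Cnorm2_gt0 (z : Cx) : z <> C0 -> 0 < Cnorm2 z.
Proof.
intros H; destruct (Cnorm2_ge0 z) as [|E]; [assumption|].
destruct (H (Cnorm2_eq0 z (eq_sym E))).
Qed.

Lemma Cinv_l (z : Cx) : z <> C0 -> Cmul (Cinv z) z = C1.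
Proof.
intros Hz; pose proof (Cnorm2_gt0 z Hz) as H; unfold Cnorm2 in H.
apply Cx_ext; unfold Cnorm2; simpl; unfold Cnorm2; field; lra.
Qed.

Lemma C1_neq0 : C1 <> C0.
Proof. intros H; apply (f_equal re) in H; simpl in H; lra. Qed.

Lemma Cx_field : field_theory C0 C1 Cadd Cmul Csub Copp Cdiv Cinv eq.
Proof.
split; [split| exact C1_neq0 | reflexivity | exact Cinv_l]; intros;
  apply Cx_ext; simpl; ring.
Qed.

Add Field Cx_field_instance : Cx_field.

Fixpoint csum (n : nat) (f : nat -> Cx) : Cx :=
  match n with O => C0 | S n' => Cadd (csum n' f) (f n') end.

(** Matrices are functions on [nat] of which only the first [n] rows and [m] columns count, so that
    the matrix types stay inside the module below. *)
Definition indep_rows (n m : nat) (e : nat -> nat -> Cx) : Prop :=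
  forall c : nat -> Cx,
    (forall x, (x < m)%nat -> csum n (fun j => c j * e j x)%Cx = C0) ->
    forall j, (j < n)%nat -> c j = C0.

Module CxLinearAlgebra.
Import ssreflect ssrfun ssrbool eqtype choice ssrnat fintype bigop ssralg matrix mxalgebra.
Import GRing.Theory.

HB.instance Definition _ := boolp.gen_eqMixin Cx.
HB.instance Definition _ := boolp.gen_choiceMixin Cx.

Lemma CaddA : associative Cadd. Proof. by move=> x y z; ring. Qed.
Lemma CaddC : commutative Cadd. Proof. by move=> x y; ring. Qed.
Lemma Cadd0 : left_id C0 Cadd. Proof. by move=> x; ring. Qed.
Lemma CaddN : left_inverse C0 Copp Cadd. Proof. by move=> x; ring. Qed.
HB.instance Definition _ := GRing.isZmodule.Build Cx CaddA CaddC Cadd0 CaddN.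

Lemma CmulA : associative Cmul. Proof. by move=> x y z; ring. Qed.
Lemma CmulC : commutative Cmul. Proof. by move=> x y; ring. Qed.
Lemma Cmul1 : left_id C1 Cmul. Proof. by move=> x; ring. Qed.
Lemma CmulD : left_distributive Cmul Cadd. Proof. by move=> x y z; ring. Qed.
Lemma Cone_neq0 : C1 != C0. Proof. by apply/eqP; exact: C1_neq0. Qed.
HB.instance Definition _ :=
  GRing.Zmodule_isComNzRing.Build Cx CmulA CmulC Cmul1 CmulD Cone_neq0.

Lemma CmulV (x : Cx) : x != GRing.zero -> Cmul (Cinv x) x = C1.
Proof. by move=> /eqP; exact: Cinv_l. Qed.
Lemma Cinv0 : Cinv C0 = C0.
Proof. by apply: Cx_ext; rewrite /= /Rdiv; ring. Qed.
HB.instance Definition _ := GRing.ComNzRing_isField.Build Cx CmulV Cinv0.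

Local Open Scope ring_scope.

Lemma csumE n (f : nat -> Cx) : csum n f = \sum_(i < n) f i.
Proof. by elim: n => [|n IH]; rewrite ?big_ord0 // big_ord_recr /= IH. Qed.

Definition row_of n (c : nat -> Cx) : 'rV[Cx]_n := \row_(i < n) c i.
Definition fun_of_row n (c : 'rV[Cx]_n) (i : nat) : Cx :=
  if insub i is Some j then c ord0 j else 0.

Lemma fun_of_rowE n (c : 'rV[Cx]_n) (i : 'I_n) : fun_of_row n c i = c ord0 i.
Proof. by rewrite /fun_of_row valK. Qed.

Lemma row_of_fun n (c : 'rV[Cx]_n) : row_of n (fun_of_row n c) = c.
Proof. by apply/rowP => i; rewrite mxE fun_of_rowE. Qed.

Lemma csum_row_mul n m (c : nat -> Cx) (M : nat -> nat -> Cx) (x : 'I_m) :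
  csum n (fun i => Cmul (c i) (M i x)) =
  (row_of n c *m (\matrix_(i < n, j < m) M i j)) ord0 x.
Proof. by rewrite csumE !mxE; apply: eq_bigr => i _; rewrite !mxE. Qed.

Lemma indep_rows_free n m e :
  indep_rows n m e -> row_free (\matrix_(i < n, j < m) e i j).
Proof.
move=> ie; rewrite -kermx_eq0; apply/eqP/row_matrixP => i; rewrite row0.
set A := \matrix_(i < n, j < m) e i j; set c := row i _.
have cA : c *m A = 0 by apply/sub_kermxP; exact: row_sub.
apply/rowP => j; rewrite !mxE.
have cE x : (x < m)%coq_nat -> csum n (fun i => Cmul (fun_of_row n c i) (e i x)) = C0.
  by move=> /ltP lx; rewrite (csum_row_mul n m _ e (Ordinal lx)) row_of_fun cA mxE.
by have := ie _ cE j (ltP (ltn_ord j)); rewrite fun_of_rowE !mxE.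
Qed.

(* [d] is the nullity of [M]; annihilators [W] of its row space have rank at
   most [m - rank M], and those of exactly that rank cut out the row space. *)
Lemma kernel_basis_and_range (n m : nat) (M : nat -> nat -> Cx) :
  exists (d : nat) (e : nat -> nat -> Cx),
    (forall j x, (j < d)%coq_nat -> (x < m)%coq_nat ->
       csum n (fun i => Cmul (e j i) (M i x)) = C0) /\
    indep_rows d n e /\
    (forall c, (forall x, (x < m)%coq_nat -> csum n (fun i => Cmul (c i) (M i x)) = C0) ->
       exists t, forall i, (i < n)%coq_nat -> c i = csum d (fun j => Cmul (t j) (e j i))) /\
    (forall r W, indep_rows r m W ->
       (forall i j, (i < n)%coq_nat -> (j < r)%coq_nat ->
          csum m (fun x => Cmul (M i x) (W j x)) = C0) ->
       (Nat.add r n <= Nat.add m d)%coq_nat /\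
       (Nat.add r n = Nat.add m d ->
        forall g, (forall j, (j < r)%coq_nat -> csum m (fun x => Cmul (g x) (W j x)) = C0) ->
        exists c, forall x, (x < m)%coq_nat -> g x = csum n (fun i => Cmul (c i) (M i x))))%N.
Proof.
set A := \matrix_(i < n, j < m) M i j.
pose K := row_base (kermx A); pose d := \rank (kermx A).
pose e j := fun_of_row n (if insub j is Some k then row (k : 'I_d) K else 0).
have eE : \matrix_(j < d, i < n) e j i = K.
  by apply/matrixP => j i; rewrite mxE /e valK fun_of_rowE mxE.
have rA : (\rank A + d = n)%N by rewrite /d mxrank_ker subnKC // rank_leq_row.
exists d, e; split; last split; last split.
- move=> j x /ltP lj /ltP lx.
  rewrite (csum_row_mul n m _ M (Ordinal lx)).
  have -> : row_of n (e j) = row (Ordinal lj) K.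
    by rewrite -eE; apply/rowP => i; rewrite !mxE.
  have -> : row (Ordinal lj) K *m A = 0.
    by apply/sub_kermxP; rewrite (submx_trans (row_sub _ _)) // eq_row_base.
  by rewrite mxE.
- move=> c cE j /ltP lj.
  have : row_of d c *m K = 0.
    by apply/rowP => i; rewrite -eE -csum_row_mul cE ?mxE //; exact/ltP.
  move=> /eqP; rewrite mulmx_free_eq0 ?row_base_free // => /eqP /rowP /(_ (Ordinal lj)).
  by rewrite !mxE.
- move=> c cE.
  have cA : (row_of n c <= K)%MS.
    rewrite eq_row_base; apply/sub_kermxP/rowP => x.
    by rewrite -csum_row_mul cE ?mxE //; exact/ltP.
  have [t tE] := submxP cA.
  exists (fun_of_row d t) => i /ltP li.
  rewrite (csum_row_mul d n _ e (Ordinal li)) row_of_fun eE -tE.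
  by rewrite mxE.
- move=> r W iW MW; set B := \matrix_(j < r, x < m) W j x.
  have rB : \rank B^T = r by rewrite mxrank_tr; apply/eqP; exact: indep_rows_free.
  have AB : A *m B^T = 0.
    apply/matrixP => i j; rewrite !mxE -[RHS](MW i j) ?csumE; try exact/ltP.
    by apply: eq_bigr => x _; rewrite !mxE.
  (* The rows of [A] lie in the left kernel of [B^T], of dimension [m - r]; with [rank A = n - d]
     this is the inequality. *)
  have rAB : (\rank A + r <= m)%N by rewrite -{1}rB; exact: mulmx0_rank_max.
  have rn : (r + n = \rank A + r + d)%N by rewrite -[in LHS]rA addnA (addnC r).
  split; first by apply/leP; rewrite -[X in (X <= _)%N]/(r + n)%N rn leq_add2r.
  move=> eq_rn g gW.
  have eqr : (\rank A + r = m)%N.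
    by apply: (@addIn d); rewrite -rn.
  have gB : (row_of m g <= kermx B^T)%MS.
    apply/sub_kermxP/rowP => j; rewrite !mxE -[RHS](gW j) ?csumE; try exact/ltP.
    by apply: eq_bigr => x _; rewrite !mxE.
  have sAB : (A <= kermx B^T)%MS by apply/sub_kermxP.
  have mr : (m - r = \rank A)%N by rewrite -[in LHS]eqr addnK.
  (* An inclusion of row spaces of equal rank is an equality, so whatever is annihilated by [W] is a
     combination of rows of [A]. *)
  have := mxrank_leqif_sup sAB; rewrite mxrank_ker rB mr => -[_].
  rewrite eqxx => /esym kA.
  have [c cE] := submxP (submx_trans gB kA).
  exists (fun_of_row n c) => x /ltP lx.
  by rewrite (csum_row_mul n m _ M (Ordinal lx)) row_of_fun -/A -cE mxE.
Qed.

End CxLinearAlgebra.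

(** * Square-summable sequences *)

Fixpoint zsum (f : Z -> R) (a : Z) (n : nat) : R :=
  match n with O => 0 | S n' => zsum f a n' + f (a + Z.of_nat n')%Z end.

Lemma zsum_ext f g a n :
  (forall x, (a <= x < a + Z.of_nat n)%Z -> f x = g x) -> zsum f a n = zsum g a n.
Proof.
induction n as [|n IH]; simpl; intros H; [reflexivity|].
rewrite IH, H; [reflexivity| lia | intros; apply H; lia].
Qed.

Lemma zsum_le f g a n :
  (forall x, (a <= x < a + Z.of_nat n)%Z -> f x <= g x) -> zsum f a n <= zsum g a n.
Proof.
induction n as [|n IH]; simpl; intros H; [lra|].
apply Rplus_le_compat; [apply IH; intros; apply H; lia | apply H; lia].
Qed.

Lemma zsum_plus f g a n : zsum (fun x => f x + g x) a n = zsum f a n + zsum g a n.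
Proof. induction n as [|n IH]; simpl; [|rewrite IH]; ring. Qed.

Lemma zsum_scal c f a n : zsum (fun x => c * f x) a n = c * zsum f a n.
Proof. induction n as [|n IH]; simpl; [|rewrite IH]; ring. Qed.

Lemma zsum_zero f a n :
  (forall x, (a <= x < a + Z.of_nat n)%Z -> f x = 0) -> zsum f a n = 0.
Proof.
intros H; rewrite (zsum_ext f (fun _ => 0 * 0)).
- rewrite (zsum_scal 0 (fun _ => 0)); ring.
- intros x Hx; rewrite H by assumption; ring.
Qed.

Lemma zsum_ge0 f a n : (forall x, 0 <= f x) -> 0 <= zsum f a n.
Proof.
intros H; induction n as [|n IH]; simpl; [lra|].
specialize (H (a + Z.of_nat n)%Z); lra.
Qed.

Lemma zsum_app f a n m : zsum f a (n + m) = zsum f a n + zsum f (a + Z.of_nat n)%Z m.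
Proof.
induction m as [|m IH]; simpl.
- rewrite Nat.add_0_r; ring.
- rewrite Nat.add_succ_r; simpl; rewrite IH.
  replace (a + Z.of_nat (n + m))%Z with (a + Z.of_nat n + Z.of_nat m)%Z by lia; ring.
Qed.

Lemma zsum_incl f a n a' n' : (forall x, 0 <= f x) ->
  (a' <= a)%Z -> (a + Z.of_nat n <= a' + Z.of_nat n')%Z ->
  zsum f a n <= zsum f a' n'.
Proof.
intros Hf H1 H2.
replace n' with (Z.to_nat (a - a') + (n + Z.to_nat (a' + Z.of_nat n' - a - Z.of_nat n)))%nat by lia.
rewrite !zsum_app.
replace (a' + Z.of_nat (Z.to_nat (a - a')))%Z with a by lia.
pose proof (zsum_ge0 f a' (Z.to_nat (a - a')) Hf).
pose proof (zsum_ge0 f (a + Z.of_nat n)%Z (Z.to_nat (a' + Z.of_nat n' - a - Z.of_nat n)) Hf).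
lra.
Qed.

Lemma zsum_term f a n x : (forall x, 0 <= f x) ->
  (a <= x < a + Z.of_nat n)%Z -> f x <= zsum f a n.
Proof.
intros Hf Hx; apply Rle_trans with (zsum f x 1).
- simpl; rewrite Z.add_0_r; lra.
- apply zsum_incl; [assumption|lia|lia].
Qed.

Lemma zsum_shift f t a n : zsum (fun x => f (x + t)%Z) a n = zsum f (a + t)%Z n.
Proof.
induction n as [|n IH]; simpl; [reflexivity|]; rewrite IH; do 2 f_equal; lia.
Qed.

Lemma zsum_recl f a n : zsum f a (S n) = f a + zsum f (a + 1)%Z n.
Proof.
change (S n) with (1 + n)%nat; rewrite zsum_app; simpl; rewrite Z.add_0_r; ring.
Qed.

Lemma zsum_reflect f a n :
  zsum (fun x => f (- x)%Z) a n = zsum f (1 - a - Z.of_nat n)%Z n.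
Proof.
revert a; induction n as [|n IH]; intros a; [reflexivity|].
rewrite zsum_recl, IH; cbn [zsum].
replace (1 - (a + 1) - Z.of_nat n)%Z with (1 - a - Z.of_nat (S n))%Z by lia.
replace (1 - a - Z.of_nat (S n) + Z.of_nat n)%Z with (- a)%Z by lia; ring.
Qed.

Lemma Cnorm2_mul z w : Cnorm2 (z * w)%Cx = Cnorm2 z * Cnorm2 w.
Proof. unfold Cnorm2; simpl; ring. Qed.

Lemma Cnorm2_opp z : Cnorm2 (- z)%Cx = Cnorm2 z.
Proof. unfold Cnorm2; simpl; ring. Qed.

Lemma Cnorm2_conj z : Cnorm2 (Cconj z) = Cnorm2 z.
Proof. unfold Cnorm2; simpl; ring. Qed.

Lemma Cnorm2_add_le z w : Cnorm2 (z + w)%Cx <= 2 * Cnorm2 z + 2 * Cnorm2 w.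
Proof.
unfold Cnorm2; simpl.
pose proof (Rle_0_sqr (re z - re w)); pose proof (Rle_0_sqr (im z - im w)).
unfold Rsqr in *; lra.
Qed.

Lemma Cnorm2_C0 : Cnorm2 C0 = 0.
Proof. unfold Cnorm2; simpl; ring. Qed.

Definition sq (u : Z -> Cx) (x : Z) : R := Cnorm2 (u x).
Definition rl2 (N : Z) (u : Z -> Cx) : Prop := exists M, forall n, zsum (sq u) N n <= M.
(** Bounding all windows at once, not only the symmetric ones, makes invariance under shifts and
    reflection immediate. *)
Definition sl2 (u : Z -> Cx) : Prop := exists M, forall a n, zsum (sq u) a n <= M.
Definition reflect (u : Z -> Cx) : Z -> Cx := fun x => u (- x)%Z.

Lemma sq_ge0 u x : 0 <= sq u x.
Proof. apply Cnorm2_ge0. Qed.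

Lemma rl2_ext N u v : (forall x, (N <= x)%Z -> u x = v x) -> rl2 N u -> rl2 N v.
Proof.
intros H [M HM]; exists M; intros n; rewrite <- (zsum_ext (sq u)); [apply HM|].
intros x Hx; unfold sq; rewrite H by lia; reflexivity.
Qed.

Lemma rl2_start N N' u : rl2 N u -> rl2 N' u.
Proof.
intros [M HM]; exists (zsum (sq u) N' (Z.to_nat (N - N')) + M); intros n.
apply Rle_trans with (zsum (sq u) N' (Z.to_nat (N - N') + n)).
- apply zsum_incl; [apply sq_ge0|lia|lia].
- rewrite zsum_app; apply Rplus_le_compat_l.
  apply Rle_trans with (zsum (sq u) N (Z.to_nat (N' - N) + n)); [|apply HM].
  apply zsum_incl; [apply sq_ge0|lia|lia].
Qed.

Lemma sl2_rl2 N u : sl2 u -> rl2 N u.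
Proof. intros [M HM]; exists M; intros n; apply HM. Qed.

Lemma sl2_reflect u : sl2 u -> sl2 (reflect u).
Proof.
intros [M HM]; exists M; intros a n; unfold sq, reflect.
rewrite (zsum_reflect (fun x => Cnorm2 (u x))); apply HM.
Qed.

Lemma sl2_of_halves N N' u : rl2 N u -> rl2 N' (reflect u) -> sl2 u.
Proof.
intros H1 H2; apply (rl2_start _ 0%Z) in H1; apply (rl2_start _ 0%Z) in H2.
destruct H1 as [M1 H1]; destruct H2 as [M2 H2]; exists (M2 + M1); intros a n.
set (L := (Z.to_nat (Z.abs a) + n)%nat).
apply Rle_trans with (zsum (sq u) (- Z.of_nat L)%Z (L + L)).
- apply zsum_incl; [apply sq_ge0|lia|lia].
- rewrite zsum_app; apply Rplus_le_compat.
  + apply Rle_trans with (zsum (sq (reflect u)) 0 (S L)); [|apply H2].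
    unfold sq at 2, reflect; rewrite (zsum_reflect (fun x => Cnorm2 (u x))).
    apply zsum_incl; [apply sq_ge0|lia|lia].
  + replace (- Z.of_nat L + Z.of_nat L)%Z with 0%Z by lia; apply H1.
Qed.

Lemma sl2_lin c u v : sl2 u -> sl2 v -> sl2 (fun x => c * u x + v x)%Cx.
Proof.
intros [M HM] [M' HM']; exists (2 * Cnorm2 c * M + 2 * M'); intros a n.
apply Rle_trans with (zsum (fun x => 2 * Cnorm2 c * sq u x + 2 * sq v x) a n).
- apply zsum_le; intros x _; unfold sq.
  pose proof (Cnorm2_add_le (c * u x)%Cx (v x)); rewrite Cnorm2_mul in H; lra.
- rewrite zsum_plus, !zsum_scal; specialize (HM a n); specialize (HM' a n).
  pose proof (Cnorm2_ge0 c); nra.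
Qed.

Lemma sl2_ext u v : (forall x, u x = v x) -> sl2 u -> sl2 v.
Proof. intros H; replace v with u; [tauto|]; apply functional_extensionality, H. Qed.

Lemma sl2_0 : sl2 (fun _ => C0).
Proof.
exists 0; intros a n; apply Req_le, zsum_zero; intros; unfold sq; apply Cnorm2_C0.
Qed.

Lemma sl2_add u v : sl2 u -> sl2 v -> sl2 (fun x => u x + v x)%Cx.
Proof.
intros Hu Hv; apply (sl2_ext (fun x => C1 * u x + v x)%Cx); [intros; ring|].
apply sl2_lin; assumption.
Qed.

Lemma sl2_scal c u : sl2 u -> sl2 (fun x => c * u x)%Cx.
Proof.
intros Hu; apply (sl2_ext (fun x => c * u x + C0)%Cx); [intros; ring|].
apply (sl2_lin c u (fun _ => C0)); [assumption|apply sl2_0].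
Qed.

Lemma sl2_sub u v : sl2 u -> sl2 v -> sl2 (fun x => u x - v x)%Cx.
Proof.
intros Hu Hv; apply (sl2_ext (fun x => - C1 * v x + u x)%Cx); [intros; ring|].
apply sl2_lin; assumption.
Qed.

Lemma sl2_shift t u : sl2 u -> sl2 (fun x => u (x + t)%Z).
Proof.
intros [M HM]; exists M; intros a n; unfold sq.
rewrite (zsum_shift (fun x => Cnorm2 (u x))); apply HM.
Qed.

Lemma sl2_bounded_mul K m u : (forall x, Cnorm2 (m x) <= K) -> sl2 u ->
  sl2 (fun x => m x * u x)%Cx.
Proof.
intros Hm [M HM]; exists (K * M); intros a n.
assert (HK : 0 <= K) by (pose proof (Cnorm2_ge0 (m 0%Z)); specialize (Hm 0%Z); lra).
apply Rle_trans with (zsum (fun x => K * sq u x) a n).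
- apply zsum_le; intros x _; unfold sq; rewrite Cnorm2_mul.
  apply Rmult_le_compat_r; [apply Cnorm2_ge0|apply Hm].
- rewrite zsum_scal; apply Rmult_le_compat_l; [assumption|apply HM].
Qed.

Lemma sl2_csum n (c : nat -> Cx) (u : nat -> Z -> Cx) :
  (forall i, (i < n)%nat -> sl2 (u i)) -> sl2 (fun x => csum n (fun i => c i * u i x)%Cx).
Proof.
induction n as [|n IH]; intros H; simpl; [apply sl2_0|].
apply (sl2_add (fun x => csum n (fun i => c i * u i x)%Cx)); [apply IH; auto|].
apply sl2_scal, H; lia.
Qed.

(** The symmetric sums increase to a limit. A window beyond [L], added to the symmetric sum up to
    [L], fits into a larger symmetric sum, so it weighs at most the limit minus that sum. *)
Lemma zsum_tail_small (f : Z -> R) : (forall x, 0 <= f x) ->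
  (exists M, forall a n, zsum f a n <= M) ->
  forall eps, 0 < eps -> exists L : nat, forall a n,
    (Z.of_nat L <= a \/ a + Z.of_nat n <= - Z.of_nat L)%Z -> zsum f a n <= eps.
Proof.
intros Hf [M HM] eps Heps.
set (S := fun L => zsum f (- Z.of_nat L)%Z (L + L)).
assert (HS : ex_finite_lim_seq S).
{ apply ex_finite_lim_seq_incr with M.
  - intros n; apply zsum_incl; [assumption|lia|lia].
  - intros n; apply HM. }
destruct HS as [l Hl].
assert (Hle : forall n, S n <= l).
{ intros n; apply (is_lim_seq_incr_compare S l); [assumption|].
  intros m; apply zsum_incl; [assumption|lia|lia]. }
apply is_lim_seq_spec in Hl; destruct (Hl (mkposreal eps Heps)) as [L HL]; simpl in HL.
exists L; intros a n Han.
specialize (HL L (Nat.le_refl L)); apply Rabs_def2 in HL.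
set (B := (L + Z.to_nat (Z.abs a) + n)%nat); specialize (Hle B).
destruct Han as [Ha|Ha].
- assert (S L + zsum f a n <= S B); [|lra].
  unfold S at 2; replace (B + B)%nat with ((B + L) + (B - L))%nat by lia.
  rewrite zsum_app; apply Rplus_le_compat; apply zsum_incl; try assumption; lia.
- assert (zsum f a n + S L <= S B); [|lra].
  unfold S at 2; replace (B + B)%nat with ((B - L) + (B + L))%nat by lia.
  rewrite zsum_app; apply Rplus_le_compat; apply zsum_incl; try assumption; lia.
Qed.

(** * First-order difference equations on a half-line *)

(* Peter-Paul form of the triangle inequality, with the weight chosen so that
   the contraction factor stays below 1. *)
Lemma dominated_step rho c : 0 <= rho < 1 -> 0 < c ->
  exists r K, 0 <= r < 1 /\ 0 <= K /\
    forall k l z w y : Cx, c <= Cnorm2 k -> Cnorm2 l <= rho * Cnorm2 k ->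
      (k * z + l * w)%Cx = y -> Cnorm2 z <= r * Cnorm2 w + K * Cnorm2 y.
Proof.
intros Hrho Hc; set (t := (1 - rho) / 2).
assert (Ht : 0 < t) by (unfold t; lra).
exists ((1 + t) * rho), ((1 + / t) / c).
assert (Hit : 0 < / t) by (apply Rinv_0_lt_compat; assumption).
assert (Hic : 0 < / c) by (apply Rinv_0_lt_compat; assumption).
split; [unfold t; nra|]; split; [unfold Rdiv; nra|].
intros k l z w y Hk Hl E.
assert (P : Cnorm2 k * Cnorm2 z <= (1 + / t) * Cnorm2 y + (1 + t) * (Cnorm2 l * Cnorm2 w)).
{ rewrite <- !Cnorm2_mul.
  replace (k * z)%Cx with (y - l * w)%Cx by (rewrite <- E; ring).
  generalize (l * w)%Cx; intros v; unfold Cnorm2; simpl.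
  assert (Q : forall a b, (a + - b) * (a + - b) <= (1 + / t) * (a * a) + (1 + t) * (b * b)).
  { intros a b.
    assert (0 <= / t * ((a + t * b) * (a + t * b))) by (apply Rmult_le_pos; [lra|apply Rle_0_sqr]).
    replace (/ t * ((a + t * b) * (a + t * b))) with (/ t * (a * a) + 2 * (a * b) + t * (b * b)) in H
      by (field; lra).
    lra. }
  pose proof (Q (re y) (re v)); pose proof (Q (im y) (im v)); lra. }
pose proof (Cnorm2_ge0 w); pose proof (Cnorm2_ge0 y); pose proof (Cnorm2_ge0 z).
assert (P2 : Cnorm2 l * Cnorm2 w <= rho * Cnorm2 k * Cnorm2 w)
  by (apply Rmult_le_compat_r; assumption).
assert (P3 : Cnorm2 y <= Cnorm2 k * (Cnorm2 y / c)).
{ apply Rle_trans with (c * (Cnorm2 y / c)); [right; field; lra|].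
  apply Rmult_le_compat_r; [|assumption]; unfold Rdiv; nra. }
apply Rmult_le_reg_l with (Cnorm2 k); [lra|].
apply Rle_trans with (1 := P).
apply Rle_trans with ((1 + / t) * (Cnorm2 k * (Cnorm2 y / c)) + (1 + t) * (rho * Cnorm2 k * Cnorm2 w)).
- apply Rplus_le_compat; apply Rmult_le_compat_l; lra.
- right; unfold Rdiv; ring.
Qed.

Definition diff1 (kap lam u : Z -> Cx) (x : Z) : Cx := (kap x * u x + lam x * u (x - 1)%Z)%Cx.

(** The ratio stays uniformly below 1 and the dominant coefficient away from 0: both are needed for
    geometric estimates in l2. *)
Definition dominates (N : Z) (kap lam : Z -> Cx) : Prop :=
  exists rho c, 0 <= rho < 1 /\ 0 < c /\
    forall x, (N <= x)%Z -> c <= Cnorm2 (kap x) /\ Cnorm2 (lam x) <= rho * Cnorm2 (kap x).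

Lemma dominates_neq0 N kap lam x : dominates N kap lam -> (N <= x)%Z -> kap x <> C0.
Proof.
intros (rho & c & _ & Hc & H) Hx E; destruct (H x Hx) as [H1 _].
rewrite E, Cnorm2_C0 in H1; lra.
Qed.

Fixpoint forward_sol (kap lam y : Z -> Cx) (N : Z) (u0 : Cx) (n : nat) : Cx :=
  match n with
  | O => u0
  | S n' => ((y (N + Z.of_nat n')%Z
              - lam (N + Z.of_nat n')%Z * forward_sol kap lam y N u0 n')
             / kap (N + Z.of_nat n')%Z)%Cx
  end.

Lemma forward_exists N kap lam y u0 : dominates N kap lam -> rl2 N y ->
  exists u, rl2 (N - 1) u /\ u (N - 1)%Z = u0 /\
    forall x, (N <= x)%Z -> diff1 kap lam u x = y x.
Proof.
intros HD [Y HY].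
set (u := fun x => forward_sol kap lam y N u0 (Z.to_nat (x - (N - 1)))).
assert (E0 : u (N - 1)%Z = u0) by (unfold u; rewrite Z.sub_diag; reflexivity).
assert (E : forall x, (N <= x)%Z -> diff1 kap lam u x = y x).
{ intros x Hx; unfold diff1, u.
  replace (Z.to_nat (x - (N - 1))) with (S (Z.to_nat (x - 1 - (N - 1)))) by lia.
  cbn [forward_sol].
  replace (N + Z.of_nat (Z.to_nat (x - 1 - (N - 1))))%Z with x by lia.
  field; apply (dominates_neq0 _ _ _ _ HD Hx). }
exists u; split; [|split; assumption].
destruct HD as (rho & c & Hrho & Hc & Hkl).
destruct (dominated_step rho c Hrho Hc) as (r & K & Hr & HK & Hstep).
(* The fixed point of [B = |u0|^2 + r B + K Y], the recursion obtained by summing [Hstep] over a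
   window. *)
exists ((Cnorm2 u0 + K * Y) / (1 - r)).
assert (H0 : 0 <= Y) by (specialize (HY O); simpl in HY; assumption).
induction n as [|n IH].
- simpl; unfold Rdiv; apply Rmult_le_pos.
  + pose proof (Cnorm2_ge0 u0); nra.
  + apply Rlt_le, Rinv_0_lt_compat; lra.
- rewrite zsum_recl; replace (N - 1 + 1)%Z with N by lia.
  apply Rle_trans with (Cnorm2 u0 + (r * zsum (sq u) (N - 1)%Z n + K * Y)).
  + unfold sq at 1; rewrite E0; apply Rplus_le_compat_l.
    apply Rle_trans with (zsum (fun x => r * sq u (x + -1)%Z + K * sq y x) N n).
    * apply zsum_le; intros x Hx; unfold sq.
      destruct (Hkl x) as [H1 H2]; [lia|].
      apply (Hstep (kap x) (lam x)); try assumption; apply E; lia.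
    * rewrite zsum_plus, (zsum_scal r (fun x => sq u (x + -1)%Z)), zsum_scal, zsum_shift.
      apply Rplus_le_compat_l, Rmult_le_compat_l; [assumption|apply HY].
  + apply Rle_trans with (Cnorm2 u0 + (r * ((Cnorm2 u0 + K * Y) / (1 - r)) + K * Y)).
    * apply Rplus_le_compat_l, Rplus_le_compat_r, Rmult_le_compat_l; lra.
    * right; field; lra.
Qed.

Lemma forward_unique N kap lam u : dominates N kap lam ->
  u (N - 1)%Z = C0 -> (forall x, (N <= x)%Z -> diff1 kap lam u x = C0) ->
  forall x, (N - 1 <= x)%Z -> u x = C0.
Proof.
intros HD H0 H.
assert (P : forall n, u (N - 1 + Z.of_nat n)%Z = C0).
{ induction n as [|n IH]; [rewrite Z.add_0_r; assumption|].
  set (x := (N - 1 + Z.of_nat (S n))%Z).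
  assert (Hx : (N <= x)%Z) by lia.
  specialize (H x Hx); unfold diff1 in H.
  replace (x - 1)%Z with (N - 1 + Z.of_nat n)%Z in H by lia.
  pose proof (dominates_neq0 _ _ _ _ HD Hx) as Hk.
  replace (u x) with ((kap x * u x + lam x * C0) / kap x)%Cx by (field; assumption).
  rewrite IH in H; rewrite H; field; assumption. }
intros x Hx; specialize (P (Z.to_nat (x - (N - 1)))).
replace (N - 1 + Z.of_nat (Z.to_nat (x - (N - 1))))%Z with x in P by lia; exact P.
Qed.

Definition Clim (s : nat -> Cx) (l : Cx) : Prop :=
  is_lim_seq (fun n => re (s n)) (re l) /\ is_lim_seq (fun n => im (s n)) (im l).

Lemma geometric_cauchy (s : nat -> R) B sg : 0 <= sg < 1 ->
  (forall n, Rabs (s (S n) - s n) <= B * sg ^ n) -> exists l : R, is_lim_seq s l.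
Proof.
intros Hsg H.
assert (ES : ex_series (fun n => s (S n) - s n)).
{ apply (ex_series_le (K := R_AbsRing) (V := R_CompleteNormedModule))
    with (b := fun n => B * sg ^ n); [exact H|].
  apply (ex_series_scal_l B (fun n => sg ^ n)); apply ex_series_geom.
  rewrite Rabs_pos_eq; lra. }
destruct ES as [l Hl]; exists (l + s O).
apply is_lim_seq_incr_1.
apply is_lim_seq_ext with (fun n => sum_n (fun n => s (S n) - s n) n + s O).
{ induction n as [|n IH]; [rewrite sum_O; ring|].
  rewrite sum_Sn; unfold plus; simpl; simpl in IH; lra. }
apply is_lim_seq_plus'; [exact Hl|apply is_lim_seq_const].
Qed.

Lemma geometric_Clim (s : nat -> Cx) B rho : 0 <= rho < 1 -> 0 <= B ->
  (forall n, Cnorm2 (s (S n) - s n)%Cx <= rho ^ n * B) -> exists l, Clim s l.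
Proof.
intros Hrho HB H.
assert (Hs : 0 <= sqrt rho < 1).
{ split; [apply sqrt_pos|]; rewrite <- sqrt_1; apply sqrt_lt_1; lra. }
assert (P : forall n, sqrt B * sqrt rho ^ n = sqrt (rho ^ n * B)).
{ intros n; rewrite sqrt_mult by (try apply pow_le; lra).
  rewrite Rmult_comm; f_equal.
  induction n as [|n IH]; simpl; [rewrite sqrt_1; reflexivity|].
  rewrite IH, sqrt_mult by (try apply pow_le; lra); reflexivity. }
destruct (geometric_cauchy (fun n => re (s n)) (sqrt B) (sqrt rho) Hs) as [l1 H1].
{ intros n; rewrite P; rewrite <- sqrt_Rsqr_abs; apply sqrt_le_1_alt.
  apply Rle_trans with (2 := H n); unfold Rsqr, Cnorm2; simpl.
  pose proof (Rle_0_sqr (im (s (S n)) + - im (s n))); unfold Rsqr in *; lra. }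
destruct (geometric_cauchy (fun n => im (s n)) (sqrt B) (sqrt rho) Hs) as [l2 H2].
{ intros n; rewrite P; rewrite <- sqrt_Rsqr_abs; apply sqrt_le_1_alt.
  apply Rle_trans with (2 := H n); unfold Rsqr, Cnorm2; simpl.
  pose proof (Rle_0_sqr (re (s (S n)) + - re (s n))); unfold Rsqr in *; lra. }
exists (mkCx l1 l2); split; assumption.
Qed.

Lemma Clim_unique s l l' : Clim s l -> Clim s l' -> l = l'.
Proof.
intros [H1 H2] [H3 H4].
apply is_lim_seq_unique in H1; apply is_lim_seq_unique in H2.
apply is_lim_seq_unique in H3; apply is_lim_seq_unique in H4.
rewrite H1 in H3; rewrite H2 in H4; injection H3; injection H4; intros.
apply Cx_ext; assumption.
Qed.

Lemma Clim_affine c d s l : Clim s l -> Clim (fun n => c * s n + d)%Cx (c * l + d)%Cx.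
Proof.
intros [H1 H2]; split; simpl; apply is_lim_seq_plus'; try apply is_lim_seq_const.
- apply is_lim_seq_minus'; apply (is_lim_seq_scal_l _ _ (Finite _)); assumption.
- apply is_lim_seq_plus'; apply (is_lim_seq_scal_l _ _ (Finite _)); assumption.
Qed.

Lemma Clim_Cnorm2 s l : Clim s l -> is_lim_seq (fun n => Cnorm2 (s n)) (Cnorm2 l).
Proof.
intros [H1 H2]; unfold Cnorm2; apply is_lim_seq_plus'; apply is_lim_seq_mult'; assumption.
Qed.

(** The recursion run leftwards from the value 0 placed [n] sites to the right of [x]. *)
Fixpoint backward_iter (kap lam y : Z -> Cx) (n : nat) (x : Z) : Cx :=
  match n with
  | O => C0
  | S n' => ((y (x + 1)%Z - kap (x + 1)%Z * backward_iter kap lam y n' (x + 1)%Z)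
             / lam (x + 1)%Z)%Cx
  end.

(** The backward recursion contracts squared moduli by [rho], so its iterates from 0 converge
    geometrically at every site. The bound [B = r B + K Y] on their windows is uniform in [n] and
    passes to the limit. *)
Lemma backward_exists N kap lam y : dominates N lam kap -> rl2 N y ->
  exists u, rl2 (N - 1) u /\ forall x, (N <= x)%Z -> diff1 kap lam u x = y x.
Proof.
intros HD [Y HY].
pose proof (fun x => dominates_neq0 N lam kap x HD) as Hn0.
destruct HD as (rho & c & Hrho & Hc & Hkl).
set (U := backward_iter kap lam y).
assert (E : forall n x, (N - 1 <= x)%Z ->
  (lam (x + 1)%Z * U (S n) x + kap (x + 1)%Z * U n (x + 1)%Z)%Cx = y (x + 1)%Z).
{ intros n x Hx; unfold U; cbn [backward_iter]; field; apply Hn0; lia. }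
assert (Hd0 : forall x, (N - 1 <= x)%Z -> Cnorm2 (U 1%nat x - U 0%nat x)%Cx <= Y / c).
{ intros x Hx.
  specialize (E 0%nat x Hx); destruct (Hkl (x + 1)%Z) as [H1 _]; [lia|].
  assert (E2 : (lam (x + 1)%Z * (U 1%nat x - U 0%nat x))%Cx = y (x + 1)%Z)
    by (rewrite <- E; change (U 0%nat (x + 1)%Z) with C0; change (U 0%nat x) with C0; ring).
  apply (f_equal Cnorm2) in E2; rewrite Cnorm2_mul in E2.
  pose proof (zsum_term (sq y) N (Z.to_nat (x + 2 - N)) (x + 1)%Z (sq_ge0 y)) as Ht.
  specialize (HY (Z.to_nat (x + 2 - N))).
  assert (HyY : Cnorm2 (y (x + 1)%Z) <= Y) by (apply Rle_trans with (2 := HY); apply Ht; lia).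
  pose proof (Cnorm2_ge0 (U 1%nat x - U 0%nat x)%Cx).
  apply Rmult_le_reg_l with c; [assumption|].
  replace (c * (Y / c)) with Y by (field; lra).
  apply Rle_trans with (2 := HyY); rewrite <- E2; apply Rmult_le_compat_r; assumption. }
assert (Hd : forall n x, (N - 1 <= x)%Z ->
  Cnorm2 (U (S n) x - U n x)%Cx <= rho ^ n * (Y / c)).
{ induction n as [|n IH]; intros x Hx; [simpl; rewrite Rmult_1_l; apply Hd0, Hx|].
  destruct (Hkl (x + 1)%Z) as [H1 H2]; [lia|].
  assert (E2 : (lam (x + 1)%Z * (U (S (S n)) x - U (S n) x))%Cx
    = (- (kap (x + 1)%Z * (U (S n) (x + 1)%Z - U n (x + 1)%Z)))%Cx).
  { pose proof (E (S n) x Hx) as E1; pose proof (E n x Hx) as E0.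
    rewrite <- E0 in E1.
    transitivity (lam (x + 1)%Z * U (S (S n)) x + kap (x + 1)%Z * U (S n) (x + 1)%Z
       - lam (x + 1)%Z * U (S n) x - kap (x + 1)%Z * U (S n) (x + 1)%Z)%Cx; [ring|].
    rewrite E1; ring. }
  apply (f_equal Cnorm2) in E2; rewrite Cnorm2_opp, !Cnorm2_mul in E2.
  specialize (IH (x + 1)%Z ltac:(lia)).
  set (A := Cnorm2 (U (S (S n)) x - U (S n) x)%Cx) in *.
  set (B := Cnorm2 (U (S n) (x + 1)%Z - U n (x + 1)%Z)%Cx) in *.
  assert (0 <= B) by apply Cnorm2_ge0.
  assert (A <= rho * B).
  { apply Rmult_le_reg_l with (Cnorm2 (lam (x + 1)%Z)); [lra|]; rewrite E2.
    apply Rle_trans with (rho * Cnorm2 (lam (x + 1)%Z) * B); [|right; ring].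
    apply Rmult_le_compat_r; assumption. }
  simpl; rewrite Rmult_assoc; apply Rle_trans with (1 := H0).
  apply Rmult_le_compat_l; lra. }
assert (HYc : 0 <= Y / c).
{ specialize (Hd0 (N - 1)%Z ltac:(lia)).
  pose proof (Cnorm2_ge0 (U 1%nat (N - 1)%Z - U 0%nat (N - 1)%Z)%Cx); lra. }
assert (HL : forall x, exists l, (N - 1 <= x)%Z -> Clim (fun n => U n x) l).
{ intros x; destruct (Z_le_dec (N - 1) x) as [Hx|Hx]; [|exists C0; intros; lia].
  destruct (geometric_Clim (fun n => U n x) (Y / c) rho Hrho HYc) as [l Hl];
    [intros n; apply Hd, Hx|exists l; auto]. }
destruct (ClassicalEpsilon.constructive_indefinite_description
  (fun u : Z -> Cx => forall x, (N - 1 <= x)%Z -> Clim (fun n => U n x) (u x))) as [u Hu].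
{ exists (fun x => proj1_sig (ClassicalEpsilon.constructive_indefinite_description _ (HL x))).
  intros x; apply (proj2_sig (ClassicalEpsilon.constructive_indefinite_description _ (HL x))). }
exists u; split.
- destruct (dominated_step rho c Hrho Hc) as (r & K & Hr & HK & Hstep).
  set (B := K * Y / (1 - r)).
  assert (HY0 : 0 <= Y) by (specialize (HY O); simpl in HY; assumption).
  assert (HB : 0 <= B).
  { unfold B, Rdiv; apply Rmult_le_pos; [nra|apply Rlt_le, Rinv_0_lt_compat; lra]. }
  assert (HU : forall n a m, (N - 1 <= a)%Z -> zsum (sq (U n)) a m <= B).
  { induction n as [|n IH]; intros a m Ha.
    - rewrite zsum_zero; [assumption|]; intros; apply Cnorm2_C0.
    - apply Rle_trans with (zsum (fun x => r * sq (U n) (x + 1)%Z + K * sq y (x + 1)%Z) a m).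
      + apply zsum_le; intros x Hx; unfold sq.
        destruct (Hkl (x + 1)%Z) as [H1 H2]; [lia|].
        apply (Hstep (lam (x + 1)%Z) (kap (x + 1)%Z)); try assumption; apply E; lia.
      + rewrite zsum_plus, (zsum_scal r (fun x => sq (U n) (x + 1)%Z)),
          (zsum_scal K (fun x => sq y (x + 1)%Z)), !zsum_shift.
        specialize (IH (a + 1)%Z m ltac:(lia)).
        assert (zsum (sq y) (a + 1)%Z m <= Y).
        { apply Rle_trans with (zsum (sq y) N (Z.to_nat (a + 1 - N) + m)); [|apply HY].
          apply zsum_incl; [apply sq_ge0|lia|lia]. }
        apply Rle_trans with (r * B + K * Y).
        * apply Rplus_le_compat; apply Rmult_le_compat_l; lra.
        * right; unfold B; field; lra. }
  exists B; intros m.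
  assert (Hlim : is_lim_seq (fun n => zsum (sq (U n)) (N - 1)%Z m) (zsum (sq u) (N - 1)%Z m)).
  { clear HU; induction m as [|m IH]; [apply is_lim_seq_const|].
    apply is_lim_seq_plus'; [exact IH|].
    apply (Clim_Cnorm2 (fun n => U n (N - 1 + Z.of_nat m)%Z)), Hu; lia. }
  apply (is_lim_seq_le _ _ _ (Finite B) (fun n => HU n (N - 1)%Z m ltac:(lia)) Hlim).
  apply is_lim_seq_const.
- intros x Hx; unfold diff1.
  assert (L1 : u (x - 1)%Z = (- (kap x / lam x) * u x + y x / lam x)%Cx).
  { apply (Clim_unique (fun n => U (S n) (x - 1)%Z)).
    - destruct (Hu (x - 1)%Z ltac:(lia)) as [H1 H2]; split.
      + apply (is_lim_seq_incr_1 (fun n => re (U n (x - 1)%Z))), H1.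
      + apply (is_lim_seq_incr_1 (fun n => im (U n (x - 1)%Z))), H2.
    - replace (fun n => U (S n) (x - 1)%Z)
        with (fun n => - (kap x / lam x) * U n x + y x / lam x)%Cx.
      + apply Clim_affine, Hu; lia.
      + apply functional_extensionality; intros n; unfold U; cbn [backward_iter].
        replace (x - 1 + 1)%Z with x by lia; field; apply Hn0, Hx. }
  rewrite L1; field; apply Hn0, Hx.
Qed.

(** Iterating the equation bounds [|u(x)|^2] by [rho^n |u(x + n)|^2], and a square-summable sequence
    is bounded. *)
Lemma backward_unique N kap lam u : dominates N lam kap -> rl2 (N - 1) u ->
  (forall x, (N <= x)%Z -> diff1 kap lam u x = C0) ->
  forall x, (N - 1 <= x)%Z -> u x = C0.
Proof.
intros (rho & c & Hrho & Hc & Hkl) [M HM] H.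
assert (P : forall n x, (N - 1 <= x)%Z -> Cnorm2 (u x) <= rho ^ n * M).
{ induction n as [|n IH]; intros x Hx.
  - simpl; rewrite Rmult_1_l.
    apply Rle_trans with (zsum (sq u) (N - 1)%Z (Z.to_nat (x + 2 - N))); [|apply HM].
    apply (zsum_term (sq u)); [apply sq_ge0|lia].
  - specialize (H (x + 1)%Z ltac:(lia)); unfold diff1 in H.
    replace (x + 1 - 1)%Z with x in H by lia.
    destruct (Hkl (x + 1)%Z) as [H1 H2]; [lia|].
    assert (E : (lam (x + 1)%Z * u x)%Cx = (- (kap (x + 1)%Z * u (x + 1)%Z))%Cx).
    { transitivity ((kap (x + 1)%Z * u (x + 1)%Z + lam (x + 1)%Z * u x)
        - kap (x + 1)%Z * u (x + 1)%Z)%Cx; [ring|rewrite H; ring]. }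
    apply (f_equal Cnorm2) in E; rewrite Cnorm2_opp, !Cnorm2_mul in E.
    specialize (IH (x + 1)%Z ltac:(lia)); pose proof (Cnorm2_ge0 (u (x + 1)%Z)).
    assert (Cnorm2 (u x) <= rho * Cnorm2 (u (x + 1)%Z)).
    { apply Rmult_le_reg_l with (Cnorm2 (lam (x + 1)%Z)); [lra|]; rewrite E.
      apply Rle_trans with (rho * Cnorm2 (lam (x + 1)%Z) * Cnorm2 (u (x + 1)%Z)); [|right; ring].
      apply Rmult_le_compat_r; assumption. }
    simpl; rewrite Rmult_assoc; apply Rle_trans with (1 := H3).
    apply Rmult_le_compat_l; lra. }
intros x Hx; apply Cnorm2_eq0, Rle_antisym; [|apply Cnorm2_ge0].
apply (is_lim_seq_le (fun _ => Cnorm2 (u x)) (fun n => rho ^ n * M) (Finite _) (Finite 0)).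
- intros n; apply P, Hx.
- apply is_lim_seq_const.
- replace (Finite 0) with (Finite (0 * M)) by (f_equal; ring).
  apply is_lim_seq_mult'; [|apply is_lim_seq_const].
  apply is_lim_seq_geom; rewrite Rabs_pos_eq; lra.
Qed.

(** * Half-line index of the supercharge *)

(** The sites [x >= N - 1] are those read by the equations at [x >= N]. Locality lets functionals of
    the two half-lines be imposed independently. *)
Definition local_functional (N : Z) (l : (Z -> Cx) -> Cx) : Prop :=
  (forall c u v, l (fun x => c * u x + v x)%Cx = (c * l u + l v)%Cx) /\
  (forall u v, (forall x, (N - 1 <= x)%Z -> u x = v x) -> l u = l v).

Definition right_bij (N : Z) (T : (Z -> Cx) -> Z -> Cx) (n : nat)
    (l : nat -> (Z -> Cx) -> Cx) : Prop :=
  (forall i, (i < n)%nat -> local_functional N (l i)) /\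
  (forall f c, rl2 N f -> exists u, rl2 (N - 1) u /\
     (forall x, (N <= x)%Z -> T u x = f x) /\ forall i, (i < n)%nat -> l i u = c i) /\
  (forall u, rl2 (N - 1) u -> (forall x, (N <= x)%Z -> T u x = C0) ->
     (forall i, (i < n)%nat -> l i u = C0) -> forall x, (N - 1 <= x)%Z -> u x = C0).

(* On every sufficiently far right half-line, [T] together with [n] boundary
   functionals is a bijection of l2 spaces; so [n] is the index of the
   half-line restriction of [T]. *)
Definition right_tail (T : (Z -> Cx) -> Z -> Cx) (n : nat) : Prop :=
  exists N0, forall N, (N0 <= N)%Z -> exists l, right_bij N T n l.

Lemma right_bij_forward N kap lam : dominates N kap lam ->
  right_bij N (diff1 kap lam) 1 (fun _ u => u (N - 1)%Z).
Proof.
intros HD; split; [|split].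
- intros i _; split; [reflexivity|]; intros u v H; apply H; lia.
- intros f c Hf; destruct (forward_exists N kap lam f (c O) HD Hf) as (u & H1 & H2 & H3).
  exists u; repeat split; try assumption; intros i Hi; replace i with O by lia; assumption.
- intros u _ H1 H2; apply (forward_unique N kap lam); try assumption; apply (H2 O); lia.
Qed.

Lemma right_bij_backward N kap lam l : dominates N lam kap -> right_bij N (diff1 kap lam) 0 l.
Proof.
intros HD; split; [|split].
- intros i Hi; lia.
- intros f c Hf; destruct (backward_exists N kap lam f HD Hf) as (u & H1 & H2).
  exists u; repeat split; try assumption; intros i Hi; lia.
- intros u H1 H2 _; apply (backward_unique N kap lam); assumption.
Qed.

Lemma diff1_lin kap lam c u v x :
  diff1 kap lam (fun y => c * u y + v y)%Cx x = (c * diff1 kap lam u x + diff1 kap lam v x)%Cx.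
Proof. unfold diff1; ring. Qed.

Lemma rl2_shift N t u : rl2 (N + t) u -> rl2 N (fun x => u (x + t)%Z).
Proof.
intros [M HM]; exists M; intros n; unfold sq.
rewrite (zsum_shift (fun x => Cnorm2 (u x))); apply HM.
Qed.

Lemma rl2_diff1 N kap lam u K :
  (forall x, (N <= x)%Z -> Cnorm2 (kap x) <= K /\ Cnorm2 (lam x) <= K) ->
  rl2 (N - 1) u -> rl2 N (diff1 kap lam u).
Proof.
intros HK [M HM]; exists (2 * K * M + 2 * K * M); intros n.
assert (H0 : 0 <= K).
{ destruct (HK N (Z.le_refl N)); pose proof (Cnorm2_ge0 (kap N)); lra. }
apply Rle_trans with (zsum (fun x => 2 * K * sq u x + 2 * K * sq u (x + -1)%Z) N n).
- apply zsum_le; intros x Hx; unfold sq, diff1.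
  pose proof (Cnorm2_add_le (kap x * u x)%Cx (lam x * u (x - 1)%Z)%Cx) as H.
  rewrite !Cnorm2_mul in H.
  destruct (HK x) as [H1 H2]; [lia|].
  replace (x + -1)%Z with (x - 1)%Z by lia.
  pose proof (Cnorm2_ge0 (u x)); pose proof (Cnorm2_ge0 (u (x - 1)%Z)).
  assert (Cnorm2 (kap x) * Cnorm2 (u x) <= K * Cnorm2 (u x)) by (apply Rmult_le_compat_r; assumption).
  assert (Cnorm2 (lam x) * Cnorm2 (u (x - 1)%Z) <= K * Cnorm2 (u (x - 1)%Z)) by (apply Rmult_le_compat_r; assumption).
  lra.
- rewrite zsum_plus, !zsum_scal, zsum_shift.
  assert (zsum (sq u) N n <= M).
  { apply Rle_trans with (zsum (sq u) (N - 1)%Z (S n)); [|apply HM].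
    apply zsum_incl; [apply sq_ge0|lia|lia]. }
  specialize (HM n); replace (N + -1)%Z with (N - 1)%Z by lia.
  apply Rplus_le_compat; apply Rmult_le_compat_l; lra.
Qed.

(** The composition is inverted from the outside in: [A] determines an intermediate sequence [v],
    then [u] solves the first-order equation for [v]. The shift by one makes the equations of
    [diff1] at [x >= N] produce exactly the sites [>= N - 1] on which solutions of [A] live. The
    functionals of [A] are read on the intermediate sequence. *)
Lemma right_bij_comp N T A nA lA kap lam nB lB K :
  (forall u x, (N <= x)%Z -> T u x = A (fun y => diff1 kap lam u (y + 1)%Z) x) ->
  (forall u v, (forall x, (N - 1 <= x)%Z -> u x = v x) -> forall x, (N <= x)%Z -> A u x = A v x) ->
  (forall x, (N <= x)%Z -> Cnorm2 (kap x) <= K /\ Cnorm2 (lam x) <= K) ->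
  right_bij N A nA lA -> right_bij N (diff1 kap lam) nB lB ->
  exists l, right_bij N T (nA + nB) l.
Proof.
intros HT HA HK (A1 & A2 & A3) (B1 & B2 & B3).
exists (fun i u => if (i <? nA)%nat then lA i (fun y => diff1 kap lam u (y + 1)%Z)
                   else lB (i - nA)%nat u).
split; [|split].
- intros i Hi; destruct (i <? nA)%nat eqn:E.
  + apply Nat.ltb_lt in E; destruct (A1 i E) as [L1 L2]; split.
    * intros c u v; rewrite <- L1; apply L2; intros x _; apply diff1_lin.
    * intros u v H; apply L2; intros x Hx; unfold diff1; rewrite !H by lia; reflexivity.
  + apply Nat.ltb_ge in E; apply B1; lia.
- intros f c Hf.
  destruct (A2 f c Hf) as (v & V1 & V2 & V3).
  destruct (B2 (fun x => v (x - 1)%Z) (fun i => c (i + nA)%nat)) as (u & U1 & U2 & U3).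
  { apply (rl2_shift N (-1) v), V1. }
  assert (Ev : forall x, (N - 1 <= x)%Z -> diff1 kap lam u (x + 1)%Z = v x).
  { intros x Hx; rewrite U2 by lia; f_equal; lia. }
  exists u; split; [assumption|]; split.
  + intros x Hx; rewrite HT, <- V2 by assumption; apply HA; assumption.
  + intros i Hi; destruct (i <? nA)%nat eqn:E.
    * apply Nat.ltb_lt in E; rewrite <- V3 by assumption.
      apply (proj2 (A1 i E)), Ev.
    * apply Nat.ltb_ge in E; rewrite U3 by lia; f_equal; lia.
- intros u Hu HTu Hl.
  assert (Ev : forall x, (N - 1 <= x)%Z -> diff1 kap lam u (x + 1)%Z = C0).
  { apply (A3 (fun y => diff1 kap lam u (y + 1)%Z)).
    - apply rl2_shift; replace (N - 1 + 1)%Z with N by lia; apply (rl2_diff1 _ _ _ _ K); assumption.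
    - intros x Hx; rewrite <- HT by assumption; apply HTu, Hx.
    - intros i Hi; specialize (Hl i ltac:(lia)); apply Nat.ltb_lt in Hi; rewrite Hi in Hl; exact Hl. }
  apply B3; [assumption| |].
  + intros x Hx; rewrite <- (Ev (x - 1)%Z) by lia; f_equal; lia.
  + intros i Hi; specialize (Hl (i + nA)%nat ltac:(lia)).
    replace (i + nA <? nA)%nat with false in Hl by (symmetry; apply Nat.ltb_ge; lia).
    replace (i + nA - nA)%nat with i in Hl by lia; exact Hl.
Qed.

(** * Factorisation of the supercharge near infinity *)

Definition tri (al be ga u : Z -> Cx) (x : Z) : Cx :=
  (al x * u (x + 1)%Z + be x * u x + ga x * u (x - 1)%Z)%Cx.

(* Up to the constant [c], the supercharge read through the coordinates
   [psi = (u(x), k u(x-1))] of the +1 eigenspace of Gamma. *)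
Definition charge (c k : Cx) (a1 a2 : Z -> R) (b : Z -> Cx) : (Z -> Cx) -> Z -> Cx :=
  tri (fun x => c * b (x + 1)%Z)%Cx
      (fun x => c * (k * Cr (a2 (x + 1)%Z - a1 x)))%Cx
      (fun x => - (c * (k * k * Cconj (b x))))%Cx.

Definition coin_ok (a1 a2 : Z -> R) (b : Z -> Cx) : Prop :=
  forall x, a1 x ^ 2 + Cnorm2 (b x) = 1 /\ a2 x ^ 2 + Cnorm2 (b x) = 1 /\
    Cmul (b x) (Cr (a1 x + a2 x)) = C0.

Lemma lim_plus_affine f l m d : lim_plus f l -> lim_plus (fun x => m * f x + d) (m * l + d).
Proof.
intros H eps Heps.
destruct (H (eps / (Rabs m + 1))) as [N HN].
{ apply Rdiv_lt_0_compat; [assumption|]; pose proof (Rabs_pos m); lra. }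
exists N; intros x Hx; specialize (HN x Hx).
replace (m * f x + d - (m * l + d)) with (m * (f x - l)) by ring.
rewrite Rabs_mult.
pose proof (Rabs_pos m); pose proof (Rabs_pos (f x - l)).
apply Rlt_div_r in HN; [nra|lra].
Qed.

Lemma lim_plus_shift f l t : lim_plus f l -> lim_plus (fun x => f (x + t)%Z) l.
Proof.
intros H eps Heps; destruct (H eps Heps) as [N HN].
exists (N - t)%Z; intros x Hx; apply HN; lia.
Qed.

Lemma lim_plus_ext f g l : (forall x, f x = g x) -> lim_plus f l -> lim_plus g l.
Proof.
intros E H eps Heps; destruct (H eps Heps) as [N HN]; exists N; intros x Hx.
rewrite <- E; apply HN, Hx.
Qed.

Lemma dominates_of_lim kap lam K L : 0 <= L < K ->
  lim_plus (fun x => Cnorm2 (kap x)) K -> lim_plus (fun x => Cnorm2 (lam x)) L ->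
  exists N0, forall N, (N0 <= N)%Z -> dominates N kap lam.
Proof.
intros HKL H1 H2; set (e := (K - L) / 3); assert (He : 0 < e) by (unfold e; lra).
destruct (H1 e He) as [N1 HN1]; destruct (H2 e He) as [N2 HN2].
exists (Z.max N1 N2); intros N HN; exists ((L + e) / (K - e)), (K - e).
assert (HKe : 0 < K - e) by (unfold e; lra).
split; [split|split].
- apply Rdiv_le_0_compat; unfold e in *; lra.
- apply Rlt_div_l; unfold e in *; lra.
- assumption.
- intros x Hx; specialize (HN1 x ltac:(lia)); specialize (HN2 x ltac:(lia)).
  apply Rabs_def2 in HN1; apply Rabs_def2 in HN2; split; [lra|].
  apply Rle_trans with (L + e); [lra|].
  apply Rle_trans with ((L + e) / (K - e) * (K - e)); [right; field; lra|].
  apply Rmult_le_compat_l; [|lra].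
  apply Rdiv_le_0_compat; lra.
Qed.

Definition chi1 (a : R) : Cx := Cr (sqrt ((1 + a) / 2)).
(** At [a = -1] the quotient would divide by zero; the eigenvector is then [(0, 1)]. *)
Definition chi2 (a : R) (b : Cx) : Cx :=
  if Req_dec_T a (-1) then C1 else (b / (Cr 2 * chi1 a))%Cx.

Lemma sq_le1_bounds a t : 0 <= t -> a ^ 2 + t = 1 -> -1 <= a <= 1.
Proof. intros; nra. Qed.

(* (chi1, chi2) is a unit vector spanning the +1 eigenspace of the coin. *)
Lemma chi_spec a b : a ^ 2 + Cnorm2 b = 1 ->
  Cnorm2 (chi1 a) = (1 + a) / 2 /\ Cnorm2 (chi2 a b) = (1 - a) / 2 /\
  Cmul (Cr 2) (chi2 a b * Cconj (chi1 a)) = b /\ Cconj (chi1 a) = chi1 a.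
Proof.
intros H; pose proof (sq_le1_bounds a _ (Cnorm2_ge0 b) H) as Ha.
assert (E1 : Cnorm2 (chi1 a) = (1 + a) / 2).
{ unfold Cnorm2, chi1; simpl; rewrite sqrt_sqrt; lra. }
assert (E4 : Cconj (chi1 a) = chi1 a) by (apply Cx_ext; simpl; ring).
split; [assumption|]; split; [|split; [|assumption]].
- unfold chi2; destruct (Req_dec_T a (-1)) as [->|Hn].
  + unfold Cnorm2; simpl; lra.
  + assert (Hc : Cmul (Cr 2) (chi1 a) <> C0).
    { intros E; apply (f_equal Cnorm2) in E; rewrite Cnorm2_mul, E1, Cnorm2_C0 in E.
      unfold Cnorm2 in E; simpl in E; lra. }
    apply Rmult_eq_reg_l with (2 * (1 + a)); [|lra].
    transitivity (Cnorm2 (Cmul (Cr 2) (chi1 a) * (b / (Cr 2 * chi1 a)))%Cx).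
    * rewrite !Cnorm2_mul, E1; unfold Cnorm2 at 2; simpl; field.
    * replace (Cmul (Cr 2) (chi1 a) * (b / (Cr 2 * chi1 a)))%Cx with b.
      -- transitivity (1 - a ^ 2); [lra|field].
      -- field; split; intros E; apply Hc; rewrite E; ring.
- rewrite E4; unfold chi2; destruct (Req_dec_T a (-1)) as [->|Hn].
  + assert (b = C0) as -> by (apply Cnorm2_eq0; lra).
    apply Cx_ext; unfold chi1; simpl; replace ((1 + -1) / 2) with 0 by field; rewrite sqrt_0; ring.
  + assert (Hc : chi1 a <> C0).
    { intros E; rewrite E, Cnorm2_C0 in E1; lra. }
    field; split; [assumption|]; intros E; apply (f_equal re) in E; simpl in E; lra.
Qed.

(** With [s = |k|^2], the number of roots of the limit symbol inside the unit disc: their squared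
    moduli are [s (1 + a) / (1 - a)] and [s (1 - a) / (1 + a)], compared with 1 without division
    because [a = 1] and [a = -1] are allowed. *)
Definition tail_dim (s a : R) : nat :=
  ((if Rlt_dec (s * (1 + a)) (1 - a) then 1 else 0) +
   (if Rlt_dec (s * (1 - a)) (1 + a) then 1 else 0))%nat.

(** If [Gamma psi = psi] then [[Gamma, C] psi = (Gamma - 1) (C + 1) psi], and where [a2 = - a1] the
    matrix [C + 1] is twice the projection onto [chi]. The inner factor [kB], [lB] takes the inner
    product of [chi(x)] with [(u(x), k u(x - 1))]; the outer factor [kA], [lA] sends multiples of
    [chi] by [(Gamma - 1) / i] into the coordinate of the -1 eigenspace. *)
Lemma charge_right_tail c k a1 a2 b a : c <> C0 -> k <> C0 -> coin_ok a1 a2 b ->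
  lim_plus a1 a -> (exists N, forall x, (N <= x)%Z -> a2 x = - a1 x) ->
  Cnorm2 k * (1 - a) <> 1 + a -> Cnorm2 k * (1 + a) <> 1 - a ->
  right_tail (charge c k a1 a2 b) (tail_dim (Cnorm2 k) a).
Proof.
intros Hc Hk Hok Hlim [N1 HN1] Hn1 Hn2.
pose proof (fun x => chi_spec (a1 x) (b x) (proj1 (Hok x))) as Hchi.
pose proof (Cnorm2_gt0 c Hc) as Gc; pose proof (Cnorm2_gt0 k Hk) as Gk.
set (s := Cnorm2 k) in *.
set (kB := fun x => Cconj (chi1 (a1 x))).
set (lB := fun x => (k * Cconj (chi2 (a1 x) (b x)))%Cx).
set (kA := fun x => (c * (Cr 2 * chi2 (a1 (x + 1)%Z) (b (x + 1)%Z)))%Cx).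
set (lA := fun x => (- (c * (Cr 2 * (k * chi1 (a1 x)))))%Cx).
assert (E2 : Cnorm2 (Cr 2) = 4) by (unfold Cnorm2; simpl; ring).
assert (Hfac : forall u x, (N1 <= x)%Z ->
  charge c k a1 a2 b u x = diff1 kA lA (fun y => diff1 kB lB u (y + 1)%Z) x).
{ intros u x Hx; unfold charge, tri, diff1, kA, lA, kB, lB.
  replace (x - 1 + 1)%Z with x by lia; replace (x + 1 - 1)%Z with x by lia.
  destruct (Hchi x) as (A1 & A2 & A3 & A4).
  destruct (Hchi (x + 1)%Z) as (B1 & B2 & B3 & B4).
  rewrite HN1 by lia.
  set (f := chi1 (a1 x)) in *; set (g := chi2 (a1 x) (b x)) in *.
  set (f' := chi1 (a1 (x + 1)%Z)) in *; set (g' := chi2 (a1 (x + 1)%Z) (b (x + 1)%Z)) in *.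
  clearbody f g f' g'.
  assert (A5 : (Cr 2 * (Cconj g * f))%Cx = Cconj (b x)).
  { rewrite <- A3; apply Cx_ext; simpl; ring. }
  assert (A6 : (Cr 2 * (f * Cconj f))%Cx = Cr (1 + a1 x)).
  { apply Cx_ext; unfold Cnorm2 in A1; simpl; [|ring].
    transitivity (2 * (re f * re f + im f * im f)); [ring|rewrite A1; field]. }
  assert (B6 : (Cr 2 * (g' * Cconj g'))%Cx = Cr (1 - a1 (x + 1)%Z)).
  { apply Cx_ext; unfold Cnorm2 in B2; simpl; [|ring].
    transitivity (2 * (re g' * re g' + im g' * im g')); [ring|rewrite B2; field]. }
  rewrite <- A5, <- B3.
  (* The middle coefficient splits as [(1 - a1(x + 1)) - (1 + a1(x))], that is
     [2 |chi2(x + 1)|^2 - 2 |chi1(x)|^2]. *)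
  replace (Cr (- a1 (x + 1)%Z - a1 x)) with
    (Cr 2 * (g' * Cconj g') - Cr 2 * (f * Cconj f))%Cx.
  - ring.
  - rewrite A6, B6; apply Cx_ext; simpl; ring. }
assert (LkB : lim_plus (fun x => Cnorm2 (kB x)) ((1 + a) / 2)).
{ apply lim_plus_ext with (fun x => / 2 * a1 x + / 2).
  - intros x; unfold kB; rewrite Cnorm2_conj, (proj1 (Hchi x)); field.
  - replace ((1 + a) / 2) with (/ 2 * a + / 2) by field; apply lim_plus_affine, Hlim. }
assert (LlB : lim_plus (fun x => Cnorm2 (lB x)) (s * ((1 - a) / 2))).
{ apply lim_plus_ext with (fun x => (- s / 2) * a1 x + s / 2).
  - intros x; unfold lB; rewrite Cnorm2_mul, Cnorm2_conj, (proj1 (proj2 (Hchi x))); fold s; field.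
  - replace (s * ((1 - a) / 2)) with ((- s / 2) * a + s / 2) by field; apply lim_plus_affine, Hlim. }
assert (LkA : lim_plus (fun x => Cnorm2 (kA x)) (2 * Cnorm2 c * (1 - a))).
{ apply lim_plus_ext with (fun x => (- 2 * Cnorm2 c) * a1 (x + 1)%Z + 2 * Cnorm2 c).
  - intros x; unfold kA; rewrite !Cnorm2_mul, (proj1 (proj2 (Hchi (x + 1)%Z))), E2; field.
  - replace (2 * Cnorm2 c * (1 - a)) with ((- 2 * Cnorm2 c) * a + 2 * Cnorm2 c) by ring.
    apply (lim_plus_affine (fun x => a1 (x + 1)%Z)), lim_plus_shift, Hlim. }
assert (LlA : lim_plus (fun x => Cnorm2 (lA x)) (2 * Cnorm2 c * (s * (1 + a)))).
{ apply lim_plus_ext with (fun x => (2 * Cnorm2 c * s) * a1 x + 2 * Cnorm2 c * s).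
  - intros x; unfold lA; rewrite Cnorm2_opp, !Cnorm2_mul, (proj1 (Hchi x)), E2; fold s; field.
  - replace (2 * Cnorm2 c * (s * (1 + a))) with ((2 * Cnorm2 c * s) * a + 2 * Cnorm2 c * s) by ring.
    apply lim_plus_affine, Hlim. }
assert (Ha : -1 <= a <= 1).
{ assert (Hb : forall x, -1 <= a1 x <= 1)
    by (intros x; apply (sq_le1_bounds _ _ (Cnorm2_ge0 (b x))), (Hok x)).
  split; apply Rnot_lt_le; intros Hlt.
  - destruct (Hlim (-1 - a)) as [N HN]; [lra|]; specialize (HN N (Z.le_refl N)).
    apply Rabs_def2 in HN; specialize (Hb N); lra.
  - destruct (Hlim (a - 1)) as [N HN]; [lra|]; specialize (HN N (Z.le_refl N)).
    apply Rabs_def2 in HN; specialize (Hb N); lra. }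
assert (HA : exists N0, forall N, (N0 <= N)%Z -> exists l,
  right_bij N (diff1 kA lA) (if Rlt_dec (s * (1 + a)) (1 - a) then 1 else 0) l).
{ destruct (Rlt_dec (s * (1 + a)) (1 - a)) as [Hlt|Hge].
  - assert (HH : 0 <= 2 * Cnorm2 c * (s * (1 + a)) < 2 * Cnorm2 c * (1 - a)).
    { split; [repeat apply Rmult_le_pos; lra|apply Rmult_lt_compat_l; lra]. }
    destruct (dominates_of_lim kA lA _ _ HH LkA LlA) as [N0 HN0]; exists N0; intros N HN; eexists; apply right_bij_forward, HN0, HN.
  - assert (Hlt : 1 - a < s * (1 + a)) by lra.
    assert (HH : 0 <= 2 * Cnorm2 c * (1 - a) < 2 * Cnorm2 c * (s * (1 + a))).
    { split; [repeat apply Rmult_le_pos; lra|apply Rmult_lt_compat_l; lra]. }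
    destruct (dominates_of_lim lA kA _ _ HH LlA LkA) as [N0 HN0]; exists N0; intros N HN; exists (fun _ _ => C0); apply right_bij_backward, HN0, HN. }
assert (HB : exists N0, forall N, (N0 <= N)%Z -> exists l,
  right_bij N (diff1 kB lB) (if Rlt_dec (s * (1 - a)) (1 + a) then 1 else 0) l).
{ destruct (Rlt_dec (s * (1 - a)) (1 + a)) as [Hlt|Hge].
  - assert (HH : 0 <= s * ((1 - a) / 2) < (1 + a) / 2) by (split; nra).
    destruct (dominates_of_lim kB lB _ _ HH LkB LlB) as [N0 HN0]; exists N0; intros N HN; eexists; apply right_bij_forward, HN0, HN.
  - assert (Hlt : 1 + a < s * (1 - a)) by lra.
    assert (HH : 0 <= (1 + a) / 2 < s * ((1 - a) / 2)) by (split; nra).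
    destruct (dominates_of_lim lB kB _ _ HH LlB LkB) as [N0 HN0]; exists N0; intros N HN; exists (fun _ _ => C0); apply right_bij_backward, HN0, HN. }
destruct HA as [NA HA]; destruct HB as [NB HB].
exists (Z.max N1 (Z.max NA NB)); intros N HN.
destruct (HA N ltac:(lia)) as [lfA RA]; destruct (HB N ltac:(lia)) as [lfB RB].
apply (right_bij_comp N _ (diff1 kA lA) _ lfA kB lB _ lfB (1 + s)).
- intros u x Hx; apply Hfac; lia.
- intros u v H x Hx; unfold diff1; rewrite !H by lia; reflexivity.
- intros x _; destruct (Hchi x) as (A1 & A2 & _).
  pose proof (sq_le1_bounds _ _ (Cnorm2_ge0 (b x)) (proj1 (Hok x))).
  unfold kB, lB; rewrite Cnorm2_mul, !Cnorm2_conj, A1, A2; fold s; split; nra.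
- exact RA.
- exact RB.
Qed.

(** * Index of tridiagonal operators *)

Lemma csum_ext n f g : (forall i, (i < n)%nat -> f i = g i) -> csum n f = csum n g.
Proof.
induction n as [|n IH]; simpl; intros H; [reflexivity|].
rewrite IH, H; auto with arith.
Qed.

Lemma csum_0 n : csum n (fun _ => C0) = C0.
Proof. induction n as [|n IH]; simpl; [reflexivity|rewrite IH; ring]. Qed.

Lemma csum_delta n (f : nat -> Cx) j : (j < n)%nat ->
  csum n (fun i => f i * (if Nat.eq_dec i j then C1 else C0))%Cx = f j.
Proof.
induction n as [|n IH]; [lia|]; intros Hj; simpl.
destruct (Nat.eq_dec n j) as [->|Hn].
- rewrite (csum_ext j _ (fun _ => C0)), csum_0; [ring|].
  intros i Hi; destruct (Nat.eq_dec i j); [lia|ring].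
- rewrite IH by lia; ring.
Qed.

Lemma csum_scal n c f : csum n (fun i => c * f i)%Cx = (c * csum n f)%Cx.
Proof. induction n as [|n IH]; simpl; [|rewrite IH]; ring. Qed.

Lemma csum_add n f g : csum n (fun i => f i + g i)%Cx = (csum n f + csum n g)%Cx.
Proof. induction n as [|n IH]; simpl; [|rewrite IH]; ring. Qed.

Lemma csum_swap n m (f : nat -> nat -> Cx) :
  csum n (fun i => csum m (fun j => f i j)) = csum m (fun j => csum n (fun i => f i j)).
Proof.
induction n as [|n IH]; simpl; [symmetry; apply csum_0|].
rewrite IH, <- csum_add; reflexivity.
Qed.

Lemma Cconj_csum n f : Cconj (csum n f) = csum n (fun i => Cconj (f i)).
Proof.
induction n as [|n IH]; simpl; [apply Cx_ext; simpl; ring|].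
rewrite <- IH; apply Cx_ext; simpl; ring.
Qed.

Lemma re_csum n (g : Z -> Cx) a :
  re (csum n (fun j => g (a + Z.of_nat j)%Z)) = zsum (fun x => re (g x)) a n.
Proof. induction n as [|n IH]; simpl; [|rewrite IH]; reflexivity. Qed.

Lemma im_csum n (g : Z -> Cx) a :
  im (csum n (fun j => g (a + Z.of_nat j)%Z)) = zsum (fun x => im (g x)) a n.
Proof. induction n as [|n IH]; simpl; [|rewrite IH]; reflexivity. Qed.

Definition is_linear (l : (Z -> Cx) -> Cx) : Prop :=
  forall c u v, l (fun x => c * u x + v x)%Cx = (c * l u + l v)%Cx.

Lemma is_linear_0 l : is_linear l -> l (fun _ => C0) = C0.
Proof.
intros H; transitivity (- C1 * l (fun _ => C0) + l (fun _ => C0))%Cx; [|ring].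
rewrite <- H; f_equal; apply functional_extensionality; intros; ring.
Qed.

Lemma is_linear_csum l n c (u : nat -> Z -> Cx) : is_linear l ->
  l (fun x => csum n (fun i => c i * u i x)%Cx) = csum n (fun i => c i * l (u i))%Cx.
Proof.
intros H; induction n as [|n IH]; simpl; [apply is_linear_0, H|].
rewrite <- IH.
replace (fun x => (csum n (fun i => c i * u i x) + c n * u n x)%Cx)
  with (fun x => (c n * u n x + csum n (fun i => c i * u i x))%Cx)
  by (apply functional_extensionality; intros; ring).
rewrite H; ring.
Qed.

Lemma tri_linear al be ga x : is_linear (fun u => tri al be ga u x).
Proof. intros c u v; unfold tri; ring. Qed.

Lemma tri_csum al be ga n c (u : nat -> Z -> Cx) x :
  tri al be ga (fun y => csum n (fun i => c i * u i y)%Cx) x =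
  csum n (fun i => c i * tri al be ga (u i) x)%Cx.
Proof. apply (is_linear_csum (fun v => tri al be ga v x)), tri_linear. Qed.

Lemma tri_sub al be ga u v x :
  tri al be ga (fun y => u y - v y)%Cx x = (tri al be ga u x - tri al be ga v x)%Cx.
Proof. unfold tri; ring. Qed.

Lemma tri_add al be ga u v x :
  tri al be ga (fun y => u y + v y)%Cx x = (tri al be ga u x + tri al be ga v x)%Cx.
Proof. unfold tri; ring. Qed.

Definition tri_bounded (al be ga : Z -> Cx) : Prop :=
  exists B, forall x, Cnorm2 (al x) <= B /\ Cnorm2 (be x) <= B /\ Cnorm2 (ga x) <= B.

Lemma tri_sl2 al be ga u : tri_bounded al be ga -> sl2 u -> sl2 (tri al be ga u).
Proof.
intros [B HB] Hu; unfold tri.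
apply (sl2_add (fun x => al x * u (x + 1)%Z + be x * u x)%Cx);
  [apply (sl2_add (fun x => al x * u (x + 1)%Z)%Cx)|].
- apply (sl2_bounded_mul B al); [apply HB|apply sl2_shift, Hu].
- apply (sl2_bounded_mul B be); [apply HB|exact Hu].
- apply (sl2_bounded_mul B ga); [apply HB|apply (sl2_shift (-1)), Hu].
Qed.

Definition tri_reflect (al be ga : Z -> Cx) : (Z -> Cx) -> Z -> Cx :=
  tri (reflect ga) (reflect be) (reflect al).

Lemma tri_reflectE al be ga u x :
  tri_reflect al be ga (reflect u) x = tri al be ga u (- x)%Z.
Proof.
unfold tri_reflect, tri, reflect.
replace (- (x + 1))%Z with (- x - 1)%Z by lia; replace (- (x - 1))%Z with (- x + 1)%Z by lia; ring.
Qed.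

Definition tri_adj (al be ga : Z -> Cx) : (Z -> Cx) -> Z -> Cx :=
  tri (fun x => Cconj (ga (x + 1)%Z)) (fun x => Cconj (be x)) (fun x => Cconj (al (x - 1)%Z)).

Definition outside (K x : Z) : Prop := (x <= - K \/ K <= x)%Z.

(* [T], observed outside the window [-K < x < K], together with [n]
   functionals is a bijection; the window has [2K-1] sites, so [T] has index
   [n - (2K-1)]. *)
Definition aug_bij (T : (Z -> Cx) -> Z -> Cx) (K : Z) (n : nat)
    (l : nat -> (Z -> Cx) -> Cx) : Prop :=
  (forall i, (i < n)%nat -> is_linear (l i)) /\
  (forall f c, sl2 f -> exists u, sl2 u /\
     (forall x, outside K x -> T u x = f x) /\ forall i, (i < n)%nat -> l i u = c i) /\
  (forall u, sl2 u -> (forall x, outside K x -> T u x = C0) ->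
     (forall i, (i < n)%nat -> l i u = C0) -> forall x, u x = C0).

(** Equations at [|x| >= K] read only sites [|x| >= K - 1], which the two half-line problems
    determine. The remaining [2 K - 3] sites, from [2 - K] to [K - 2], are free, and their values
    serve as further functionals. *)
Lemma aug_bij_of_tails al be ga K nL nR lL lR : (2 <= K)%Z ->
  right_bij K (tri al be ga) nR lR -> right_bij K (tri_reflect al be ga) nL lL ->
  exists l, aug_bij (tri al be ga) K (nR + nL + Z.to_nat (2 * K - 3)) l.
Proof.
intros HK (R1 & R2 & R3) (L1 & L2 & L3).
exists (fun i u => if (i <? nR)%nat then lR i u
  else if (i <? nR + nL)%nat then lL (i - nR)%nat (reflect u)
  else u (2 - K + Z.of_nat (i - nR - nL))%Z).
split; [|split].
- intros i Hi c u v; destruct (i <? nR)%nat eqn:E1.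
  { apply Nat.ltb_lt in E1; apply (R1 i E1). }
  apply Nat.ltb_ge in E1; destruct (i <? nR + nL)%nat eqn:E2; [|reflexivity].
  apply Nat.ltb_lt in E2; destruct (L1 (i - nR)%nat ltac:(lia)) as [L _]; rewrite <- L; reflexivity.
- intros f c Hf.
  destruct (R2 f c (sl2_rl2 _ _ Hf)) as (uR & A1 & A2 & A3).
  destruct (L2 (reflect f) (fun i => c (i + nR)%nat) (sl2_rl2 _ _ (sl2_reflect _ Hf)))
    as (uL & B1 & B2 & B3).
  set (u := fun x => if Z_le_dec (K - 1) x then uR x
     else if Z_le_dec x (1 - K) then uL (- x)%Z
     else c (nR + nL + Z.to_nat (x + K - 2))%nat).
  assert (ER : forall x, (K - 1 <= x)%Z -> u x = uR x).
  { intros x Hx; unfold u; destruct (Z_le_dec (K - 1) x); [reflexivity|lia]. }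
  assert (EL : forall x, (K - 1 <= x)%Z -> reflect u x = uL x).
  { intros x Hx; unfold u, reflect; destruct (Z_le_dec (K - 1) (- x)); [lia|].
    destruct (Z_le_dec (- x) (1 - K)); [f_equal; lia|lia]. }
  exists u; split; [|split].
  + apply (sl2_of_halves (K - 1) (K - 1)).
    * apply (rl2_ext _ uR); [intros; symmetry; apply ER; assumption|assumption].
    * apply (rl2_ext _ uL); [intros; symmetry; apply EL; assumption|assumption].
  + intros x [Hx|Hx].
    * replace x with (- - x)%Z by lia; rewrite <- tri_reflectE.
      transitivity (reflect f (- x)%Z); [|unfold reflect; f_equal; lia].
      rewrite <- B2 by lia; unfold tri_reflect, tri; rewrite !EL by lia; reflexivity.
    * rewrite <- A2 by lia; unfold tri; rewrite !ER by lia; reflexivity.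
  + intros i Hi; destruct (i <? nR)%nat eqn:E1.
    { apply Nat.ltb_lt in E1; rewrite <- A3 by assumption; apply (R1 i E1), ER. }
    apply Nat.ltb_ge in E1; destruct (i <? nR + nL)%nat eqn:E2.
    * apply Nat.ltb_lt in E2.
      transitivity (lL (i - nR)%nat uL); [apply (L1 (i - nR)%nat ltac:(lia)), EL|].
      rewrite B3 by lia; f_equal; lia.
    * apply Nat.ltb_ge in E2; unfold u.
      destruct (Z_le_dec (K - 1) (2 - K + Z.of_nat (i - nR - nL))); [lia|].
      destruct (Z_le_dec (2 - K + Z.of_nat (i - nR - nL)) (1 - K)); [lia|].
      f_equal; lia.
- intros u Hu HT Hl.
  assert (ZR : forall x, (K - 1 <= x)%Z -> u x = C0).
  { apply R3.
    - apply sl2_rl2, Hu.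
    - intros x Hx; apply HT; right; assumption.
    - intros i Hi; specialize (Hl i ltac:(lia)).
      apply Nat.ltb_lt in Hi; rewrite Hi in Hl; exact Hl. }
  assert (ZL : forall x, (K - 1 <= x)%Z -> reflect u x = C0).
  { apply L3.
    - apply sl2_rl2, sl2_reflect, Hu.
    - intros x Hx; rewrite tri_reflectE; apply HT; left; lia.
    - intros i Hi; specialize (Hl (i + nR)%nat ltac:(lia)).
      replace (i + nR <? nR)%nat with false in Hl by (symmetry; apply Nat.ltb_ge; lia).
      replace (i + nR <? nR + nL)%nat with true in Hl by (symmetry; apply Nat.ltb_lt; lia).
      replace (i + nR - nR)%nat with i in Hl by lia; exact Hl. }
  intros x; destruct (Z_le_dec (K - 1) x) as [Hx|Hx]; [apply ZR, Hx|].
  destruct (Z_le_dec x (1 - K)) as [Hx'|Hx'].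
  { specialize (ZL (- x)%Z ltac:(lia)); unfold reflect in ZL.
    replace (- - x)%Z with x in ZL by lia; exact ZL. }
  specialize (Hl (nR + nL + Z.to_nat (x + K - 2))%nat ltac:(lia)); cbv beta in Hl.
  replace (nR + nL + Z.to_nat (x + K - 2) <? nR)%nat with false in Hl
    by (symmetry; apply Nat.ltb_ge; lia).
  replace (nR + nL + Z.to_nat (x + K - 2) <? nR + nL)%nat with false in Hl
    by (symmetry; apply Nat.ltb_ge; lia).
  rewrite <- Hl; f_equal; lia.
Qed.

(** * Green's formula and orthogonality to the kernel of the adjoint *)

Definition dot (z w : Cx) : R := re z * re w + im z * im w.

Lemma Rabs_dot_le d z w : 0 < d -> Rabs (dot z w) <= d * Cnorm2 z + / d * Cnorm2 w.
Proof.
intros Hd; assert (Hi : 0 < / d) by (apply Rinv_0_lt_compat, Hd).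
assert (Q : forall s a b, s * s = 1 -> s * (a * b) <= (d * (a * a) + / d * (b * b)) / 2).
{ intros s a b Hs.
  assert (0 <= / d * ((d * a - s * b) * (d * a - s * b)))
    by (apply Rmult_le_pos; [lra|apply Rle_0_sqr]).
  replace (/ d * ((d * a - s * b) * (d * a - s * b)))
    with (d * (a * a) - 2 * (s * (a * b)) + (s * s) * (/ d * (b * b))) in H by (field; lra).
  rewrite Hs in H; lra. }
pose proof (Cnorm2_ge0 z); pose proof (Cnorm2_ge0 w).
assert (0 <= d * Cnorm2 z) by (apply Rmult_le_pos; lra).
assert (0 <= / d * Cnorm2 w) by (apply Rmult_le_pos; lra).
unfold dot, Cnorm2 in *; apply Rabs_le; split.
- pose proof (Q (-1) (re z) (re w) ltac:(ring)); pose proof (Q (-1) (im z) (im w) ltac:(ring)); lra.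
- pose proof (Q 1 (re z) (re w) ltac:(ring)); pose proof (Q 1 (im z) (im w) ltac:(ring)); lra.
Qed.

Lemma zsum_telescope (J : Z -> R) a n :
  zsum (fun x => J x - J (x - 1)%Z) a n = J (a + Z.of_nat n - 1)%Z - J (a - 1)%Z.
Proof.
induction n as [|n IH]; [simpl; rewrite Z.add_0_r; ring|].
simpl zsum; rewrite IH.
replace (a + Z.of_nat (S n) - 1)%Z with (a + Z.of_nat n)%Z by lia; ring.
Qed.

Definition window (L : nat) (f : Z -> R) : R := zsum f (- Z.of_nat L)%Z (2 * L + 1).

(* Green's formula: for [w] in the kernel of the adjoint, [<w, Tu>] over a
   window reduces to boundary terms. *)
Lemma green_vanishes al be ga u w : tri_bounded al be ga -> sl2 u -> sl2 w ->
  (forall x, tri_adj al be ga w x = C0) ->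
  forall eps, 0 < eps -> exists L0, forall L, (L0 <= L)%nat ->
    Rabs (window L (fun x => dot (w x) (tri al be ga u x))) <= eps.
Proof.
intros [B HB] [Mu HMu] [Mw HMw] Hw eps Heps.
assert (B0 : 0 <= B) by (destruct (HB 0%Z); pose proof (Cnorm2_ge0 (al 0%Z)); lra).
(* The flux between [x] and [x + 1]: its difference is the local density of [<w, T u> - <T* w, u>],
   so the sum telescopes. *)
set (J := fun x => dot (w x) (al x * u (x + 1)%Z)%Cx - dot (w (x + 1)%Z) (ga (x + 1)%Z * u x)%Cx).
assert (EJ : forall x, dot (w x) (tri al be ga u x) = J x - J (x - 1)%Z).
{ intros x; transitivity (J x - J (x - 1)%Z + dot (tri_adj al be ga w x) (u x)).
  - unfold J, tri_adj, tri, dot; replace (x - 1 + 1)%Z with x by lia; simpl; ring.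
  - rewrite Hw; unfold dot; simpl; ring. }
set (g := fun x => sq w x + sq u x).
assert (BJ : forall x, Rabs (J x) <= (1 + B) * zsum g x 2).
{ intros x; unfold J.
  pose proof (Rabs_dot_le 1 (w x) (al x * u (x + 1)%Z)%Cx ltac:(lra)) as H1.
  pose proof (Rabs_dot_le 1 (w (x + 1)%Z) (ga (x + 1)%Z * u x)%Cx ltac:(lra)) as H2.
  rewrite Cnorm2_mul, Rinv_1 in H1, H2.
  destruct (HB x) as (Ba & _ & _); destruct (HB (x + 1)%Z) as (_ & _ & Bg).
  pose proof (Rabs_triang (dot (w x) (al x * u (x + 1)%Z)%Cx)
    (- dot (w (x + 1)%Z) (ga (x + 1)%Z * u x)%Cx)) as H3.
  rewrite Rabs_Ropp in H3.
  unfold g, sq; simpl; rewrite Z.add_0_r.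
  pose proof (Cnorm2_ge0 (u x)); pose proof (Cnorm2_ge0 (u (x + 1)%Z)).
  pose proof (Cnorm2_ge0 (w x)); pose proof (Cnorm2_ge0 (w (x + 1)%Z)).
  assert (Cnorm2 (al x) * Cnorm2 (u (x + 1)%Z) <= B * Cnorm2 (u (x + 1)%Z)) by (apply Rmult_le_compat_r; assumption).
  assert (Cnorm2 (ga (x + 1)%Z) * Cnorm2 (u x) <= B * Cnorm2 (u x)) by (apply Rmult_le_compat_r; assumption).
  assert (0 <= B * Cnorm2 (w x)) by (apply Rmult_le_pos; assumption).
  assert (0 <= B * Cnorm2 (w (x + 1)%Z)) by (apply Rmult_le_pos; assumption).
  unfold Rminus; lra. }
destruct (zsum_tail_small g) with (eps := eps / (2 * (1 + B))) as [L0 HL0].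
- intros x; unfold g; pose proof (sq_ge0 u x); pose proof (sq_ge0 w x); lra.
- exists (Mw + Mu); intros a n; unfold g; rewrite zsum_plus.
  apply Rplus_le_compat; [apply HMw|apply HMu].
- apply Rdiv_lt_0_compat; lra.
- exists (S L0); intros L HL; unfold window.
  rewrite (zsum_ext _ (fun x => J x - J (x - 1)%Z)) by (intros; apply EJ).
  rewrite zsum_telescope.
  replace (- Z.of_nat L + Z.of_nat (2 * L + 1) - 1)%Z with (Z.of_nat L) by lia.
  pose proof (BJ (Z.of_nat L)) as H1; pose proof (BJ (- Z.of_nat L - 1)%Z) as H2.
  pose proof (HL0 (Z.of_nat L) 2%nat ltac:(lia)) as H3.
  pose proof (HL0 (- Z.of_nat L - 1)%Z 2%nat ltac:(lia)) as H4.
  pose proof (Rabs_triang (J (Z.of_nat L)) (- J (- Z.of_nat L - 1)%Z)) as H5.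
  rewrite Rabs_Ropp in H5.
  assert (E : (1 + B) * (eps / (2 * (1 + B))) = eps / 2) by (field; lra).
  apply Rmult_le_compat_l with (r := 1 + B) in H3; [|lra].
  apply Rmult_le_compat_l with (r := 1 + B) in H4; [|lra].
  unfold Rminus at 1; lra.
Qed.

Lemma Rle_all_eps a : (forall eps, 0 < eps -> a <= eps) -> a <= 0.
Proof. intros H; apply Rnot_lt_le; intros Ha; specialize (H (a / 2) ltac:(lra)); lra. Qed.

(** The kernel of the adjoint is orthogonal to the range, so such a [w] is orthogonal to itself. The
    pointwise hypothesis asks [T u] to agree with [w] only where [w] is nonzero. *)
Lemma ker_adj_orth_self al be ga u w : tri_bounded al be ga -> sl2 u -> sl2 w ->
  (forall x, tri_adj al be ga w x = C0) ->
  (forall x, dot (w x) (tri al be ga u x) = sq w x) -> forall x, w x = C0.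
Proof.
intros HB Hu Hw Ha E x.
apply Cnorm2_eq0, Rle_antisym; [|apply Cnorm2_ge0].
apply Rle_all_eps; intros eps Heps.
destruct (green_vanishes al be ga u w HB Hu Hw Ha eps Heps) as [L0 HL0].
specialize (HL0 (L0 + Z.to_nat (Z.abs x))%nat ltac:(lia)); unfold window in HL0.
rewrite (zsum_ext _ (sq w)) in HL0 by (intros; apply E).
apply Rle_trans with (2 := HL0), Rle_trans with (2 := Rle_abs _).
apply (zsum_term (sq w)); [apply sq_ge0|lia].
Qed.

(** Membership in the closure of the range of [T] on square-summable sequences; for bounded [T],
    square summability of [phi] follows. *)
Definition approximable (T : (Z -> Cx) -> Z -> Cx) (phi : Z -> Cx) : Prop :=
  forall eps, 0 < eps -> exists s, sl2 s /\
    forall a n, zsum (sq (fun x => phi x - T s x)%Cx) a n <= eps.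

Lemma window_support f K L : (0 < K)%Z -> (forall x, outside K x -> f x = 0) ->
  (Z.to_nat K <= L)%nat -> window L f = zsum f (1 - K)%Z (Z.to_nat (2 * K - 1)).
Proof.
intros HK Hf HL; unfold window.
replace (2 * L + 1)%nat with
  (Z.to_nat (1 - K + Z.of_nat L) + (Z.to_nat (2 * K - 1) + (2 * L + 1 - Z.to_nat (1 - K + Z.of_nat L) - Z.to_nat (2 * K - 1))))%nat by lia.
rewrite !zsum_app.
rewrite (zsum_zero f (- Z.of_nat L)%Z) by (intros; apply Hf; left; lia).
rewrite (zsum_zero f (_ + _ + _)%Z) by (intros; apply Hf; right; lia).
replace (- Z.of_nat L + Z.of_nat (Z.to_nat (1 - K + Z.of_nat L)))%Z with (1 - K)%Z by lia; ring.
Qed.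

Lemma approximable_orth_re al be ga K phi w : tri_bounded al be ga -> (0 < K)%Z ->
  approximable (tri al be ga) phi -> (forall x, outside K x -> phi x = C0) -> sl2 w ->
  (forall x, tri_adj al be ga w x = C0) ->
  zsum (fun x => dot (w x) (phi x)) (1 - K)%Z (Z.to_nat (2 * K - 1)) = 0.
Proof.
intros HB HK Hphi Hsup Hw Ha.
set (S := zsum _ _ _).
cut (Rabs S <= 0).
{ intros H; apply Rabs_eq_0; pose proof (Rabs_pos S); lra. }
apply Rle_all_eps; intros eps Heps.
destruct Hw as [W HW]; assert (Hw : sl2 w) by (exists W; assumption).
assert (W0 : 0 <= W) by (specialize (HW 0%Z O); simpl in HW; assumption).
(* With this weight the remainder contributes at most [d W + eps / 3 <= 2 eps / 3]; the boundary
   terms of Green's formula take the last third. *)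
set (d := eps / (3 * (W + 1))).
assert (Hd : 0 < d) by (unfold d; apply Rdiv_lt_0_compat; lra).
destruct (Hphi (eps / 3 * d)) as (s & Hs & Hr).
{ apply Rmult_lt_0_compat; lra. }
destruct (green_vanishes al be ga s w HB Hs Hw Ha (eps / 3) ltac:(lra)) as [L0 HL0].
set (L := (L0 + Z.to_nat K)%nat); specialize (HL0 L ltac:(lia)).
assert (ES : S = window L (fun x => dot (w x) (phi x))).
{ symmetry; apply window_support; [assumption| |lia].
  intros x Hx; rewrite Hsup by assumption; unfold dot; simpl; ring. }
set (r := fun x => (phi x - tri al be ga s x)%Cx) in Hr.
assert (ES2 : S = window L (fun x => dot (w x) (tri al be ga s x)) + window L (fun x => dot (w x) (r x))).
{ rewrite ES; unfold window; rewrite <- zsum_plus; apply zsum_ext; intros x _.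
  unfold r, dot; simpl; ring. }
assert (HR : Rabs (window L (fun x => dot (w x) (r x))) <= d * W + / d * (eps / 3 * d)).
{ apply Rle_trans with (window L (fun x => d * sq w x + / d * sq r x)).
  - unfold window; generalize (2 * L + 1)%nat; induction n as [|n IH]; simpl; [rewrite Rabs_R0; lra|].
    eapply Rle_trans; [apply Rabs_triang|]; apply Rplus_le_compat; [assumption|].
    apply Rabs_dot_le, Hd.
  - unfold window; rewrite zsum_plus, !zsum_scal.
    apply Rplus_le_compat; apply Rmult_le_compat_l; try apply HW; try apply Hr; try lra.
    apply Rlt_le, Rinv_0_lt_compat, Hd. }
replace (/ d * (eps / 3 * d)) with (eps / 3) in HR by (field; lra).
assert (d * W <= eps / 3).
{ apply Rle_trans with (d * (W + 1)); [apply Rmult_le_compat_l; lra|].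
  right; unfold d; field; lra. }
rewrite ES2; eapply Rle_trans; [apply Rabs_triang|]; lra.
Qed.

Lemma approximable_orth al be ga K phi w : tri_bounded al be ga -> (0 < K)%Z ->
  approximable (tri al be ga) phi -> (forall x, outside K x -> phi x = C0) -> sl2 w ->
  (forall x, tri_adj al be ga w x = C0) ->
  csum (Z.to_nat (2 * K - 1))
    (fun j => phi (1 - K + Z.of_nat j)%Z * Cconj (w (1 - K + Z.of_nat j)%Z))%Cx = C0.
Proof.
intros HB HK Hphi Hsup Hw Ha.
(* [dot] is the real part of the Hermitian product. Replacing [w] by [I w], again in the kernel of
   the adjoint, gives the imaginary part. *)
set (I := mkCx 0 1).
assert (H1 := approximable_orth_re al be ga K phi w HB HK Hphi Hsup Hw Ha).
assert (H2 := approximable_orth_re al be ga K phi (fun x => I * w x)%Cx HB HK Hphi Hsup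
  (sl2_scal _ _ Hw)).
rewrite (zsum_ext _ (fun x => im (phi x * Cconj (w x))%Cx)) in H2
  by (intros; unfold dot, I; simpl; ring).
rewrite (zsum_ext _ (fun x => re (phi x * Cconj (w x))%Cx)) in H1
  by (intros; unfold dot; simpl; ring).
apply Cx_ext.
- rewrite (re_csum _ (fun x => phi x * Cconj (w x))%Cx); exact H1.
- rewrite (im_csum _ (fun x => phi x * Cconj (w x))%Cx); apply H2.
  intros x; transitivity (I * tri_adj al be ga w x)%Cx; [unfold tri_adj, tri; ring|rewrite Ha; ring].
Qed.

(** * Reduction of kernel and range to a finite matrix *)

Definition ker (T : (Z -> Cx) -> Z -> Cx) (u : Z -> Cx) : Prop :=
  sl2 u /\ forall x, T u x = C0.

Definition seq_basis (S : (Z -> Cx) -> Prop) (d : nat) (e : nat -> Z -> Cx) : Prop :=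
  (forall j, (j < d)%nat -> S (e j)) /\
  (forall c, (forall x, csum d (fun j => c j * e j x)%Cx = C0) ->
     forall j, (j < d)%nat -> c j = C0) /\
  (forall u, S u -> exists c, forall x, u x = csum d (fun j => c j * e j x)%Cx).

(** The family dual to the functionals; by uniqueness it spans the square-summable solutions of
    [T u = 0] outside the window. *)
Lemma aug_bij_solutions T K n l : aug_bij T K n l ->
  exists U : nat -> Z -> Cx, (forall i, sl2 (U i)) /\
    (forall i x, outside K x -> T (U i) x = C0) /\
    (forall i j, (i < n)%nat -> (j < n)%nat ->
       l j (U i) = if Nat.eq_dec i j then C1 else C0).
Proof.
intros (_ & A2 & _).
assert (H : forall i : nat, exists u, sl2 u /\ (forall x, outside K x -> T u x = C0) /\
  forall j, (j < n)%nat -> l j u = if Nat.eq_dec i j then C1 else C0).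
{ intros i; apply (A2 (fun _ => C0) (fun j => if Nat.eq_dec i j then C1 else C0) sl2_0). }
exists (fun i => proj1_sig (constructive_indefinite_description _ (H i))).
pose proof (fun i => proj2_sig (constructive_indefinite_description _ (H i))) as P.
cbv beta in P; repeat split; intros; apply (P i); assumption.
Qed.

(** Kernel and range of [T] are governed by the matrix [M] of the values of [T (U i)] at the
    [2 K - 1] sites of the window. Sequences in the kernel of the adjoint, restricted to the window,
    annihilate its rows. If their number reaches [2 K - 1 - rank M], orthogonality to them is the
    only condition for lying in the range, and this condition passes to limits. *)
Lemma aug_bij_kernel al be ga K n l : tri_bounded al be ga -> (0 < K)%Z ->
  aug_bij (tri al be ga) K n l ->
  exists d e, seq_basis (ker (tri al be ga)) d e /\
    forall r w, seq_basis (ker (tri_adj al be ga)) r w ->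
      (r + n <= Z.to_nat (2 * K - 1) + d)%nat /\
      ((r + n = Z.to_nat (2 * K - 1) + d)%nat ->
       forall phi, approximable (tri al be ga) phi ->
       exists psi, sl2 psi /\ forall x, phi x = tri al be ga psi x).
Proof.
intros HB HK Haug; set (T := tri al be ga) in *; set (m := Z.to_nat (2 * K - 1)).
destruct (aug_bij_solutions T K n l Haug) as (U & U1 & U2 & U3).
destruct Haug as (A1 & A2 & A3).
assert (lU : forall c j, (j < n)%nat ->
  l j (fun x => csum n (fun i => c i * U i x)%Cx) = c j).
{ intros c j Hj; rewrite is_linear_csum by (apply A1, Hj).
  rewrite <- (csum_delta n c j Hj); apply csum_ext; intros i Hi.
  rewrite U3 by assumption; reflexivity. }
assert (Uspan : forall u, sl2 u -> (forall x, outside K x -> T u x = C0) ->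
  forall x, u x = csum n (fun i => l i u * U i x)%Cx).
{ intros u Hu HT x.
  set (v := fun x => csum n (fun i => l i u * U i x)%Cx).
  assert (Hv : sl2 v) by (apply sl2_csum; intros; apply U1).
  assert (Z0 : (u x - v x)%Cx = C0).
  { apply (A3 (fun x => u x - v x)%Cx).
    - apply sl2_sub; assumption.
    - intros y Hy; unfold T; rewrite tri_sub.
      fold T; rewrite HT by assumption.
      unfold v, T; rewrite tri_csum, (csum_ext n _ (fun _ => C0)), csum_0; [ring|].
      intros i Hi; fold T; rewrite U2 by assumption; ring.
    - intros i Hi; transitivity (l i (fun x => - C1 * v x + u x)%Cx).
      + f_equal; apply functional_extensionality; intros y; ring.
      + rewrite (A1 i Hi); unfold v; rewrite (lU (fun i => l i u)) by assumption; ring. }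
  transitivity ((u x - v x) + v x)%Cx; [ring|rewrite Z0; unfold v; ring]. }
set (M := fun i j => T (U i) (1 - K + Z.of_nat j)%Z).
assert (TU : forall c, (forall j, (j < m)%nat -> csum n (fun i => c i * M i j)%Cx = C0) ->
  forall x, T (fun y => csum n (fun i => c i * U i y)%Cx) x = C0).
{ intros c Hc x; unfold T; rewrite tri_csum; fold T.
  destruct (Z_le_dec x (- K)) as [Hx|Hx]; [|destruct (Z_le_dec K x) as [Hx'|Hx']].
  - rewrite (csum_ext n _ (fun _ => C0)), csum_0; [reflexivity|].
    intros i Hi; rewrite U2 by (left; assumption); ring.
  - rewrite (csum_ext n _ (fun _ => C0)), csum_0; [reflexivity|].
    intros i Hi; rewrite U2 by (right; assumption); ring.
  - specialize (Hc (Z.to_nat (x - (1 - K))) ltac:(lia)); unfold M in Hc.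
    replace (1 - K + Z.of_nat (Z.to_nat (x - (1 - K))))%Z with x in Hc by lia; exact Hc. }
destruct (CxLinearAlgebra.kernel_basis_and_range n m M) as (d & e & E1 & E2 & E3 & E4).
exists d, (fun j x => csum n (fun i => e j i * U i x)%Cx); split; [split; [|split]|].
- intros j Hj; split; [apply sl2_csum; intros; apply U1|].
  apply TU; intros x Hx; apply E1; assumption.
- intros c Hc; apply E2; intros i Hi.
  rewrite <- (lU (fun i => csum d (fun j => c j * e j i)%Cx) i Hi).
  transitivity (l i (fun _ => C0)); [|apply is_linear_0, A1, Hi].
  f_equal; apply functional_extensionality; intros x; rewrite <- (Hc x).
  rewrite (csum_ext n _ (fun i => csum d (fun j => c j * (e j i * U i x))%Cx)).
  + rewrite csum_swap; apply csum_ext; intros j Hj; apply csum_scal.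
  + intros i' _; transitivity (U i' x * csum d (fun j => c j * e j i'))%Cx; [ring|].
    rewrite <- csum_scal; apply csum_ext; intros; ring.
- intros u [Hu HTu].
  pose proof (Uspan u Hu (fun x _ => HTu x)) as Eu.
  destruct (E3 (fun i => l i u)) as [t Ht].
  + intros j Hj; rewrite <- (HTu (1 - K + Z.of_nat j)%Z).
    transitivity (T (fun x => csum n (fun i => l i u * U i x)%Cx) (1 - K + Z.of_nat j)%Z).
    * unfold T; rewrite tri_csum; reflexivity.
    * f_equal; apply functional_extensionality; intros; symmetry; apply Eu.
  + exists t; intros x; rewrite Eu.
    rewrite (csum_ext n _ (fun i => csum d (fun j => t j * (e j i * U i x))%Cx)).
    * rewrite csum_swap; apply csum_ext; intros j Hj; apply csum_scal.
    * intros i Hi; rewrite Ht by assumption.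
      transitivity (U i x * csum d (fun j => t j * e j i))%Cx; [ring|].
      rewrite <- csum_scal; apply csum_ext; intros; ring.
- intros r w (W1 & W2 & W3).
  set (W := fun j x => Cconj (w j (1 - K + Z.of_nat x)%Z)).
  destruct (E4 r W) as [D1 D2].
  + intros c Hc.
    set (v := fun x => csum r (fun j => Cconj (c j) * w j x)%Cx).
    assert (Hv : sl2 v) by (apply sl2_csum; intros; apply W1; assumption).
    assert (Tv : forall x, tri_adj al be ga v x = C0).
    { intros x; unfold v, tri_adj; rewrite tri_csum, (csum_ext r _ (fun _ => C0)), csum_0;
        [reflexivity|].
      intros j Hj; destruct (W1 j Hj) as [_ H]; unfold tri_adj in H; rewrite H; ring. }
    (* A combination [v] vanishing on the window equals [T u] outside it for some [u], so it is
       orthogonal to itself: restriction to the window keeps the kernel elements independent. *)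
    destruct (A2 v (fun _ => C0) Hv) as (u & Hu & HTu & _).
    assert (v0 : forall x, v x = C0).
    { apply (ker_adj_orth_self al be ga u); try assumption.
      intros x; destruct (Z_le_dec x (- K)) as [Hx|Hx]; [|destruct (Z_le_dec K x) as [Hx'|Hx']].
      - unfold T in HTu; rewrite HTu by (left; assumption); reflexivity.
      - unfold T in HTu; rewrite HTu by (right; assumption); reflexivity.
      - assert (vx : v x = C0).
        { specialize (Hc (Z.to_nat (x - (1 - K))) ltac:(lia)); unfold W in Hc.
          replace (1 - K + Z.of_nat (Z.to_nat (x - (1 - K))))%Z with x in Hc by lia.
          apply (f_equal Cconj) in Hc; rewrite Cconj_csum in Hc.
          transitivity (Cconj C0); [rewrite <- Hc; unfold v|apply Cx_ext; simpl; ring].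
          apply csum_ext; intros; apply Cx_ext; simpl; ring. }
        unfold sq, dot; rewrite vx, Cnorm2_C0; simpl; ring. }
    intros j Hj; pose proof (W2 (fun j => Cconj (c j)) v0 j Hj) as H.
    apply (f_equal Cconj) in H; transitivity (Cconj (Cconj (c j))); [apply Cx_ext; simpl; ring|].
    rewrite H; apply Cx_ext; simpl; ring.
  + intros i j Hi Hj; destruct (W1 j Hj) as [Hw1 Hw2].
    apply (approximable_orth al be ga K (T (U i)) (w j)); try assumption; [|intros; apply U2; assumption].
    intros eps Heps; exists (U i); split; [apply U1|].
    intros a n'; rewrite zsum_zero; [lra|]; intros x _; unfold sq.
    fold T; transitivity (Cnorm2 C0); [f_equal; ring|apply Cnorm2_C0].
  + split; [exact D1|]; intros Heq phi Hphi.
    assert (Sphi : sl2 phi).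
    { destruct (Hphi 1 ltac:(lra)) as (s & Hs & Hr).
      apply (sl2_ext (fun x => (phi x - T s x) + T s x)%Cx); [intros; ring|].
      apply (sl2_add (fun x => phi x - T s x)%Cx); [exists 1; exact Hr|].
      apply tri_sl2; assumption. }
    destruct (A2 phi (fun _ => C0) Sphi) as (u & Hu & HTu & _).
    (* Subtracting a solution outside the window leaves a [g] supported in the window and still
       approximable, hence orthogonal to every [w j]. *)
    set (g := fun x => (phi x - T u x)%Cx).
    destruct (D2 Heq (fun j => g (1 - K + Z.of_nat j)%Z)) as [c Hc].
    { intros j Hj; destruct (W1 j Hj) as [Hw1 Hw2].
      apply (approximable_orth al be ga K g (w j)); try assumption.
      - intros eps Heps; destruct (Hphi eps Heps) as (s & Hs & Hr).
        exists (fun x => s x - u x)%Cx; split; [apply sl2_sub; assumption|].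
        intros a n'; rewrite (zsum_ext _ (sq (fun x => phi x - T s x)%Cx)); [apply Hr|].
        intros x _; unfold sq, g; rewrite tri_sub; f_equal; unfold T; ring.
      - intros x Hx; unfold g; rewrite HTu by assumption; ring. }
    exists (fun x => u x + csum n (fun i => c i * U i x))%Cx; split.
    { apply (sl2_add u (fun x => csum n (fun i => c i * U i x)%Cx)); [assumption|].
      apply sl2_csum; intros; apply U1. }
    intros x; unfold T; rewrite (tri_add al be ga u (fun x => csum n (fun i => c i * U i x)%Cx)), tri_csum; fold T.
    destruct (Z_le_dec x (- K)) as [Hx|Hx]; [|destruct (Z_le_dec K x) as [Hx'|Hx']].
    * rewrite HTu, (csum_ext n _ (fun _ => C0)), csum_0; [ring| |left; assumption].
      intros i Hi; rewrite U2 by (left; assumption); ring.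
    * rewrite HTu, (csum_ext n _ (fun _ => C0)), csum_0; [ring| |right; assumption].
      intros i Hi; rewrite U2 by (right; assumption); ring.
    * specialize (Hc (Z.to_nat (x - (1 - K))) ltac:(lia)); unfold M, g in Hc.
      replace (1 - K + Z.of_nat (Z.to_nat (x - (1 - K))))%Z with x in Hc by lia.
      rewrite <- Hc; ring.
Qed.

Lemma tri_adj_involutive al be ga :
  tri_adj (fun x => Cconj (ga (x + 1)%Z)) (fun x => Cconj (be x)) (fun x => Cconj (al (x - 1)%Z))
  = tri al be ga.
Proof.
unfold tri_adj; f_equal; apply functional_extensionality; intros x.
- replace (x + 1 - 1)%Z with x by lia; apply Cx_ext; simpl; ring.
- apply Cx_ext; simpl; ring.
- replace (x - 1 + 1)%Z with x by lia; apply Cx_ext; simpl; ring.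
Qed.

Lemma tri_adj_bounded al be ga : tri_bounded al be ga ->
  tri_bounded (fun x => Cconj (ga (x + 1)%Z)) (fun x => Cconj (be x)) (fun x => Cconj (al (x - 1)%Z)).
Proof. intros [B HB]; exists B; intros x; rewrite !Cnorm2_conj; repeat split; apply HB. Qed.

(* Each of [dim ker T* <= dim coker T] and [dim ker T <= dim coker T*] is easy;
   since the indices of [T] and [T*] are opposite, both are equalities. *)
Theorem tri_fredholm al be ga K n n' l l' : tri_bounded al be ga -> (0 < K)%Z ->
  aug_bij (tri al be ga) K n l -> aug_bij (tri_adj al be ga) K n' l' ->
  (n + n' = 2 * Z.to_nat (2 * K - 1))%nat ->
  exists d e d' e', seq_basis (ker (tri al be ga)) d e /\
    seq_basis (ker (tri_adj al be ga)) d' e' /\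
    (Z.of_nat d - Z.of_nat d' = Z.of_nat n - (2 * K - 1))%Z /\
    (forall phi, approximable (tri al be ga) phi ->
       exists psi, sl2 psi /\ forall x, phi x = tri al be ga psi x).
Proof.
intros HB HK A A' Hn.
destruct (aug_bij_kernel al be ga K n l HB HK A) as (d & e & S & P).
destruct (aug_bij_kernel _ _ _ K n' l' (tri_adj_bounded _ _ _ HB) HK A') as (d' & e' & S' & P').
rewrite tri_adj_involutive in P'.
(* With [m = 2 K - 1], the inequalities [d' + n <= m + d] and [d + n' <= m + d'] add up to
   [n + n' <= 2 m], which is an equality. *)
destruct (P d' e' S') as [P1 P2]; destruct (P' d e S) as [P1' _].
exists d, e, d', e'; split; [assumption|]; split; [assumption|]; split; [lia|].
apply P2; lia.
Qed.

(** * Adjoint, reflection and index of the supercharge *)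

Lemma Cconj_neq0 z : z <> C0 -> Cconj z <> C0.
Proof.
intros H E; apply H, Cnorm2_eq0; rewrite <- Cnorm2_conj, E; apply Cnorm2_C0.
Qed.

Lemma Cmul_neq0 z w : z <> C0 -> w <> C0 -> (z * w)%Cx <> C0.
Proof.
intros Hz Hw E; apply (f_equal Cnorm2) in E; rewrite Cnorm2_mul, Cnorm2_C0 in E.
pose proof (Cnorm2_gt0 z Hz); pose proof (Cnorm2_gt0 w Hw); nra.
Qed.

Lemma Copp_neq0 z : z <> C0 -> (- z)%Cx <> C0.
Proof. intros H E; apply H, Cnorm2_eq0; rewrite <- Cnorm2_opp, E; apply Cnorm2_C0. Qed.

Lemma Cinv_neq0 z : z <> C0 -> Cinv z <> C0.
Proof.
intros H E; pose proof (Cinv_l z H) as E2; rewrite E in E2; apply C1_neq0; rewrite <- E2; ring.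
Qed.

Lemma Cnorm2_inv z : z <> C0 -> Cnorm2 (Cinv z) = / Cnorm2 z.
Proof.
intros H; pose proof (Cinv_l z H) as E; apply (f_equal Cnorm2) in E; rewrite Cnorm2_mul in E.
pose proof (Cnorm2_gt0 z H); apply Rmult_eq_reg_r with (Cnorm2 z); [|lra].
rewrite E, Rinv_l by lra; unfold Cnorm2; simpl; ring.
Qed.

Lemma Cconj_opp z : Cconj (- z)%Cx = (- Cconj z)%Cx.
Proof. apply Cx_ext; simpl; ring. Qed.

Lemma Cconj_mul z w : Cconj (z * w)%Cx = (Cconj z * Cconj w)%Cx.
Proof. apply Cx_ext; simpl; ring. Qed.

Lemma Cconj_conj z : Cconj (Cconj z) = z.
Proof. apply Cx_ext; simpl; ring. Qed.

Lemma Cconj_Cr r : Cconj (Cr r) = Cr r.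
Proof. apply Cx_ext; simpl; ring. Qed.

Definition charge_adj c k a1 a2 b :=
  tri_adj (fun x => c * b (x + 1)%Z)%Cx
      (fun x => c * (k * Cr (a2 (x + 1)%Z - a1 x)))%Cx
      (fun x => - (c * (k * k * Cconj (b x))))%Cx.

Definition charge_reflect c k a1 a2 b :=
  tri_reflect (fun x => c * b (x + 1)%Z)%Cx
      (fun x => c * (k * Cr (a2 (x + 1)%Z - a1 x)))%Cx
      (fun x => - (c * (k * k * Cconj (b x))))%Cx.

(** Up to the scalar [- conj k], the pair [(- conj k w(x), w(x - 1))] has the form
    [(w(x), k' w(x - 1))] with [k' = - 1 / conj k], so the -1 eigenspace is coordinatised like the
    +1 eigenspace. *)
Lemma charge_adjE c k a1 a2 b : k <> C0 ->
  charge_adj c k a1 a2 b =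
  charge (- (Cconj c * (Cconj k * Cconj k)))%Cx (- Cinv (Cconj k))%Cx a1 a2 b.
Proof.
intros Hk; pose proof (Cconj_neq0 k Hk); unfold charge_adj, charge, tri_adj.
f_equal; apply functional_extensionality; intros x;
  rewrite ?Cconj_opp, ?Cconj_mul, ?Cconj_conj, ?Cconj_Cr.
- ring.
- field; assumption.
- replace (x - 1 + 1)%Z with x by lia; field; assumption.
Qed.

(** Reflecting [(u(x), k u(x - 1))] by [x -> 1 - x] and exchanging the components gives, up to the
    scalar [k], the same form for the reflected [u] with [1 / k]; the exchange swaps [a1] with [a2]
    and conjugates [b]. *)
Lemma charge_reflectE c k a1 a2 b : k <> C0 ->
  charge_reflect c k a1 a2 b =
  charge (- (c * (k * k)))%Cx (Cinv k) (fun x => a2 (1 - x)%Z) (fun x => a1 (1 - x)%Z)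
    (fun x => Cconj (b (1 - x)%Z)).
Proof.
intros Hk; unfold charge_reflect, charge, tri_reflect, reflect.
f_equal; apply functional_extensionality; intros x.
- replace (1 - (x + 1))%Z with (- x)%Z by lia; ring.
- replace (1 - (x + 1))%Z with (- x)%Z by lia; replace (1 - x)%Z with (- x + 1)%Z by lia.
  replace (Cr (a2 (- x + 1)%Z - a1 (- x)%Z)) with (- Cr (a1 (- x)%Z - a2 (- x + 1)%Z))%Cx
    by (apply Cx_ext; simpl; ring).
  field; assumption.
- rewrite Cconj_conj; replace (1 - x)%Z with (- x + 1)%Z by lia; field; assumption.
Qed.

Lemma coin_ok_reflect a1 a2 b : coin_ok a1 a2 b ->
  coin_ok (fun x => a2 (1 - x)%Z) (fun x => a1 (1 - x)%Z) (fun x => Cconj (b (1 - x)%Z)).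
Proof.
intros H x; destruct (H (1 - x)%Z) as (H1 & H2 & H3); rewrite Cnorm2_conj.
split; [assumption|]; split; [assumption|].
rewrite Rplus_comm, <- (Cconj_Cr (_ + _)), <- Cconj_mul, H3; apply Cx_ext; simpl; ring.
Qed.

Lemma charge_bounded c k a1 a2 b : coin_ok a1 a2 b ->
  tri_bounded (fun x => c * b (x + 1)%Z)%Cx
      (fun x => c * (k * Cr (a2 (x + 1)%Z - a1 x)))%Cx
      (fun x => - (c * (k * k * Cconj (b x))))%Cx.
Proof.
intros H.
pose proof (Cnorm2_ge0 c) as Hc; pose proof (Cnorm2_ge0 k) as Hk.
set (s := Cnorm2 k) in *; set (C := Cnorm2 c) in *.
exists (C * (1 + 4 * s + s * s)); intros x.
assert (Hb : forall y, Cnorm2 (b y) <= 1) by (intros y; destruct (H y) as (H1 & _); nra).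
assert (Ha : Cnorm2 (Cr (a2 (x + 1)%Z - a1 x)) <= 4).
{ pose proof (sq_le1_bounds _ _ (Cnorm2_ge0 (b x)) (proj1 (H x))).
  pose proof (sq_le1_bounds _ _ (Cnorm2_ge0 (b (x + 1)%Z)) (proj1 (proj2 (H (x + 1)%Z)))).
  unfold Cnorm2; simpl; nra. }
pose proof (Hb x); pose proof (Hb (x + 1)%Z).
rewrite Cnorm2_opp, !Cnorm2_mul, Cnorm2_conj; fold s; fold C.
pose proof (Cnorm2_ge0 (b x)); pose proof (Cnorm2_ge0 (b (x + 1)%Z)).
pose proof (Cnorm2_ge0 (Cr (a2 (x + 1)%Z - a1 x))).
split; [|split]; apply Rmult_le_compat_l; try assumption; nra.
Qed.

Lemma tail_dim_opp s a : tail_dim s (- a) = tail_dim s a.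
Proof.
unfold tail_dim; replace (1 + - a) with (1 - a) by ring; replace (1 - - a) with (1 + a) by ring.
lia.
Qed.

(** Passing from [s] to [1 / s] replaces each of the two squared moduli by the inverse of the other,
    so roots inside the disc trade places with roots outside. *)
Lemma tail_dim_inv s a : 0 < s -> s * (1 - a) <> 1 + a -> s * (1 + a) <> 1 - a ->
  (tail_dim (/ s) a + tail_dim s a = 2)%nat.
Proof.
intros Hs H1 H2.
assert (E : forall y z, / s * y < z <-> y < s * z).
{ intros y z; split; intros H.
  - apply Rmult_lt_compat_l with (r := s) in H; [|assumption].
    rewrite <- Rmult_assoc, Rinv_r, Rmult_1_l in H; lra.
  - apply Rmult_lt_reg_l with s; [assumption|].
    rewrite <- Rmult_assoc, Rinv_r, Rmult_1_l; lra. }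
unfold tail_dim.
repeat match goal with |- context [Rlt_dec ?x ?y] => destruct (Rlt_dec x y) end;
  rewrite ?E in *; try reflexivity; exfalso; lra.
Qed.

Lemma inv_nondegenerate s a : 0 < s -> s * (1 - a) <> 1 + a -> s * (1 + a) <> 1 - a ->
  / s * (1 - a) <> 1 + a /\ / s * (1 + a) <> 1 - a.
Proof.
intros Hs H1 H2; split; intros E.
- apply H2; rewrite <- E; field; lra.
- apply H1; rewrite <- E; field; lra.
Qed.

(** The equality [a2 = - a1] is required exactly at all far sites, since the factorisation holds
    only there. *)
Definition right_limit (a1 a2 : Z -> R) (a : R) : Prop :=
  lim_plus a1 a /\ exists N, forall x, (N <= x)%Z -> a2 x = - a1 x.
(** The sign: the first diagonal entry of the reflected coin is [a2], with limit [- a(L)]. *)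
Definition left_limit (a1 a2 : Z -> R) (a : R) : Prop :=
  right_limit (fun x => a2 (1 - x)%Z) (fun x => a1 (1 - x)%Z) (- a).

Lemma charge_aug_bij c k a1 a2 b aL aR : c <> C0 -> k <> C0 -> coin_ok a1 a2 b ->
  left_limit a1 a2 aL -> right_limit a1 a2 aR ->
  Cnorm2 k * (1 - aL) <> 1 + aL -> Cnorm2 k * (1 + aL) <> 1 - aL ->
  Cnorm2 k * (1 - aR) <> 1 + aR -> Cnorm2 k * (1 + aR) <> 1 - aR ->
  exists K0, forall K, (K0 <= K)%Z -> exists l, aug_bij (charge c k a1 a2 b) K
    (tail_dim (Cnorm2 k) aR + (2 - tail_dim (Cnorm2 k) aL) + Z.to_nat (2 * K - 3)) l.
Proof.
intros Hc Hk Hok [LL1 LL2] [LR1 LR2] HL1 HL2 HR1 HR2.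
pose proof (Cnorm2_gt0 k Hk) as Hs.
destruct (charge_right_tail c k a1 a2 b aR Hc Hk Hok LR1 LR2 HR1 HR2) as [NR TR].
destruct (inv_nondegenerate _ _ Hs HL1 HL2) as [HL1' HL2'].
assert (TL : right_tail (charge_reflect c k a1 a2 b) (tail_dim (/ Cnorm2 k) (- aL))).
{ rewrite charge_reflectE by assumption; rewrite <- Cnorm2_inv by assumption.
  apply charge_right_tail; try assumption.
  - apply Copp_neq0; repeat apply Cmul_neq0; assumption.
  - apply Cinv_neq0, Hk.
  - apply coin_ok_reflect, Hok.
  - rewrite Cnorm2_inv by assumption; lra.
  - rewrite Cnorm2_inv by assumption; lra. }
destruct TL as [NL TL].
exists (Z.max 2 (Z.max NR NL)); intros K HK.
destruct (TR K ltac:(lia)) as [lR BR]; destruct (TL K ltac:(lia)) as [lL BL].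
rewrite tail_dim_opp in BL.
replace (2 - tail_dim (Cnorm2 k) aL)%nat with (tail_dim (/ Cnorm2 k) aL)
  by (pose proof (tail_dim_inv _ _ Hs HL1 HL2); lia).
apply (aug_bij_of_tails _ _ _ K _ _ lL lR); [lia|exact BR|exact BL].
Qed.

Theorem charge_fredholm c k a1 a2 b aL aR : c <> C0 -> k <> C0 -> coin_ok a1 a2 b ->
  left_limit a1 a2 aL -> right_limit a1 a2 aR ->
  Cnorm2 k * (1 - aL) <> 1 + aL -> Cnorm2 k * (1 + aL) <> 1 - aL ->
  Cnorm2 k * (1 - aR) <> 1 + aR -> Cnorm2 k * (1 + aR) <> 1 - aR ->
  (exists d e d' e', seq_basis (ker (charge c k a1 a2 b)) d e /\
    seq_basis (ker (charge_adj c k a1 a2 b)) d' e' /\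
    (Z.of_nat d - Z.of_nat d'
     = Z.of_nat (tail_dim (Cnorm2 k) aR) - Z.of_nat (tail_dim (Cnorm2 k) aL))%Z) /\
  (forall phi, approximable (charge c k a1 a2 b) phi ->
     exists psi, sl2 psi /\ forall x, phi x = charge c k a1 a2 b psi x) /\
  (exists K, forall phi, sl2 phi -> exists u, sl2 u /\
     forall x, outside K x -> charge c k a1 a2 b u x = phi x).
Proof.
intros Hc Hk Hok LL LR HL1 HL2 HR1 HR2.
pose proof (Cnorm2_gt0 k Hk) as Hs.
pose proof (Cconj_neq0 k Hk) as Hk'.
destruct (charge_aug_bij c k a1 a2 b aL aR) as [K1 HK1]; try assumption.
destruct (inv_nondegenerate _ _ Hs HL1 HL2) as [HL1' HL2'].
destruct (inv_nondegenerate _ _ Hs HR1 HR2) as [HR1' HR2'].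
set (c' := (- (Cconj c * (Cconj k * Cconj k)))%Cx); set (k' := (- Cinv (Cconj k))%Cx).
assert (Es : Cnorm2 k' = / Cnorm2 k)
  by (unfold k'; rewrite Cnorm2_opp, Cnorm2_inv, Cnorm2_conj by assumption; reflexivity).
destruct (charge_aug_bij c' k' a1 a2 b aL aR) as [K2 HK2]; try assumption; try (rewrite Es; assumption).
{ apply Copp_neq0; repeat apply Cmul_neq0; try assumption; apply Cconj_neq0; assumption. }
{ apply Copp_neq0, Cinv_neq0; assumption. }
set (K := Z.max 2 (Z.max K1 K2)).
destruct (HK1 K ltac:(lia)) as [l A]; destruct (HK2 K ltac:(lia)) as [l' A'].
unfold c', k' in A'; rewrite <- charge_adjE in A' by assumption; fold k' in A'; rewrite Es in A'.
(* At each end the counts for [s] and [1 / s] add up to 2, whence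
   [n + n' = 4 + 2 (2 K - 3) = 2 (2 K - 1)]. *)
pose proof (tail_dim_inv _ _ Hs HL1 HL2); pose proof (tail_dim_inv _ _ Hs HR1 HR2).
destruct (tri_fredholm _ _ _ K _ _ l l' (charge_bounded c k a1 a2 b Hok) ltac:(lia) A A' ltac:(lia))
  as (d & e & d' & e' & S & S' & Hd & Hcl).
split; [|split].
- exists d, e, d', e'; split; [assumption|]; split; [assumption|lia].
- exact Hcl.
- exists K; intros phi Hphi; destruct A as (_ & A2 & _).
  destruct (A2 phi (fun _ => C0) Hphi) as (u & U1 & U2 & _); exists u; split; assumption.
Qed.

(** * Non-closed range at a zero of the symbol *)

Definition ind (s : Z) (n : nat) (x : Z) : R :=
  if Z_le_dec s x then if Z_lt_dec x (s + Z.of_nat n) then 1 else 0 else 0.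

Lemma ind_in s n x : (s <= x < s + Z.of_nat n)%Z -> ind s n x = 1.
Proof.
intros H; unfold ind; destruct (Z_le_dec s x); [|lia].
destruct (Z_lt_dec x (s + Z.of_nat n)); [reflexivity|lia].
Qed.

Lemma ind_out s n x : ~ (s <= x < s + Z.of_nat n)%Z -> ind s n x = 0.
Proof.
intros H; unfold ind; destruct (Z_le_dec s x); [|reflexivity].
destruct (Z_lt_dec x (s + Z.of_nat n)); [lia|reflexivity].
Qed.

Lemma ind_ge0 s n x : 0 <= ind s n x.
Proof.
destruct (Z_le_dec s x); [destruct (Z_lt_dec x (s + Z.of_nat n))|].
- rewrite ind_in by lia; lra.
- rewrite ind_out by lia; lra.
- rewrite ind_out by lia; lra.
Qed.

Lemma zsum_ind_le s n a m : zsum (ind s n) a m <= INR n.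
Proof.
induction n as [|n IH].
- rewrite zsum_zero; [simpl; lra|]; intros; apply ind_out; lia.
- rewrite (zsum_ext _ (fun x => ind s n x + ind (s + Z.of_nat n) 1 x)).
  + rewrite zsum_plus, S_INR; apply Rplus_le_compat; [exact IH|].
    assert (P : zsum (ind (s + Z.of_nat n) 1) a m = ind a m (s + Z.of_nat n)%Z).
    { clear IH; induction m as [|m IH]; [simpl; rewrite ind_out by lia; reflexivity|].
      simpl; rewrite IH.
      destruct (Z.eq_dec (a + Z.of_nat m) (s + Z.of_nat n)) as [E|E].
      - rewrite (ind_out a m), ind_in, ind_in by lia; ring.
      - rewrite (ind_out (s + Z.of_nat n) 1) by lia.
        destruct (Z_le_dec a (s + Z.of_nat n));
          [destruct (Z_lt_dec (s + Z.of_nat n) (a + Z.of_nat m))|].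
        + rewrite !ind_in by lia; ring.
        + rewrite !ind_out by lia; ring.
        + rewrite !ind_out by lia; ring. }
    rewrite P; destruct (Z_le_dec a (s + Z.of_nat n));
      [destruct (Z_lt_dec (s + Z.of_nat n) (a + Z.of_nat m))|].
    * rewrite ind_in by lia; lra.
    * rewrite ind_out by lia; lra.
    * rewrite ind_out by lia; lra.
  + intros x _; destruct (Z.eq_dec x (s + Z.of_nat n)) as [E|E].
    * rewrite ind_in, (ind_out s n), ind_in by lia; ring.
    * rewrite (ind_out (s + Z.of_nat n) 1) by lia.
      destruct (Z_le_dec s x); [destruct (Z_lt_dec x (s + Z.of_nat n))|].
      -- rewrite !ind_in by lia; ring.
      -- rewrite !ind_out by lia; ring.
      -- rewrite !ind_out by lia; ring.
Qed.

Fixpoint Cpow (z : Cx) (n : nat) : Cx := match n with O => C1 | S n' => (z * Cpow z n')%Cx end.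

Lemma Cnorm2_Cpow z n : Cnorm2 z = 1 -> Cnorm2 (Cpow z n) = 1.
Proof.
intros H; induction n as [|n IH]; simpl; [unfold Cnorm2; simpl; ring|].
rewrite Cnorm2_mul, H, IH; ring.
Qed.

(** [Z.to_nat] is constant on negative sites, where no packet placed by [starts] lives. *)
Definition wave (z : Cx) (x : Z) : Cx := Cpow z (Z.to_nat x).

(* Plane wave of modulus [2^-n] on [4^n] consecutive sites: a unit vector. *)
Definition packet (z : Cx) (start : nat -> Z) (n : nat) (x : Z) : Cx :=
  (Cr ((/ 2) ^ n * ind (start n) (4 ^ n) x) * wave z x)%Cx.

(** Packet [n] lies past [N n], where the symbol at [z] is already small, and past the earlier
    packets. Since it starts at [n + 2] or later, each site meets only finitely many packets. *)
Fixpoint starts (N : nat -> Z) (n : nat) : Z :=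
  match n with
  | O => Z.max 2 (N O)
  | S n' => Z.max (N (S n')) (starts N n' + Z.of_nat (4 ^ n') + 2)
  end.

Lemma starts_ge N n : (Z.of_nat n + 2 <= starts N n)%Z.
Proof. induction n as [|n IH]; cbn [starts]; lia. Qed.

Lemma starts_ge_N N n : (N n <= starts N n)%Z.
Proof. destruct n; cbn [starts]; lia. Qed.

Lemma starts_gap N i j : (i < j)%nat ->
  (starts N i + Z.of_nat (4 ^ i) + 2 <= starts N j)%Z.
Proof.
induction j as [|j IH]; [lia|]; intros H; cbn [starts].
destruct (Nat.eq_dec i j) as [->|Hn]; [lia|]; specialize (IH ltac:(lia)); lia.
Qed.

Lemma half_pow_sq n : (/ 2) ^ n * (/ 2) ^ n = (/ 4) ^ n.
Proof. rewrite <- Rpow_mult_distr; f_equal; lra. Qed.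

Lemma quarter_pow n : INR (4 ^ n) * (/ 4) ^ n = 1.
Proof.
rewrite pow_INR, <- Rpow_mult_distr; simpl INR.
replace ((1 + 1 + 1 + 1) * / 4) with 1 by field; apply pow1.
Qed.

Lemma Cnorm2_packet z s n x : Cnorm2 z = 1 ->
  Cnorm2 (packet z s n x) = (/ 4) ^ n * ind (s n) (4 ^ n) x.
Proof.
intros Hz; unfold packet, wave; rewrite Cnorm2_mul, Cnorm2_Cpow, <- half_pow_sq by assumption.
assert (ind (s n) (4 ^ n) x * ind (s n) (4 ^ n) x = ind (s n) (4 ^ n) x).
{ unfold ind; destruct (Z_le_dec (s n) x); [|ring]; destruct (Z_lt_dec x (s n + Z.of_nat (4 ^ n))); ring. }
unfold Cnorm2; simpl; rewrite <- H at 3; ring.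
Qed.

Lemma packet_out z s n x : ~ (s n <= x < s n + Z.of_nat (4 ^ n))%Z -> packet z s n x = C0.
Proof. intros H; unfold packet; rewrite ind_out by assumption; apply Cx_ext; simpl; ring. Qed.

Lemma packet_sl2 z s n : Cnorm2 z = 1 -> sl2 (packet z s n).
Proof.
intros Hz; exists 1; intros a m.
rewrite (zsum_ext _ (fun x => (/ 4) ^ n * ind (s n) (4 ^ n) x))
  by (intros; apply Cnorm2_packet, Hz).
rewrite zsum_scal, <- (quarter_pow n), Rmult_comm.
apply Rmult_le_compat_r; [apply pow_le; lra|apply zsum_ind_le].
Qed.

Lemma Cnorm2_add3_le z1 z2 z3 Q : Cnorm2 z1 <= Q -> Cnorm2 z2 <= Q -> Cnorm2 z3 <= Q ->
  Cnorm2 (z1 + z2 + z3)%Cx <= 10 * Q.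
Proof.
intros; pose proof (Cnorm2_add_le (z1 + z2)%Cx z3); pose proof (Cnorm2_add_le z1 z2).
pose proof (Cnorm2_ge0 z1); lra.
Qed.

(** Inside the packet [T] multiplies by the symbol at [z], which leaves at most [(/ 4)^n] from unit
    mass. The four sites around the two ends contribute at most [10 B (/ 4)^n] each. *)
Lemma packet_image_small al be ga z N B :
  (forall x, Cnorm2 (al x) <= B /\ Cnorm2 (be x) <= B /\ Cnorm2 (ga x) <= B) ->
  Cnorm2 z = 1 ->
  (forall n x, (N n <= x)%Z -> Cnorm2 (al x * z + be x + ga x * Cconj z)%Cx <= (/ 4) ^ n) ->
  forall n a m, zsum (sq (tri al be ga (packet z (starts N) n))) a m <= (1 + 40 * B) * (/ 4) ^ n.
Proof.
intros HB Hz HN n a m.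
set (s := starts N n); set (len := (4 ^ n)%nat).
assert (Hlen : (1 <= Z.of_nat len)%Z).
{ unfold len; pose proof (Nat.pow_nonzero 4 n ltac:(lia)); lia. }
assert (Hs : (2 <= s)%Z) by (pose proof (starts_ge N n); unfold s; lia).
assert (B0 : 0 <= B) by (destruct (HB 0%Z); pose proof (Cnorm2_ge0 (al 0%Z)); lra).
assert (Q0 : 0 <= (/ 4) ^ n) by (apply pow_le; lra).
set (u := packet z (starts N) n).
set (F := fun x => (/ 4) ^ n * ((/ 4) ^ n * ind s len x) + 10 * B * (/ 4) ^ n *
  (ind (s - 1) 2 x + ind (s + Z.of_nat len - 1) 2 x)).
apply Rle_trans with (zsum F a m).
- apply zsum_le; intros x _; unfold sq, F.
  pose proof (ind_ge0 s len x) as I1; pose proof (ind_ge0 (s - 1) 2 x) as I2.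
  pose proof (ind_ge0 (s + Z.of_nat len - 1) 2 x) as I3.
  assert (D : ((s - 1 <= x <= s) \/ (s + Z.of_nat len - 1 <= x <= s + Z.of_nat len)
    \/ (s < x < s + Z.of_nat len - 1) \/ (x < s - 1 \/ s + Z.of_nat len < x))%Z) by lia.
  assert (Edge : 1 <= ind (s - 1) 2 x + ind (s + Z.of_nat len - 1) 2 x ->
    Cnorm2 (tri al be ga u x) <= (/ 4) ^ n * ((/ 4) ^ n * ind s len x) + 10 * B * (/ 4) ^ n *
      (ind (s - 1) 2 x + ind (s + Z.of_nat len - 1) 2 x)).
  { intros H1.
    assert (Hu : forall y, Cnorm2 (u y) <= (/ 4) ^ n).
    { intros y; unfold u; rewrite Cnorm2_packet by assumption.
      assert (ind (starts N n) (4 ^ n) y <= 1).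
      { unfold ind; destruct (Z_le_dec _ _); [|lra]; destruct (Z_lt_dec _ _); lra. }
      rewrite <- (Rmult_1_r ((/ 4) ^ n)) at 2; apply Rmult_le_compat_l; assumption. }
    destruct (HB x) as (Ha & Hb & Hg).
    assert (Cnorm2 (tri al be ga u x) <= 10 * (B * (/ 4) ^ n)).
    { apply Cnorm2_add3_le; rewrite Cnorm2_mul; apply Rmult_le_compat;
        try apply Cnorm2_ge0; try assumption; apply Hu. }
    assert (0 <= (/ 4) ^ n * ((/ 4) ^ n * ind s len x)) by (repeat apply Rmult_le_pos; assumption).
    assert (0 <= 10 * B * (/ 4) ^ n) by (repeat apply Rmult_le_pos; lra).
    nra. }
  destruct D as [D|[D|[D|D]]].
  + apply Edge; rewrite (ind_in (s - 1)) by lia; lra.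
  + apply Edge; rewrite (ind_in (s + Z.of_nat len - 1)) by lia; lra.
  + assert (Hw1 : wave z (x + 1)%Z = (z * wave z x)%Cx).
    { unfold wave; replace (Z.to_nat (x + 1)) with (S (Z.to_nat x)) by lia; reflexivity. }
    assert (Hw2 : wave z (x - 1)%Z = (Cconj z * wave z x)%Cx).
    { unfold wave; replace (Z.to_nat x) with (S (Z.to_nat (x - 1))) by lia; simpl.
      transitivity (Cr (Cnorm2 z) * Cpow z (Z.to_nat (x - 1)))%Cx;
        [rewrite Hz; fold C1; ring|apply Cx_ext; unfold Cnorm2; simpl; ring]. }
    assert (E : tri al be ga u x =
      (Cr ((/ 2) ^ n) * wave z x * (al x * z + be x + ga x * Cconj z))%Cx).
    { unfold tri, u, packet; rewrite Hw1, Hw2; fold s len; rewrite !ind_in, Rmult_1_r by lia; ring. }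
    rewrite E, !Cnorm2_mul; unfold wave; rewrite Cnorm2_Cpow by assumption.
    replace (Cnorm2 (Cr ((/ 2) ^ n))) with ((/ 4) ^ n)
      by (rewrite <- half_pow_sq; unfold Cnorm2; simpl; ring).
    specialize (HN n x ltac:(pose proof (starts_ge_N N n); unfold s in D; lia)).
    rewrite (ind_in s len) by lia.
    assert (0 <= 10 * B * (/ 4) ^ n * (ind (s - 1) 2 x + ind (s + Z.of_nat len - 1) 2 x))
      by (repeat apply Rmult_le_pos; lra).
    rewrite !Rmult_1_r.
    apply Rmult_le_compat_l with (r := (/ 4) ^ n) in HN; [lra|assumption].
  + assert (E : tri al be ga u x = C0).
    { unfold tri, u; rewrite !packet_out by (fold s; fold len; lia); ring. }
    rewrite E, Cnorm2_C0.
    apply Rplus_le_le_0_compat; repeat apply Rmult_le_pos; lra.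
- unfold F; rewrite zsum_plus, !zsum_scal, zsum_plus.
  pose proof (zsum_ind_le s len a m) as I1; pose proof (zsum_ind_le (s - 1) 2 a m) as I2.
  pose proof (zsum_ind_le (s + Z.of_nat len - 1) 2 a m) as I3; simpl in I2, I3.
  pose proof (quarter_pow n) as Hq; fold len in Hq.
  assert ((/ 4) ^ n * zsum (ind s len) a m <= 1).
  { rewrite <- Hq, Rmult_comm; apply Rmult_le_compat_r; assumption. }
  assert (0 <= 10 * B * (/ 4) ^ n) by (repeat apply Rmult_le_pos; lra).
  nra.
Qed.

Definition packet_sum z s (w : nat -> Cx) (k : nat) (x : Z) : Cx :=
  csum k (fun n => w n * packet z s n x)%Cx.

(** Along [starts], packets of number at least [x] vanish at [x], so this truncation is the full
    series. It need not be square summable; only its image under [T] is controlled. *)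
Definition packet_series z s (w : nat -> Cx) (x : Z) : Cx := packet_sum z s w (Z.to_nat x) x.

Lemma packet_sum_stable z N w k x : (Z.to_nat x <= k)%nat ->
  packet_sum z (starts N) w k x = packet_series z (starts N) w x.
Proof.
intros H; unfold packet_series, packet_sum; induction H as [|k H IH]; [reflexivity|].
simpl; rewrite IH, packet_out; [ring|].
pose proof (starts_ge N k); lia.
Qed.

Lemma packet_series_block z N w n x :
  (starts N n <= x < starts N n + Z.of_nat (4 ^ n))%Z ->
  packet_series z (starts N) w x = (w n * packet z (starts N) n x)%Cx.
Proof.
intros Hx; rewrite <- (packet_sum_stable z N w (S n + Z.to_nat x)) by lia.
unfold packet_sum.
rewrite <- (csum_delta (S n + Z.to_nat x) (fun i => w i * packet z (starts N) i x)%Cx n) by lia.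
apply csum_ext; intros i Hi; destruct (Nat.eq_dec i n) as [->|Hn]; [ring|].
rewrite packet_out; [ring|].
destruct (Nat.lt_total i n) as [H|[H|H]]; [|lia|]; pose proof (starts_gap N _ _ H); lia.
Qed.

Lemma packet_series_approximable al be ga z N w :
  tri_bounded al be ga -> Cnorm2 z = 1 -> (forall n, Cnorm2 (w n) <= 1) ->
  (forall n x, (N n <= x)%Z -> Cnorm2 (al x * z + be x + ga x * Cconj z)%Cx <= (/ 4) ^ n) ->
  approximable (tri al be ga) (tri al be ga (packet_series z (starts N) w)).
Proof.
intros [B HB] Hz Hw HN eps Heps.
assert (B0 : 0 <= B) by (destruct (HB 0%Z); pose proof (Cnorm2_ge0 (al 0%Z)); lra).
pose proof (packet_image_small al be ga z N B HB Hz HN) as Hsmall.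
set (T := tri al be ga) in *; set (P := packet_sum z (starts N) w).
set (C := 1 + 40 * B) in *.
(* The constant reproduces itself: [2 C (/ 4)^k + 2 (4 C (/ 4)^(k + 1)) = 4 C (/ 4)^k]. *)
assert (Htail : forall m k a n,
  zsum (sq (fun x => T (P (k + m)%nat) x - T (P k) x)%Cx) a n <= 4 * C * (/ 4) ^ k).
{ induction m as [|m IH]; intros k a n.
  - rewrite Nat.add_0_r, zsum_zero.
    + assert (0 <= (/ 4) ^ k) by (apply pow_le; lra); unfold C; nra.
    + intros x _; unfold sq; transitivity (Cnorm2 C0); [f_equal; ring|apply Cnorm2_C0].
  - apply Rle_trans with (zsum (fun x => 2 * sq (T (packet z (starts N) k)) x
      + 2 * sq (fun x => T (P (S k + m)%nat) x - T (P (S k)) x)%Cx x) a n).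
    + apply zsum_le; intros x _; unfold sq.
      replace (k + S m)%nat with (S k + m)%nat by lia.
      replace (T (P (S k + m)%nat) x - T (P k) x)%Cx
        with ((w k * T (packet z (starts N) k) x) + (T (P (S k + m)%nat) x - T (P (S k)) x))%Cx.
      * pose proof (Cnorm2_add_le (w k * T (packet z (starts N) k) x)%Cx (T (P (S k + m)%nat) x - T (P (S k)) x)%Cx) as H.
        rewrite Cnorm2_mul in H.
        pose proof (Hw k); pose proof (Cnorm2_ge0 (T (packet z (starts N) k) x)).
        assert (Cnorm2 (w k) * Cnorm2 (T (packet z (starts N) k) x) <= 1 * Cnorm2 (T (packet z (starts N) k) x))
          by (apply Rmult_le_compat_r; assumption).
        lra.
      * generalize (T (P (S k + m)%nat) x); intros t.
        unfold P at 1, T, packet_sum, tri; simpl csum.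
        unfold P, packet_sum; ring.
    + rewrite zsum_plus, (zsum_scal 2 (sq (T (packet z (starts N) k)))),
        (zsum_scal 2 (sq (fun x => T (P (S k + m)%nat) x - T (P (S k)) x)%Cx)).
      specialize (IH (S k) a n); specialize (Hsmall k a n); simpl pow in IH.
      lra. }
assert (HC : 0 < 4 * C) by (unfold C; lra).
destruct (pow_lt_1_zero (/ 4) ltac:(rewrite Rabs_pos_eq; lra) (eps / (4 * C))
  ltac:(apply Rdiv_lt_0_compat; assumption)) as [k Hk].
specialize (Hk k (Nat.le_refl k)); rewrite Rabs_pos_eq in Hk by (apply pow_le; lra).
exists (P k); split.
- apply sl2_csum; intros i _; apply packet_sl2, Hz.
(* A window sees finitely many packets: on it the series may be replaced by the partial sum of
   length [k + m]. *)
- intros a n; set (m := Z.to_nat (Z.abs a + Z.of_nat n + 1)).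
  rewrite (zsum_ext _ (sq (fun x => T (P (k + m)%nat) x - T (P k) x)%Cx)).
  + apply Rle_trans with (1 := Htail m k a n).
    apply Rlt_div_r in Hk; [lra|assumption].
  + intros x Hx; unfold sq; do 2 f_equal; unfold T, tri, P.
    rewrite !packet_sum_stable by lia; reflexivity.
Qed.

(* The formal solutions of [T h = 0] on a half-line where [al] does not vanish
   form a space of dimension at most 2, so of three packet series with disjoint
   supports some nontrivial combination would have to be square summable. *)
Lemma tri_range_not_closed al be ga z : tri_bounded al be ga -> Cnorm2 z = 1 ->
  lim_plus (fun x => Cnorm2 (al x * z + be x + ga x * Cconj z)%Cx) 0 ->
  (exists N, forall x, (N <= x)%Z -> al x <> C0) ->
  ~ (forall phi, approximable (tri al be ga) phi ->
       exists psi, sl2 psi /\ forall x, phi x = tri al be ga psi x).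
Proof.
intros HB Hz Hlim [N0 HN0] Hcl.
assert (HN : exists N : nat -> Z, forall n x, (N n <= x)%Z ->
  Cnorm2 (al x * z + be x + ga x * Cconj z)%Cx <= (/ 4) ^ n).
{ assert (H : forall n : nat, exists N, forall x, (N <= x)%Z ->
    Cnorm2 (al x * z + be x + ga x * Cconj z)%Cx <= (/ 4) ^ n).
  { intros n; destruct (Hlim ((/ 4) ^ n) ltac:(apply pow_lt; lra)) as [N HN].
    exists N; intros x Hx; specialize (HN x Hx); apply Rabs_def2 in HN; lra. }
  exists (fun n => proj1_sig (constructive_indefinite_description _ (H n))).
  intros n; apply (proj2_sig (constructive_indefinite_description _ (H n))). }
destruct HN as [N HN]; set (T := tri al be ga) in *.
set (w := fun j n : nat => if Nat.eq_dec (n mod 3) j then C1 else C0).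
set (U := fun j => packet_series z (starts N) (w j)).
assert (HU : forall j : nat, exists psi, sl2 psi /\ forall x, T (U j) x = T psi x).
{ intros j; apply Hcl, packet_series_approximable; try assumption.
  intros n; unfold w; destruct (Nat.eq_dec (n mod 3) j); unfold Cnorm2; simpl; lra. }
set (psi := fun j => proj1_sig (constructive_indefinite_description _ (HU j))).
assert (Hpsi : forall j, sl2 (psi j) /\ forall x, T (U j) x = T (psi j) x)
  by (intros j; apply (proj2_sig (constructive_indefinite_description _ (HU j)))).
set (h := fun j x => (psi j x - U j x)%Cx).
(* The values of [h 0], [h 1], [h 2] at the sites [N0 - 1] and [N0]. With no annihilators, the rank
   inequality reads [3 <= 2 + d], so some nontrivial combination vanishes at both sites. *)
destruct (CxLinearAlgebra.kernel_basis_and_range 3 2 (fun j i => h j (N0 - 1 + Z.of_nat i)%Z))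
  as (d & e & E1 & E2 & _ & E4).
destruct (E4 O (fun _ _ => C0)) as [Hd _]; [intros c _ j Hj; lia|intros; lia|].
set (c := e O).
assert (Hc : exists j, (j < 3)%nat /\ c j <> C0).
{ destruct (classic (exists j, (j < 3)%nat /\ c j <> C0)) as [H|H]; [exact H|exfalso].
  apply C1_neq0; apply (E2 (fun i => if Nat.eq_dec i O then C1 else C0)) with (j := O); [|lia].
  intros x Hx; rewrite (csum_ext d _ (fun i => e i x * (if Nat.eq_dec i 0 then C1 else C0))%Cx)
    by (intros; ring).
  rewrite (csum_delta d (fun i => e i x)) by lia.
  destruct (classic (e O x = C0)) as [E|E]; [exact E|].
  exfalso; apply H; exists x; split; assumption. }
set (Psi := fun x => csum 3 (fun j => c j * psi j x)%Cx).
set (H := fun x => csum 3 (fun j => c j * h j x)%Cx).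
assert (TH : forall x, T H x = C0).
{ intros x; unfold H, T; rewrite tri_csum, (csum_ext 3 _ (fun _ => C0)), csum_0; [reflexivity|].
  intros j _; unfold h; rewrite tri_sub; fold T; rewrite (proj2 (Hpsi j)); ring. }
assert (H0 : forall n, H (N0 - 1 + Z.of_nat n)%Z = C0 /\ H (N0 - 1 + Z.of_nat (S n))%Z = C0).
{ induction n as [|n [I1 I2]].
  - split; [apply (E1 O O)|apply (E1 O 1%nat)]; lia.
  - split; [exact I2|].
    set (x := (N0 - 1 + Z.of_nat (S n))%Z) in *.
    replace (N0 - 1 + Z.of_nat (S (S n)))%Z with (x + 1)%Z by lia.
    replace (N0 - 1 + Z.of_nat n)%Z with (x - 1)%Z in I1 by lia.
    specialize (TH x); unfold T, tri in TH; rewrite I1, I2 in TH.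
    assert (Ha : al x <> C0) by (apply HN0; lia).
    transitivity ((al x * H (x + 1)%Z + be x * C0 + ga x * C0) / al x)%Cx; [field; assumption|].
    rewrite TH; field; assumption. }
assert (EPsi : forall x, (N0 - 1 <= x)%Z -> Psi x = csum 3 (fun j => c j * U j x)%Cx).
{ intros x Hx; destruct (H0 (Z.to_nat (x - (N0 - 1)))) as [E _].
  replace (N0 - 1 + Z.of_nat (Z.to_nat (x - (N0 - 1))))%Z with x in E by lia.
  transitivity (H x + csum 3 (fun j => c j * U j x))%Cx.
  - unfold H, Psi, h; simpl; ring.
  - rewrite E; ring. }
destruct Hc as (j & Hj & Hcj); pose proof (Cnorm2_gt0 _ Hcj) as Gj.
assert (SPsi : sl2 Psi) by (apply sl2_csum; intros; apply Hpsi).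
destruct (zsum_tail_small (sq Psi) (sq_ge0 Psi) SPsi (Cnorm2 (c j) / 2) ltac:(lra)) as [L HL].
(* A packet of residue [j] beyond [L] and [N0]. On it [Psi] is [c j] times a unit vector, against
   the tail bound [Cnorm2 (c j) / 2]. *)
set (n := (j + (L + Z.to_nat N0) * 3)%nat).
assert (Hn : (n mod 3 = j)%nat) by (unfold n; rewrite Nat.Div0.mod_add; apply Nat.mod_small, Hj).
pose proof (starts_ge N n) as Hsn.
specialize (HL (starts N n) (4 ^ n)%nat ltac:(lia)).
rewrite (zsum_ext _ (fun x => Cnorm2 (c j) * (/ 4) ^ n)) in HL.
- assert (E : forall m a, zsum (fun _ => Cnorm2 (c j) * (/ 4) ^ n) a m = Cnorm2 (c j) * (INR m * (/ 4) ^ n)).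
  { induction m as [|m IH]; intros a; [simpl; ring|].
    cbn [zsum]; rewrite IH, S_INR; ring. }
  rewrite E, quarter_pow in HL; lra.
- intros x Hx; unfold sq; rewrite EPsi by lia.
  rewrite (csum_ext 3 _ (fun i => (c i * packet z (starts N) n x) * (if Nat.eq_dec i j then C1 else C0))%Cx).
  + rewrite (csum_delta 3 (fun i => c i * packet z (starts N) n x)%Cx) by assumption.
    rewrite Cnorm2_mul, Cnorm2_packet, ind_in by assumption; ring.
  + intros i Hi; unfold U; rewrite (packet_series_block z N (w i) n) by assumption.
    unfold w; rewrite Hn.
    destruct (Nat.eq_dec j i), (Nat.eq_dec i j); try lia; ring.
Qed.

(** * Limits of the coin and zeros of the limit symbol *)

Lemma Cmul_conj z : (z * Cconj z)%Cx = Cr (Cnorm2 z).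
Proof. apply Cx_ext; unfold Cnorm2; simpl; ring. Qed.

Lemma Cr_opp r : Cr (- r) = (- Cr r)%Cx.
Proof. apply Cx_ext; simpl; ring. Qed.

Lemma Cr_add r s : Cr (r + s) = (Cr r + Cr s)%Cx.
Proof. apply Cx_ext; simpl; ring. Qed.

Lemma Cr_sub r s : Cr (r - s) = (Cr r - Cr s)%Cx.
Proof. apply Cx_ext; simpl; ring. Qed.

Lemma Cr_m1 : Cr (-1) = (- C1)%Cx.
Proof. apply Cx_ext; simpl; ring. Qed.

Definition vanishing (f : Z -> Cx) : Prop :=
  forall eps, 0 < eps -> exists N, forall x, (N <= x)%Z -> Cnorm2 (f x) <= eps.

Lemma vanishing_add f g : vanishing f -> vanishing g -> vanishing (fun x => f x + g x)%Cx.
Proof.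
intros Hf Hg eps Heps; destruct (Hf (eps / 4) ltac:(lra)) as [N1 H1].
destruct (Hg (eps / 4) ltac:(lra)) as [N2 H2]; exists (Z.max N1 N2); intros x Hx.
specialize (H1 x ltac:(lia)); specialize (H2 x ltac:(lia)).
pose proof (Cnorm2_add_le (f x) (g x)); lra.
Qed.

Lemma vanishing_scal c f : vanishing f -> vanishing (fun x => c * f x)%Cx.
Proof.
intros Hf eps Heps; pose proof (Cnorm2_ge0 c).
destruct (Hf (eps / (Cnorm2 c + 1))) as [N HN]; [apply Rdiv_lt_0_compat; lra|].
exists N; intros x Hx; specialize (HN x Hx); rewrite Cnorm2_mul.
apply Rle_div_r in HN; [|lra]; pose proof (Cnorm2_ge0 (f x)); nra.
Qed.

Lemma vanishing_shift t f : vanishing f -> vanishing (fun x => f (x + t)%Z).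
Proof.
intros Hf eps Heps; destruct (Hf eps Heps) as [N HN]; exists (N - t)%Z; intros x Hx; apply HN; lia.
Qed.

Lemma vanishing_conj f : vanishing f -> vanishing (fun x => Cconj (f x)).
Proof.
intros Hf eps Heps; destruct (Hf eps Heps) as [N HN]; exists N; intros x Hx.
rewrite Cnorm2_conj; apply HN, Hx.
Qed.

Lemma vanishing_of_lim (f : Z -> Cx) l :
  lim_plus (fun x => re (f x)) (re l) -> lim_plus (fun x => im (f x)) (im l) ->
  vanishing (fun x => f x - l)%Cx.
Proof.
intros H1 H2 eps Heps.
set (d := Rmin 1 (eps / 2)).
assert (Hd : 0 < d) by (unfold d; apply Rmin_pos; lra).
assert (Hd1 : d <= 1) by apply Rmin_l; assert (Hd2 : d <= eps / 2) by apply Rmin_r.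
destruct (H1 d Hd) as [N1 HN1]; destruct (H2 d Hd) as [N2 HN2].
exists (Z.max N1 N2); intros x Hx.
specialize (HN1 x ltac:(lia)); specialize (HN2 x ltac:(lia)).
apply Rabs_def2 in HN1; apply Rabs_def2 in HN2.
unfold Cnorm2; simpl; nra.
Qed.

Lemma lim_plus_seq f l : lim_plus f l -> is_lim_seq (fun n => f (Z.of_nat n)) l.
Proof.
intros H; apply is_lim_seq_spec; intros eps; destruct (H eps (cond_pos eps)) as [N HN].
exists (Z.to_nat N); intros n Hn; apply HN; lia.
Qed.

Lemma lim_seq_const_eq (f : nat -> R) (l r : R) :
  is_lim_seq f l -> (forall n, f n = r) -> l = r.
Proof.
intros H E; apply is_lim_seq_unique in H.
rewrite (Lim_seq_ext _ (fun _ => r)) in H by assumption.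
rewrite Lim_seq_const in H; injection H; auto.
Qed.

(** A nonzero [b x] forces [a1 x + a2 x = 0], while [b x = 0] leaves only 1 and -1 for [a1 x] and
    [a2 x]. In the limit nontriviality excludes equal signs; far out the sum is then below 2 in
    modulus, hence 0. *)
Lemma nontrivial_limit a1 a2 b aR a2R bR : coin_ok a1 a2 b ->
  lim_plus a1 aR -> lim_plus a2 a2R ->
  lim_plus (fun x => re (b x)) (re bR) -> lim_plus (fun x => im (b x)) (im bR) ->
  ~ coin_trivial aR a2R bR ->
  a2R = - aR /\ aR ^ 2 + Cnorm2 bR = 1 /\ right_limit a1 a2 aR.
Proof.
intros Hok L1 L2 L3 L4 Hnt.
pose proof (lim_plus_seq _ _ L1) as S1; pose proof (lim_plus_seq _ _ L2) as S2.
pose proof (lim_plus_seq _ _ L3) as S3; pose proof (lim_plus_seq _ _ L4) as S4.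
assert (Sb : is_lim_seq (fun n => Cnorm2 (b (Z.of_nat n))) (Cnorm2 bR)).
{ unfold Cnorm2; apply is_lim_seq_plus'; apply is_lim_seq_mult'; assumption. }
assert (E1 : aR * aR + Cnorm2 bR = 1).
{ apply (lim_seq_const_eq (fun n => a1 (Z.of_nat n) * a1 (Z.of_nat n) + Cnorm2 (b (Z.of_nat n)))).
  - apply is_lim_seq_plus'; [apply is_lim_seq_mult'|]; assumption.
  - intros n; destruct (Hok (Z.of_nat n)) as (H & _); lra. }
assert (E2 : a2R * a2R + Cnorm2 bR = 1).
{ apply (lim_seq_const_eq (fun n => a2 (Z.of_nat n) * a2 (Z.of_nat n) + Cnorm2 (b (Z.of_nat n)))).
  - apply is_lim_seq_plus'; [apply is_lim_seq_mult'|]; assumption.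
  - intros n; destruct (Hok (Z.of_nat n)) as (_ & H & _); lra. }
assert (Hsum : forall x, (a1 x + a2 x) * Cnorm2 (b x) = 0).
{ intros x; destruct (Hok x) as (_ & _ & H); apply (f_equal Cnorm2) in H.
  rewrite Cnorm2_mul, Cnorm2_C0 in H; apply Rmult_integral in H; destruct H as [H|H].
  - rewrite H; ring.
  - unfold Cnorm2 in H at 1; simpl in H.
    assert (a1 x + a2 x = 0) as -> by nra; ring. }
assert (E3 : (aR + a2R) * Cnorm2 bR = 0).
{ apply (lim_seq_const_eq (fun n => (a1 (Z.of_nat n) + a2 (Z.of_nat n)) * Cnorm2 (b (Z.of_nat n)))).
  - apply is_lim_seq_mult'; [apply is_lim_seq_plus'|]; assumption.
  - intros n; apply Hsum. }
assert (E4 : a2R = - aR).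
{ apply Rmult_integral in E3; destruct E3 as [E3|E3]; [lra|].
  pose proof (Cnorm2_eq0 _ E3) as Eb; rewrite E3 in E1, E2.
  assert (D1 : (aR - 1) * (aR + 1) = 0) by lra; assert (D2 : (a2R - 1) * (a2R + 1) = 0) by lra.
  apply Rmult_integral in D1; apply Rmult_integral in D2.
  destruct D1, D2; try lra; exfalso; apply Hnt; [left|right]; repeat split; try lra; assumption. }
split; [assumption|]; split; [simpl; lra|]; split; [assumption|].
destruct (L1 1 ltac:(lra)) as [N1 HN1]; destruct (L2 1 ltac:(lra)) as [N2 HN2].
exists (Z.max N1 N2); intros x Hx.
specialize (HN1 x ltac:(lia)); specialize (HN2 x ltac:(lia)); rewrite E4 in HN2.
apply Rabs_def2 in HN1; apply Rabs_def2 in HN2.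
pose proof (Hsum x) as H; apply Rmult_integral in H; destruct H as [H|H]; [lra|].
destruct (Hok x) as (H1 & H2 & _); rewrite H in H1, H2.
assert (D1 : (a1 x - 1) * (a1 x + 1) = 0) by lra; assert (D2 : (a2 x - 1) * (a2 x + 1) = 0) by lra.
apply Rmult_integral in D1; apply Rmult_integral in D2; destruct D1, D2; lra.
Qed.

Definition closed_range (T : (Z -> Cx) -> Z -> Cx) : Prop :=
  forall phi, approximable T phi -> exists psi, sl2 psi /\ forall x, phi x = T psi x.

(* The limit symbol [b z - 2 k a - k^2 conj b / z] has the roots
   [k (a - 1) / b] and [k (a + 1) / b]. *)
Lemma charge_not_closed c k a1 a2 b a bR : c <> C0 -> k <> C0 -> coin_ok a1 a2 b ->
  right_limit a1 a2 a -> a ^ 2 + Cnorm2 bR = 1 ->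
  lim_plus (fun x => re (b x)) (re bR) -> lim_plus (fun x => im (b x)) (im bR) ->
  Cnorm2 k * (1 - a) = 1 + a \/ Cnorm2 k * (1 + a) = 1 - a ->
  ~ closed_range (charge c k a1 a2 b).
Proof.
intros Hc Hk Hok [L1 [N1 HN1]] E1 L3 L4 Hdeg.
pose proof (Cnorm2_gt0 k Hk) as Hs.
(* The degeneracy relation with [Cnorm2 k > 0] excludes [a = 1] and [a = -1], so [bR] is nonzero. *)
assert (Ha : -1 < a < 1).
{ pose proof (sq_le1_bounds a _ (Cnorm2_ge0 bR) E1).
  destruct H as [H1 H2]; split; destruct Hdeg as [D|D]; nra. }
assert (GbR : 0 < Cnorm2 bR) by (simpl in E1; nra).
assert (HbR : bR <> C0) by (intros E; rewrite E, Cnorm2_C0 in GbR; lra).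
(* Either alternative says that one of the roots [k (a + t) / bR] has modulus 1, with [t = -1] for
   the first and [t = 1] for the second. *)
assert (Hz : exists t, (t = 1 \/ t = -1) /\ Cnorm2 k * (a + t) ^ 2 = 1 - a ^ 2).
{ destruct Hdeg as [D|D]; [exists (-1)|exists 1]; (split; [tauto|]).
  - transitivity (Cnorm2 k * (1 - a) * (1 - a)); [ring|rewrite D; ring].
  - transitivity (Cnorm2 k * (1 + a) * (1 + a)); [ring|rewrite D; ring]. }
destruct Hz as (t & Ht & Et).
set (z := (k * Cr (a + t) / bR)%Cx).
assert (Hz : Cnorm2 z = 1).
{ unfold z, Cdiv; rewrite !Cnorm2_mul, Cnorm2_inv by assumption.
  replace (Cnorm2 (Cr (a + t))) with ((a + t) ^ 2) by (unfold Cnorm2; simpl; ring).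
  rewrite Et; replace (1 - a ^ 2) with (Cnorm2 bR) by lra; field; lra. }
assert (Hzz : (z * Cconj z)%Cx = C1).
{ rewrite Cmul_conj, Hz; reflexivity. }
assert (Hz0 : z <> C0) by (intros E; rewrite E, Cnorm2_C0 in Hz; lra).
assert (Hsym : (bR * z - Cr (2 * a) * k - k * k * Cconj bR * Cconj z)%Cx = C0).
{ assert (Ebz : (bR * z)%Cx = (k * Cr (a + t))%Cx) by (unfold z; field; assumption).
  assert (P : (z * (bR * z - Cr (2 * a) * k - k * k * Cconj bR * Cconj z))%Cx = C0).
  { transitivity (z * (bR * z) - Cr (2 * a) * k * z - k * k * Cconj bR * (z * Cconj z))%Cx; [ring|].
    rewrite Hzz, Ebz.
    assert (Hbb : (bR * Cconj bR)%Cx = Cr (1 - a ^ 2)).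
    { rewrite Cmul_conj; f_equal; lra. }
    transitivity ((k * Cr (a + t) * (bR * z) - Cr (2 * a) * k * (bR * z)
       - k * k * (bR * Cconj bR)) / bR)%Cx; [field; assumption|].
    rewrite Hbb, Ebz.
    transitivity (k * k * (Cr (a + t) * Cr (a + t) - Cr (2 * a) * Cr (a + t) - Cr (1 - a ^ 2)) / bR)%Cx;
      [field; assumption|].
    replace (Cr (a + t) * Cr (a + t) - Cr (2 * a) * Cr (a + t) - Cr (1 - a ^ 2))%Cx with C0;
      [field; assumption|].
    apply Cx_ext; simpl; destruct Ht as [-> | ->]; ring. }
  transitivity ((z * (bR * z - Cr (2 * a) * k - k * k * Cconj bR * Cconj z)) / z)%Cx;
    [field; assumption|rewrite P; field; assumption]. }
pose proof (vanishing_of_lim b bR L3 L4) as Vb.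
apply (tri_range_not_closed _ _ _ z (charge_bounded c k a1 a2 b Hok) Hz).
- assert (Va1 : vanishing (fun x => Cr (a1 x) - Cr a)%Cx).
  { apply vanishing_of_lim; simpl; [exact L1|].
    intros eps Heps; exists 0%Z; intros; rewrite Rminus_diag, Rabs_R0; assumption. }
  assert (V : vanishing (fun x => c * ((z * (b (x + 1)%Z - bR) +
    (- k * ((Cr (a1 (x + 1)%Z) - Cr a) + (Cr (a1 x) - Cr a)))) +
    (- (k * k * Cconj z) * Cconj (b x - bR))))%Cx).
  { apply vanishing_scal.
    apply (vanishing_add (fun x => z * (b (x + 1)%Z - bR) + (- k * ((Cr (a1 (x + 1)%Z) - Cr a) + (Cr (a1 x) - Cr a))))%Cx).
    - apply (vanishing_add (fun x => z * (b (x + 1)%Z - bR))%Cx).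
      + apply vanishing_scal, (vanishing_shift 1 _ Vb).
      + apply vanishing_scal, (vanishing_add (fun x => Cr (a1 (x + 1)%Z) - Cr a)%Cx); [|assumption].
        apply (vanishing_shift 1 _ Va1).
    - apply vanishing_scal, vanishing_conj, Vb. }
  intros eps Heps; destruct (V (eps / 2) ltac:(lra)) as [N HN].
  exists (Z.max N N1); intros x Hx; specialize (HN x ltac:(lia)).
  rewrite Rminus_0_r, Rabs_pos_eq by apply Cnorm2_ge0.
  match goal with |- Cnorm2 ?d < _ => match type of HN with Cnorm2 ?d' <= _ =>
    replace d with d'; [lra|] end end.
  rewrite (HN1 (x + 1)%Z) by lia.
  replace (Cconj (b x - bR)%Cx) with (Cconj (b x) - Cconj bR)%Cx by (apply Cx_ext; simpl; ring).
  replace (Cr (- a1 (x + 1)%Z - a1 x)) with (- Cr (a1 (x + 1)%Z) - Cr (a1 x))%Cx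
    by (apply Cx_ext; simpl; ring).
  transitivity (c * b (x + 1)%Z * z + c * (k * (- Cr (a1 (x + 1)%Z) - Cr (a1 x)))
    + - (c * (k * k * Cconj (b x))) * Cconj z
    - c * (bR * z - (Cr a + Cr a) * k - k * k * Cconj bR * Cconj z))%Cx; [ring|].
  replace (Cr a + Cr a)%Cx with (Cr (2 * a)) by (apply Cx_ext; simpl; ring).
  rewrite Hsym; ring.
- destruct (Vb (Cnorm2 bR / 4) ltac:(lra)) as [N HN]; exists N; intros x Hx.
  apply Cmul_neq0; [assumption|]; intros E.
  specialize (HN (x + 1)%Z ltac:(lia)); rewrite E in HN.
  replace (C0 - bR)%Cx with (- bR)%Cx in HN by ring; rewrite Cnorm2_opp in HN; lra.
Qed.

Lemma closed_range_reflect al be ga :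
  closed_range (tri al be ga) -> closed_range (tri_reflect al be ga).
Proof.
intros H phi Hphi.
assert (Err : forall v : Z -> Cx, reflect (reflect v) = v).
{ intros v; apply functional_extensionality; intros x; unfold reflect; f_equal; lia. }
destruct (H (reflect phi)) as (psi & Hpsi & E).
- intros eps Heps; destruct (Hphi eps Heps) as (s & Hs & Hr).
  exists (reflect s); split; [apply sl2_reflect, Hs|]; intros a n.
  rewrite (zsum_ext _ (fun x => sq (fun y => phi y - tri_reflect al be ga s y)%Cx (- x)%Z)).
  + rewrite zsum_reflect; apply Hr.
  + intros x _; unfold sq; do 2 f_equal.
    rewrite <- (Err s) at 2; rewrite tri_reflectE, Z.opp_involutive; reflexivity.
- exists (reflect psi); split; [apply sl2_reflect, Hpsi|]; intros x.
  rewrite tri_reflectE, <- E; unfold reflect; f_equal; lia.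
Qed.

Lemma lim_minus_reflect f l : lim_minus f l -> lim_plus (fun x => f (1 - x)%Z) l.
Proof.
intros H eps Heps; destruct (H eps Heps) as [N HN]; exists (1 - N)%Z; intros x Hx; apply HN; lia.
Qed.

(** * Coordinates on the eigenspaces of Gamma *)

Definition iota_p (k : Cx) (u : Z -> Cx) : V := fun x => (u x, k * u (x - 1)%Z)%Cx.
Definition iota_m (k : Cx) (w : Z -> Cx) : V := fun x => (- (Cconj k * w x), w (x - 1)%Z)%Cx.

Lemma l2_partial_zsum psi N :
  l2_partial psi N = zsum (fun x => vnorm2 (psi x)) (- Z.of_nat N)%Z (2 * N + 1).
Proof.
unfold l2_partial; rewrite Nat.add_1_r; induction (2 * N)%nat as [|n IH].
- simpl; rewrite Rplus_0_l; do 2 f_equal; lia.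
- rewrite tech5, IH; cbn [zsum]; f_equal; do 2 f_equal; lia.
Qed.

Lemma vnorm2_ge0 z : 0 <= vnorm2 z.
Proof. unfold vnorm2; pose proof (Cnorm2_ge0 (fst z)); pose proof (Cnorm2_ge0 (snd z)); lra. Qed.

Lemma l2_partial_windows psi M : (forall N, l2_partial psi N <= M) ->
  forall a n, zsum (fun x => vnorm2 (psi x)) a n <= M.
Proof.
intros H a n; apply Rle_trans with (2 := H (Z.to_nat (Z.abs a) + n)%nat).
rewrite l2_partial_zsum; apply zsum_incl; [intros; apply vnorm2_ge0|lia|lia].
Qed.

Lemma in_l2_components psi :
  in_l2 psi <-> sl2 (fun x => fst (psi x)) /\ sl2 (fun x => snd (psi x)).
Proof.
split.
- intros [M HM]; pose proof (l2_partial_windows psi M HM) as H.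
  split; exists M; intros a n; apply Rle_trans with (2 := H a n); apply zsum_le; intros x _;
    unfold sq, vnorm2; pose proof (Cnorm2_ge0 (fst (psi x))); pose proof (Cnorm2_ge0 (snd (psi x))); lra.
- intros [[M1 H1] [M2 H2]]; exists (M1 + M2); intros N; rewrite l2_partial_zsum.
  unfold vnorm2; rewrite zsum_plus; apply Rplus_le_compat; [apply H1|apply H2].
Qed.

Definition kfactor (p : R) (q : Cx) : Cx := (Cconj q * Cr (/ (1 + p)))%Cx.
(** The diagonal entry [- (1 + p)] of [Gamma - 1] divided by [2i]. *)
Definition cfactor (p : R) : Cx := mkCx 0 ((1 + p) / 2).

Section Coordinates.
Context (p : R) (q : Cx) (a1 a2 : Z -> R) (b : Z -> Cx).
Context (Hpq : p ^ 2 + Cnorm2 q = 1) (Hq : q <> C0).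

Local Notation k := (kfactor p q).
Local Notation c := (cfactor p).

Lemma p_bounds : -1 < p < 1.
Proof. pose proof (Cnorm2_gt0 q Hq); nra. Qed.

Lemma kfactor_spec : Cconj q = (Cr (1 + p) * k)%Cx /\ q = (Cr (1 + p) * Cconj k)%Cx /\
  (k * Cconj k)%Cx = Cr ((1 - p) / (1 + p)).
Proof.
pose proof p_bounds as Hp; unfold Cnorm2 in Hpq.
assert (E : re q * re q + im q * im q = (1 - p) * (1 + p)) by lra.
repeat split; apply Cx_ext; unfold kfactor; simpl; try (field; lra).
transitivity ((re q * re q + im q * im q) * (/ (1 + p) * / (1 + p))); [ring|].
rewrite E; field; lra.
Qed.

Lemma Cnorm2_kfactor : Cnorm2 k = (1 - p) / (1 + p).
Proof.
destruct kfactor_spec as (_ & _ & H); rewrite Cmul_conj in H; apply (f_equal re) in H; exact H.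
Qed.

Lemma kfactor_neq0 : k <> C0.
Proof.
intros E; pose proof p_bounds; pose proof Cnorm2_kfactor as H0; rewrite E, Cnorm2_C0 in H0.
assert (0 < (1 - p) / (1 + p)) by (apply Rdiv_lt_0_compat; lra); lra.
Qed.

Lemma cfactor_neq0 : c <> C0.
Proof. intros E; pose proof p_bounds; apply (f_equal im) in E; simpl in E; lra. Qed.

Lemma iota_p_eigen u x : Gam p q (iota_p k u) x = iota_p k u x.
Proof.
pose proof p_bounds; destruct kfactor_spec as (E1 & E2 & E3).
set (k0 := k) in *; clearbody k0; unfold Gam, iota_p; simpl fst; simpl snd.
rewrite Z.add_simpl_r, E1, E2; f_equal.
- transitivity ((Cr p + Cr (1 + p) * (k0 * Cconj k0)) * u x)%Cx; [ring|].
  rewrite E3; apply Cx_ext; simpl; field; lra.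
- rewrite Cr_add, Cr_opp; fold C1; ring.
Qed.

Lemma iota_m_eigen w x : Gam p q (iota_m k w) x = vscale (Cr (-1)) (iota_m k w) x.
Proof.
pose proof p_bounds; destruct kfactor_spec as (E1 & E2 & E3).
set (k0 := k) in *; clearbody k0; unfold Gam, iota_m, vscale; simpl fst; simpl snd.
rewrite Z.add_simpl_r, E1, E2; f_equal.
- rewrite Cr_add, Cr_m1; fold C1; ring.
- transitivity ((- (Cr (1 + p) * (k0 * Cconj k0)) + Cr (- p)) * w (x - 1)%Z)%Cx; [ring|].
  rewrite E3; apply Cx_ext; simpl; field; lra.
Qed.

Lemma Hplus_iff psi :
  Hplus p q psi <-> exists u, sl2 u /\ forall x, psi x = iota_p k u x.
Proof.
pose proof p_bounds as Hp; destruct kfactor_spec as (E1 & E2 & E3); split.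
- intros [Hl2 HG]; apply in_l2_components in Hl2; destruct Hl2 as [H1 H2].
  exists (fun x => fst (psi x)); split; [exact H1|]; intros x.
  specialize (HG x); apply (f_equal snd) in HG; unfold Gam in HG; simpl snd in HG.
  unfold iota_p; rewrite (surjective_pairing (psi x)) at 1; f_equal.
  transitivity ((Cconj q * fst (psi (x - 1)%Z) + Cr (- p) * snd (psi x) + Cr p * snd (psi x)) * Cr (/ (1 + p)))%Cx.
  + rewrite HG; apply Cx_ext; simpl; field; lra.
  + unfold kfactor; apply Cx_ext; simpl; field; lra.
- intros (u & Hu & E).
  assert (E' : psi = iota_p k u) by (apply functional_extensionality; exact E).
  subst psi; split; [|intros x; apply iota_p_eigen].
  apply in_l2_components; unfold iota_p; simpl; split; [exact Hu|].
  apply sl2_scal, (sl2_shift (-1)), Hu.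
Qed.

Lemma Hminus_iff psi :
  Hminus p q psi <-> exists w, sl2 w /\ forall x, psi x = iota_m k w x.
Proof.
pose proof p_bounds as Hp; destruct kfactor_spec as (E1 & E2 & E3); split.
- intros [Hl2 HG]; apply in_l2_components in Hl2; destruct Hl2 as [H1 H2].
  exists (fun x => snd (psi (x + 1)%Z)); split; [apply (sl2_shift 1 (fun x => snd (psi x))), H2|]; intros x.
  specialize (HG x); apply (f_equal fst) in HG; unfold Gam, vscale in HG; simpl fst in HG.
  unfold iota_m; rewrite (surjective_pairing (psi x)) at 1; rewrite Z.sub_add; f_equal.
  transitivity (- (Cr (/ (1 + p)) * (Cr (-1) * fst (psi x) - Cr p * fst (psi x))))%Cx.
  + apply Cx_ext; simpl; field; lra.
  + rewrite <- HG; unfold kfactor; apply Cx_ext; simpl; field; lra.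
- intros (u & Hu & E).
  assert (E' : psi = iota_m k u) by (apply functional_extensionality; exact E).
  subst psi; split; [|intros x; apply iota_m_eigen].
  apply in_l2_components; unfold iota_m; simpl; split.
  + apply (sl2_ext (fun x => - Cconj k * u x)%Cx); [intros; ring|apply sl2_scal, Hu].
  + apply (sl2_shift (-1)), Hu.
Qed.

Lemma Cmul_half_i z : (mkCx 0 (- / 2) * z)%Cx = (- (mkCx 0 (/ 2) * z))%Cx.
Proof. apply Cx_ext; simpl; ring. Qed.

Lemma Qop_iota_p u : Qop p q a1 a2 b (iota_p k u) = iota_m k (charge c k a1 a2 b u).
Proof.
pose proof p_bounds as Hp; destruct kfactor_spec as (E1 & E2 & E3).
assert (EC : Gam p q (iota_p k u) = iota_p k u)
  by (apply functional_extensionality; intros; apply iota_p_eigen).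
apply functional_extensionality; intros x; unfold Qop; rewrite EC; clear EC.
set (k0 := k) in *; clearbody k0.
unfold vscale, vsub, vadd, Gam, Coin, iota_p, iota_m, charge, tri; simpl fst; simpl snd.
rewrite Z.add_simpl_r, Z.sub_add; unfold vscale; simpl fst; simpl snd.
assert (Ec : c = (mkCx 0 (/ 2) * Cr (1 + p))%Cx) by (apply Cx_ext; unfold cfactor; simpl; field).
assert (E4 : (Cr (1 + p) * (k0 * Cconj k0))%Cx = (C1 - Cr p)%Cx)
  by (rewrite E3; apply Cx_ext; simpl; field; lra).
rewrite E1, E2, Ec, !Cr_m1, !Cr_sub, !Cmul_half_i, ?Cr_opp.
set (h := mkCx 0 (/ 2)); clearbody h.
set (A1 := Cr (a1 x)); set (A2 := Cr (a2 (x + 1)%Z));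
f_equal.
- transitivity (h * (C1 - Cr p) * (A1 * u x + Cconj (b x) * (k0 * u (x - 1)%Z))
    - h * (Cr (1 + p) * Cconj k0 * (b (x + 1)%Z * u (x + 1)%Z + A2 * (k0 * u x))))%Cx; [ring|].
  rewrite <- E4; ring.
- rewrite Cr_add; fold C1; ring.
Qed.

Lemma Qop_iota_m w : Qop p q a1 a2 b (iota_m k w) = iota_p k (charge_adj c k a1 a2 b w).
Proof.
pose proof p_bounds as Hp; destruct kfactor_spec as (E1 & E2 & E3).
assert (EC : Gam p q (iota_m k w) = vscale (Cr (-1)) (iota_m k w))
  by (apply functional_extensionality; intros; apply iota_m_eigen).
apply functional_extensionality; intros x; unfold Qop; rewrite EC; clear EC.
set (k0 := k) in *; clearbody k0.
unfold vscale, vsub, vadd, Gam, Coin, iota_p, iota_m, charge_adj, tri_adj, tri; simpl fst; simpl snd.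
rewrite ?Z.add_simpl_r, ?Z.sub_add; unfold vscale; simpl fst; simpl snd.
rewrite ?Z.add_simpl_r, ?Z.sub_add.
rewrite !Cconj_opp, !Cconj_mul, !Cconj_conj, !Cconj_Cr.
assert (Ec : Cconj c = (- (mkCx 0 (/ 2) * Cr (1 + p)))%Cx) by (apply Cx_ext; unfold cfactor; simpl; field).
assert (E4 : (Cr (1 + p) * (k0 * Cconj k0))%Cx = (C1 - Cr p)%Cx)
  by (rewrite E3; apply Cx_ext; simpl; field; lra).
rewrite E1, E2, Ec, !Cr_m1, !Cr_sub, !Cmul_half_i, ?Cr_opp.
set (h := mkCx 0 (/ 2)); clearbody h.
f_equal.
- rewrite Cr_add; fold C1; ring.
- set (A1' := Cr (a1 (x - 1)%Z)); set (A2' := Cr (a2 x)).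
  transitivity (h * ((C1 - Cr p) * (b x * (Cconj k0 * w x) - A2' * w (x - 1)%Z))
    - h * (Cr (1 + p) * k0 * (Cconj (b (x - 1)%Z) * w (x - 1 - 1)%Z - A1' * (Cconj k0 * w (x - 1)%Z))))%Cx; [ring|].
  rewrite <- E4; ring.
Qed.

End Coordinates.

(** * Transfer of kernels and ranges to the eigenspaces *)

Definition V_linear (io : (Z -> Cx) -> V) : Prop :=
  (forall c u v x, io (fun y => c * u y + v y)%Cx x = vadd (vscale c (io u)) (io v) x) /\
  (forall x, io (fun _ => C0) x = vzero x).

Lemma iota_p_linear k : V_linear (iota_p k).
Proof.
split; intros; unfold iota_p, vadd, vscale, vzero; simpl; f_equal; ring.
Qed.

Lemma iota_m_linear k : V_linear (iota_m k).
Proof.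
split; intros; unfold iota_m, vadd, vscale, vzero; simpl; f_equal; ring.
Qed.

Lemma iota_p_inj k u v : (forall x, iota_p k u x = iota_p k v x) -> forall x, u x = v x.
Proof. intros H x; apply (f_equal fst (H x)). Qed.

Lemma iota_m_inj k u v : (forall x, iota_m k u x = iota_m k v x) -> forall x, u x = v x.
Proof.
intros H x; specialize (H (x + 1)%Z); unfold iota_m in H; apply (f_equal snd) in H; simpl in H.
rewrite Z.add_simpl_r in H; exact H.
Qed.

Lemma csum_recl n f : csum (S n) f = (f O + csum n (fun i => f (S i)))%Cx.
Proof.
induction n as [|n IH]; [simpl; ring|].
change (csum (S (S n)) f) with (csum (S n) f + f (S n))%Cx; rewrite IH; simpl; ring.
Qed.

(** The start [a] is arbitrary for the induction: the tail of [seq a (S d)] starts at [S a]. *)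
Lemma lincomb_csum io : V_linear io -> forall d a c e x,
  lincomb (map c (seq a d)) (map (fun j => io (e j)) (seq a d)) x =
  io (fun y => csum d (fun j => c (a + j)%nat * e (a + j)%nat y)%Cx) x.
Proof.
intros [L0 L1]; induction d as [|d IH]; intros a c e x; simpl lincomb; [symmetry; apply L1|].
transitivity (vadd (vscale (c a) (io (e a)))
  (io (fun y => csum d (fun j => c (S a + j)%nat * e (S a + j)%nat y)%Cx)) x).
- unfold vadd; rewrite IH; reflexivity.
- rewrite <- L0; f_equal; apply functional_extensionality; intros y.
  rewrite csum_recl, Nat.add_0_r; f_equal; apply csum_ext; intros i _.
  replace (a + S i)%nat with (S a + i)%nat by lia; reflexivity.
Qed.

Lemma list_as_map (cs : list Cx) d : length cs = d ->
  cs = map (fun j => nth j cs C0) (seq 0 d).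
Proof.
intros H; apply (nth_ext _ _ C0 C0); [rewrite length_map, length_seq; assumption|].
intros n Hn; rewrite (nth_indep (map _ _) C0 (nth 0 cs C0)) by (rewrite length_map, length_seq; lia).
rewrite (map_nth (fun j => nth j cs C0)), seq_nth by lia; reflexivity.
Qed.

Lemma in_span_csum io d c e phi : V_linear io ->
  (forall x, phi x = io (fun y => csum d (fun j => c j * e j y)%Cx) x) ->
  in_span (map (fun j => io (e j)) (seq 0 d)) phi.
Proof.
intros Hio H; exists (map c (seq 0 d)); split; [rewrite !length_map; reflexivity|].
intros x; rewrite lincomb_csum by assumption; apply H.
Qed.

Lemma dim_eq_of_basis io (S : V -> Prop) (S' : (Z -> Cx) -> Prop) d e : V_linear io ->
  (forall u v, (forall x, io u x = io v x) -> forall x, u x = v x) ->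
  (forall psi, S psi <-> exists u, S' u /\ forall x, psi x = io u x) ->
  seq_basis S' d e -> dim_eq S d.
Proof.
intros Hio Hinj HS (B1 & B2 & B3); exists (map (fun j => io (e j)) (seq 0 d)).
split; [rewrite length_map, length_seq; reflexivity|]; split; [|split].
- apply Forall_map, Forall_forall; intros j Hj; apply in_seq in Hj.
  apply HS; exists (e j); split; [apply B1; lia|reflexivity].
- intros cs Hlen H; rewrite length_map, length_seq in Hlen.
  rewrite (list_as_map cs d Hlen); apply Forall_map, Forall_forall; intros j Hj.
  apply in_seq in Hj; apply (B2 (fun j => nth j cs C0)); [|lia].
  apply (Hinj _ (fun _ => C0)); intros x; rewrite (proj2 Hio), <- H.
  pose proof (lincomb_csum io Hio d 0 (fun j => nth j cs C0) e x) as L.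
  rewrite <- (list_as_map cs d Hlen) in L; symmetry; exact L.
- intros psi Hpsi; apply HS in Hpsi; destruct Hpsi as (u & Hu & E).
  destruct (B3 u Hu) as [c Hc]; apply (in_span_csum io d c e); [assumption|].
  intros x; rewrite E; f_equal; apply functional_extensionality; exact Hc.
Qed.

Lemma dim_eq_finite S n : dim_eq S n -> finite_dim S.
Proof. intros (vs & _ & H1 & _ & H2); exists vs; split; assumption. Qed.

Section Transfer.
Context (p : R) (q : Cx) (a1 a2 : Z -> R) (b : Z -> Cx).
Context (Hpq : p ^ 2 + Cnorm2 q = 1) (Hq : q <> C0) (Hok : coin_ok a1 a2 b).

Local Notation k := (kfactor p q).
Local Notation T := (charge (cfactor p) k a1 a2 b).
Local Notation T' := (charge_adj (cfactor p) k a1 a2 b).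

Lemma ker_Qplus_iff psi :
  (Hplus p q psi /\ forall x, Qop p q a1 a2 b psi x = vzero x) <->
  exists u, ker T u /\ forall x, psi x = iota_p k u x.
Proof.
rewrite (Hplus_iff p q Hpq Hq); split.
- intros [(u & Hu & E) H]; exists u; split; [split; [assumption|]|assumption].
  assert (E' : psi = iota_p k u) by (apply functional_extensionality; exact E); subst psi.
  apply (iota_m_inj k _ (fun _ => C0)); intros x.
  rewrite (proj2 (iota_m_linear k)), <- H, Qop_iota_p by assumption; reflexivity.
- intros (u & [Hu HT] & E); split; [exists u; split; assumption|].
  assert (E' : psi = iota_p k u) by (apply functional_extensionality; exact E); subst psi.
  intros x; rewrite Qop_iota_p by assumption.
  replace (T u) with (fun _ : Z => C0) by (apply functional_extensionality; intros; symmetry; apply HT).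
  apply (iota_m_linear k).
Qed.

(** If [T* T u = 0], then [T u] lies both in the range of [T] and in the kernel of [T*], so it
    vanishes. *)
Lemma kerHplus_iff psi :
  kerHplus p q a1 a2 b psi <-> exists u, ker T u /\ forall x, psi x = iota_p k u x.
Proof.
unfold kerHplus, Hop; rewrite (Hplus_iff p q Hpq Hq); split.
- intros [(u & Hu & E) H]; exists u; split; [split; [assumption|]|assumption].
  assert (E' : psi = iota_p k u) by (apply functional_extensionality; exact E); subst psi.
  rewrite Qop_iota_p, Qop_iota_m in H by assumption.
  pose proof (charge_bounded (cfactor p) k a1 a2 b Hok) as HB.
  apply (ker_adj_orth_self _ _ _ u (T u) HB Hu (tri_sl2 _ _ _ u HB Hu)); [|reflexivity].
  apply (iota_p_inj k _ (fun _ => C0)); intros x.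
  rewrite (proj2 (iota_p_linear k)), <- H; reflexivity.
- intros (u & Hu & E); destruct (proj2 (ker_Qplus_iff psi)) as [H1 H2]; [exists u; split; assumption|].
  split; [exists u; split; [apply Hu|assumption]|].
  replace (Qop p q a1 a2 b psi) with (iota_p k (fun _ => C0)).
  + intros x; rewrite Qop_iota_p by assumption.
    replace (T (fun _ => C0)) with (fun _ : Z => C0)
      by (apply functional_extensionality; intros; unfold charge, tri; ring).
    apply (iota_m_linear k).
  + apply functional_extensionality; intros x; rewrite H2; apply (iota_p_linear k).
Qed.

Lemma kerHminus_iff psi :
  kerHminus p q a1 a2 b psi <-> exists w, ker T' w /\ forall x, psi x = iota_m k w x.
Proof.
unfold kerHminus, Hop; rewrite (Hminus_iff p q Hpq Hq); split.
- intros [(u & Hu & E) H]; exists u; split; [split; [assumption|]|assumption].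
  assert (E' : psi = iota_m k u) by (apply functional_extensionality; exact E); subst psi.
  rewrite Qop_iota_m, Qop_iota_p in H by assumption.
  pose proof (tri_adj_bounded _ _ _ (charge_bounded (cfactor p) k a1 a2 b Hok)) as HB.
  apply (ker_adj_orth_self _ _ _ u (T' u) HB Hu (tri_sl2 _ _ _ u HB Hu)); [|reflexivity].
  pose proof (tri_adj_involutive (fun x => cfactor p * b (x + 1)%Z)%Cx
      (fun x => cfactor p * (k * Cr (a2 (x + 1)%Z - a1 x)))%Cx
      (fun x => - (cfactor p * (k * k * Cconj (b x))))%Cx) as Ea.
  intros x; transitivity (T (T' u) x); [exact (f_equal (fun F => F (T' u) x) Ea)|revert x].
  apply (iota_m_inj k _ (fun _ => C0)); intros x.
  rewrite (proj2 (iota_m_linear k)), <- H; reflexivity.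
- intros (u & [Hu HT] & E); split; [exists u; split; assumption|].
  assert (E' : psi = iota_m k u) by (apply functional_extensionality; exact E); subst psi.
  rewrite Qop_iota_m, Qop_iota_p by assumption.
  replace (T' u) with (fun _ : Z => C0) by (apply functional_extensionality; intros; symmetry; apply HT).
  replace (T (fun _ => C0)) with (fun _ : Z => C0)
    by (apply functional_extensionality; intros; unfold charge, tri; ring).
  apply (iota_m_linear k).
Qed.

Lemma vsub_iota_m u v x : vsub (iota_m k u) (iota_m k v) x = iota_m k (fun y => u y - v y)%Cx x.
Proof.
unfold vsub, vadd, vscale, iota_m; simpl; rewrite Cr_m1; f_equal; ring.
Qed.

Lemma fredholm_of_charge d e K : seq_basis (ker T) d e -> closed_range T ->
  (forall phi, sl2 phi -> exists u, sl2 u /\ forall x, outside K x -> T u x = phi x) ->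
  fredholm p q a1 a2 b.
Proof.
intros HB Hcl Hco; split; [|split].
- apply (dim_eq_finite _ d), (dim_eq_of_basis (iota_p k) _ (ker T) d e); try assumption.
  + apply iota_p_linear.
  + apply iota_p_inj.
  + apply ker_Qplus_iff.
- intros s phi Hs Hconv.
  assert (Hpt : forall eps, 0 < eps -> exists u, sl2 u /\
    (forall a n, zsum (fun x => vnorm2 (vsub (iota_m k (T u)) phi x)) a n <= eps)).
  { intros eps Heps; destruct (Hconv eps Heps) as [n Hn].
    specialize (Hn n (Nat.le_refl n)).
    destruct (proj1 (Hplus_iff p q Hpq Hq (s n)) (Hs n)) as (u & Hu & E).
    assert (E' : s n = iota_p k u) by (apply functional_extensionality; exact E).
    rewrite E', Qop_iota_p in Hn by assumption.
    exists u; split; [assumption|]; apply l2_partial_windows, Hn. }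
  set (f := fun x => snd (phi (x + 1)%Z)).
  (* The relation between the two components that characterises [iota_m] holds along the sequence
     and passes to the limit at each pair of sites [x], [x + 1]. *)
  assert (Ephi : forall x, phi x = iota_m k f x).
  { intros x; unfold iota_m, f; rewrite Z.sub_add, (surjective_pairing (phi x)) at 1; f_equal.
    set (s' := Cnorm2 k); assert (Hs' : 0 <= s') by apply Cnorm2_ge0.
    assert (Z0 : (fst (phi x) + Cconj k * snd (phi (x + 1)%Z))%Cx = C0).
    { apply Cnorm2_eq0, Rle_antisym; [|apply Cnorm2_ge0].
      apply Rle_all_eps; intros eps Heps.
      destruct (Hpt (eps / (2 + 2 * s'))) as (u & Hu & Hw); [apply Rdiv_lt_0_compat; lra|].
      pose proof (Hw x 1%nat) as W1; pose proof (Hw (x + 1)%Z 1%nat) as W2; simpl in W1, W2.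
      rewrite Z.add_0_r in W1, W2; rewrite Rplus_0_l in W1, W2.
      unfold vnorm2, vsub, vadd, vscale, iota_m in W1, W2; simpl in W1, W2.
      rewrite Z.add_simpl_r in W2; rewrite Cr_m1 in W1, W2.
      set (A := (- (Cconj k * T u x) + - C1 * fst (phi x))%Cx) in W1.
      set (B := (T u x + - C1 * snd (phi (x + 1)%Z))%Cx) in W2.
      replace (fst (phi x) + Cconj k * snd (phi (x + 1)%Z))%Cx with (- (A + Cconj k * B))%Cx
        by (unfold A, B; ring).
      rewrite Cnorm2_opp.
      pose proof (Cnorm2_add_le A (Cconj k * B)%Cx) as H; rewrite Cnorm2_mul, Cnorm2_conj in H; fold s' in H.
      match type of W1 with _ + ?r <= _ => assert (0 <= r) by apply Cnorm2_ge0 end.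
      match type of W2 with ?r + _ <= _ => assert (0 <= r) by apply Cnorm2_ge0 end.
      assert (HA : Cnorm2 A <= eps / (2 + 2 * s')) by lra.
      assert (HB' : s' * Cnorm2 B <= s' * (eps / (2 + 2 * s'))) by (apply Rmult_le_compat_l; lra).
      assert (2 * (eps / (2 + 2 * s')) + 2 * (s' * (eps / (2 + 2 * s'))) = eps) by (field; lra).
      lra. }
    transitivity ((fst (phi x) + Cconj k * snd (phi (x + 1)%Z)) - Cconj k * snd (phi (x + 1)%Z))%Cx;
      [ring|rewrite Z0; ring]. }
  assert (Hf : approximable T f).
  { intros eps Heps; destruct (Hpt eps Heps) as (u & Hu & Hw); exists u; split; [assumption|].
    intros a n; apply Rle_trans with (2 := Hw (a + 1)%Z n).
    rewrite <- (zsum_shift (fun x => vnorm2 (vsub (iota_m k (T u)) phi x)) 1 a n).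
    apply zsum_le; intros x _; unfold sq, vnorm2, vsub, vadd, vscale, iota_m, f; simpl.
    rewrite Z.add_simpl_r, Cr_m1, <- (Cnorm2_opp (_ - _)%Cx).
    match goal with |- Cnorm2 ?y <= ?r + Cnorm2 ?y' =>
      replace y with y' by ring; assert (0 <= r) by apply Cnorm2_ge0; lra end. }
  destruct (Hcl f Hf) as (psi & Hpsi & E).
  exists (iota_p k psi); split.
  + apply Hplus_iff; try assumption; exists psi; split; [assumption|reflexivity].
  + intros x; rewrite Qop_iota_p, Ephi by assumption; f_equal.
    apply functional_extensionality; exact E.
(* Once [T u = f] is solved outside the window, the error lives on its [2 K - 1] sites, so the unit
   sequences there span a complement. *)
- set (delta := fun j x => if Z.eq_dec x (1 - K + Z.of_nat j) then C1 else C0).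
  exists (map (fun j => iota_m k (delta j)) (seq 0 (Z.to_nat (2 * K - 1)))); split.
  + apply Forall_map, Forall_forall; intros j _; apply Hminus_iff; try assumption.
    exists (delta j); split; [|reflexivity].
    exists 1; intros a n; rewrite (zsum_ext _ (ind (1 - K + Z.of_nat j) 1)).
    * apply (zsum_ind_le _ 1).
    * intros x _; unfold sq, delta; destruct (Z.eq_dec x (1 - K + Z.of_nat j)).
      -- rewrite ind_in by lia; unfold Cnorm2; simpl; ring.
      -- rewrite ind_out by lia; apply Cnorm2_C0.
  + intros phi Hphi; apply Hminus_iff in Hphi; try assumption.
    destruct Hphi as (f & Hf & E); destruct (Hco f Hf) as (u & Hu & Hout).
    exists (iota_p k u); split; [apply Hplus_iff; try assumption; exists u; split; [assumption|reflexivity]|].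
    assert (E' : phi = iota_m k f) by (apply functional_extensionality; exact E); subst phi.
    rewrite Qop_iota_p by assumption.
    apply (in_span_csum (iota_m k) _ (fun j => f (1 - K + Z.of_nat j)%Z - T u (1 - K + Z.of_nat j)%Z)%Cx);
      [apply iota_m_linear|].
    intros x; rewrite vsub_iota_m; f_equal; apply functional_extensionality; intros y.
    destruct (classic (outside K y)) as [Hy|Hy].
    * rewrite Hout, (csum_ext _ _ (fun _ => C0)), csum_0 by
        (first [assumption | intros j Hj; unfold delta;
           destruct (Z.eq_dec y (1 - K + Z.of_nat j)); [unfold outside in Hy; lia|ring]]); ring.
    * unfold outside in Hy.
      rewrite (csum_ext _ _ (fun j => (f y - T u y) * (if Nat.eq_dec j (Z.to_nat (y - (1 - K))) then C1 else C0))%Cx).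
      -- rewrite (csum_delta _ (fun _ => f y - T u y)%Cx) by lia; reflexivity.
      -- intros j Hj; unfold delta.
         destruct (Z.eq_dec y (1 - K + Z.of_nat j)) as [Ey|Ey];
           destruct (Nat.eq_dec j (Z.to_nat (y - (1 - K)))) as [Ej|Ej]; try lia; [|ring].
         rewrite <- Ey; reflexivity.
Qed.

(** Approximants of squared error [1 / (j + 1)] form a convergent sequence of images; [iota_m]
    multiplies squared norms by [1 + |k|^2], whence the constant [s' + 1]. *)
Lemma closed_range_of_fredholm : fredholm p q a1 a2 b -> closed_range T.
Proof.
intros (_ & Hcl & _) phi Hphi.
assert (H : forall j : nat, exists s, sl2 s /\
  forall a n, zsum (sq (fun x => phi x - T s x)%Cx) a n <= / (INR j + 1)).
{ intros j; apply Hphi, Rinv_0_lt_compat; pose proof (pos_INR j); lra. }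
set (s := fun j => proj1_sig (constructive_indefinite_description _ (H j))).
assert (Hs : forall j, sl2 (s j) /\
  forall a n, zsum (sq (fun x => phi x - T (s j) x)%Cx) a n <= / (INR j + 1))
  by (intros j; apply (proj2_sig (constructive_indefinite_description _ (H j)))).
destruct (Hcl (fun j => iota_p k (s j)) (iota_m k phi)) as (psi & Hpsi & E).
- intros j; apply Hplus_iff; try assumption; exists (s j); split; [apply Hs|reflexivity].
- intros eps Heps; set (s' := Cnorm2 k); assert (Hs' : 0 <= s') by apply Cnorm2_ge0.
  destruct (INR_archimed eps (s' + 1)) as [J HJ]; [assumption|].
  exists J; intros j Hj N; rewrite l2_partial_zsum, Qop_iota_p by assumption.
  destruct (Hs j) as [_ Hw]; set (r := fun x => (phi x - T (s j) x)%Cx) in Hw.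
  rewrite (zsum_ext _ (fun x => s' * sq r x + sq r (x + -1)%Z)).
  + rewrite zsum_plus, zsum_scal, zsum_shift.
    pose proof (Hw (- Z.of_nat N)%Z (2 * N + 1)%nat) as W1.
    pose proof (Hw (- Z.of_nat N + -1)%Z (2 * N + 1)%nat) as W2.
    apply Rle_trans with (s' * / (INR j + 1) + / (INR j + 1)).
    * apply Rplus_le_compat; [apply Rmult_le_compat_l; assumption|assumption].
    * pose proof (pos_INR j); apply Rmult_le_reg_r with (INR j + 1); [lra|].
      replace ((s' * / (INR j + 1) + / (INR j + 1)) * (INR j + 1)) with (s' + 1) by (field; lra).
      apply le_INR in Hj; nra.
  + intros x _; rewrite vsub_iota_m; unfold vnorm2, iota_m; simpl.
    rewrite Cnorm2_opp, Cnorm2_mul, Cnorm2_conj; fold s'; unfold sq, r.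
    replace (x + -1)%Z with (x - 1)%Z by lia.
    rewrite <- (Cnorm2_opp (T (s j) x - phi x)%Cx), <- (Cnorm2_opp (T (s j) (x - 1)%Z - phi (x - 1)%Z)%Cx).
    do 2 f_equal; [f_equal|]; ring.
- apply Hplus_iff in Hpsi; try assumption; destruct Hpsi as (u & Hu & Eu); exists u; split; [assumption|].
  assert (E' : psi = iota_p k u) by (apply functional_extensionality; exact Eu); subst psi.
  apply (iota_m_inj k); intros x; rewrite E, Qop_iota_p by assumption; reflexivity.
Qed.

End Transfer.

(** Cleared of denominators, the first alternative is [a = - p] and the second is [a = p]. *)
Lemma degenerate_iff p a : -1 < p < 1 ->
  (Rabs p = Rabs a <-> (1 - p) / (1 + p) * (1 - a) = 1 + a \/ (1 - p) / (1 + p) * (1 + a) = 1 - a).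
Proof.
intros Hp.
assert (E : forall y z, (1 - p) / (1 + p) * y = z <-> (1 - p) * y = (1 + p) * z).
{ intros y z; split; intros H; [rewrite <- H; field; lra|].
  apply Rmult_eq_reg_l with (1 + p); [|lra]; rewrite <- H; field; lra. }
rewrite !E; split.
- intros H; unfold Rabs in H; destruct (Rcase_abs p), (Rcase_abs a); first [left; nra | right; nra].
- intros [H|H].
  + replace a with (- p) by lra; symmetry; apply Rabs_Ropp.
  + replace a with p by lra; reflexivity.
Qed.

(** The two comparisons in [tail_dim] become [a < p] and [- p < a]: both hold if [|a| < p], neither
    if [p < - |a|], and exactly one if [|p| < |a|]. *)
Lemma tail_dim_abs p a : -1 < p < 1 -> Rabs p <> Rabs a ->
  Z.of_nat (tail_dim ((1 - p) / (1 + p)) a)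
  = if Rlt_dec (Rabs a) (Rabs p) then (1 + sgnZ p)%Z else 1%Z.
Proof.
intros Hp Hne.
assert (E : forall y z, (1 - p) / (1 + p) * y < z <-> (1 - p) * y < (1 + p) * z).
{ intros y z; split; intros H.
  - apply Rmult_lt_compat_l with (r := 1 + p) in H; [|lra].
    replace ((1 + p) * ((1 - p) / (1 + p) * y)) with ((1 - p) * y) in H by (field; lra); exact H.
  - apply Rmult_lt_reg_l with (1 + p); [lra|].
    replace ((1 + p) * ((1 - p) / (1 + p) * y)) with ((1 - p) * y) by (field; lra); exact H. }
unfold tail_dim, sgnZ, Rabs in *.
destruct (Rcase_abs p), (Rcase_abs a);
  repeat match goal with |- context [Rlt_dec ?x ?y] => destruct (Rlt_dec x y) end;
  rewrite ?E in *; try reflexivity; exfalso; lra.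
Qed.

Lemma index_formula_tail_dim p aL aR : -1 < p < 1 -> Rabs p <> Rabs aL -> Rabs p <> Rabs aR ->
  index_formula p aL aR = (Z.of_nat (tail_dim ((1 - p) / (1 + p)) aR)
    - Z.of_nat (tail_dim ((1 - p) / (1 + p)) aL))%Z.
Proof.
intros Hp HL HR; rewrite !tail_dim_abs by assumption; unfold index_formula.
destruct (Rlt_dec (Rabs aR) (Rabs p)), (Rlt_dec (Rabs p) (Rabs aL)),
  (Rlt_dec (Rabs aL) (Rabs p)), (Rlt_dec (Rabs p) (Rabs aR)); try lia; exfalso; lra.
Qed.

Theorem mainTheorem1
  (p : R) (q : Cx) (a1 a2 : Z -> R) (b : Z -> Cx)
  (a1L a2L a1R a2R : R) (bL bR : Cx)
  (Hpq : p ^ 2 + Cnorm2 q = 1) (Hq : q <> C0)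
  (Ha1 : forall x, a1 x ^ 2 + Cnorm2 (b x) = 1)
  (Ha2 : forall x, a2 x ^ 2 + Cnorm2 (b x) = 1)
  (Hb : forall x, Cmul (b x) (Cr (a1 x + a2 x)) = C0)
  (* anisotropy: C(L) = lim_{x -> -oo} C(x), C(R) = lim_{x -> +oo} C(x) *)
  (HL1 : lim_minus a1 a1L) (HL2 : lim_minus a2 a2L)
  (HLb1 : lim_minus (fun x => re (b x)) (re bL)) (HLb2 : lim_minus (fun x => im (b x)) (im bL))
  (HR1 : lim_plus a1 a1R) (HR2 : lim_plus a2 a2R)
  (HRb1 : lim_plus (fun x => re (b x)) (re bR)) (HRb2 : lim_plus (fun x => im (b x)) (im bR))
  (* both limit coins nontrivial; a(L) := a1(L), a(R) := a1(R) *)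
  (HntL : ~ coin_trivial a1L a2L bL) (HntR : ~ coin_trivial a1R a2R bR) :
  (fredholm p q a1 a2 b <-> (Rabs p <> Rabs a1L /\ Rabs p <> Rabs a1R)) /\
  (fredholm p q a1 a2 b -> witten_index_is p q a1 a2 b (index_formula p a1L a1R)).
Proof.
pose proof (p_bounds p q Hpq Hq) as Hp.
pose proof (kfactor_neq0 p q Hpq Hq) as Hk; pose proof (cfactor_neq0 p q Hpq Hq) as Hc.
pose proof (Cnorm2_kfactor p q Hpq Hq) as Es.
assert (Hok : coin_ok a1 a2 b) by (intros x; repeat split; auto).
(* The coin seen from the left end, in the form produced by [charge_reflectE]. *)
set (a1' := fun x => a2 (1 - x)%Z); set (a2' := fun x => a1 (1 - x)%Z).
set (b' := fun x => Cconj (b (1 - x)%Z)).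
assert (Hok' : coin_ok a1' a2' b') by (apply coin_ok_reflect, Hok).
destruct (nontrivial_limit a1 a2 b a1R a2R bR Hok HR1 HR2 HRb1 HRb2 HntR) as (ER & NR & LR).
assert (Lre : lim_plus (fun x => re (b' x)) (re (Cconj bL)))
  by (apply (lim_minus_reflect (fun x => re (b x))), HLb1).
assert (Lim : lim_plus (fun x => im (b' x)) (im (Cconj bL))).
{ apply lim_plus_ext with (fun x => (-1) * im (b (1 - x)%Z) + 0); [intros; unfold b'; simpl; ring|].
  replace (im (Cconj bL)) with ((-1) * im bL + 0) by (simpl; ring).
  apply (lim_plus_affine (fun x => im (b (1 - x)%Z))), (lim_minus_reflect (fun x => im (b x))), HLb2. }
destruct (nontrivial_limit a1' a2' b' a2L a1L (Cconj bL) Hok') as (EL & NL & LL);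
  [apply lim_minus_reflect, HL2|apply lim_minus_reflect, HL1|exact Lre|exact Lim| |].
{ intros H; apply HntL; destruct H as [(H1 & H2 & H3)|(H1 & H2 & H3)]; [left|right];
    repeat split; try assumption; rewrite <- (Cconj_conj bL), H3; apply Cx_ext; simpl; ring. }
assert (LL' : left_limit a1 a2 a1L).
{ unfold left_limit; rewrite EL, Ropp_involutive; exact LL. }
assert (HA1 : fredholm p q a1 a2 b -> Rabs p <> Rabs a1L /\ Rabs p <> Rabs a1R).
{ intros HF; pose proof (closed_range_of_fredholm p q a1 a2 b Hpq Hq HF) as Hcl; split; intros E.
  - apply closed_range_reflect in Hcl.
    fold (charge_reflect (cfactor p) (kfactor p q) a1 a2 b) in Hcl.
    rewrite charge_reflectE in Hcl by assumption; revert Hcl.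
    apply (charge_not_closed _ _ a1' a2' b' a2L (Cconj bL)); try assumption.
    + apply Copp_neq0, Cmul_neq0; [assumption|apply Cmul_neq0; assumption].
    + apply Cinv_neq0, Hk.
    + rewrite Cnorm2_inv, Es by assumption.
      (* Inverting [|k|^2] amounts to replacing [p] by [- p]: the reflected walk has parameters
         [- p] and [- a(L)], of unchanged moduli. *)
      replace (/ ((1 - p) / (1 + p))) with ((1 - - p) / (1 + - p)) by (field; lra).
      apply degenerate_iff; [lra|]; rewrite Rabs_Ropp, E, EL; apply Rabs_Ropp.
  - revert Hcl; apply (charge_not_closed _ _ a1 a2 b a1R bR); try assumption.
    rewrite Es; apply degenerate_iff; assumption. }
assert (HX : Rabs p <> Rabs a1L /\ Rabs p <> Rabs a1R ->
  fredholm p q a1 a2 b /\ witten_index_is p q a1 a2 b (index_formula p a1L a1R)).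
{ intros [H1 H2].
  pose proof (proj2 (degenerate_iff p a1L Hp)) as D1; pose proof (proj2 (degenerate_iff p a1R Hp)) as D2.
  rewrite <- Es in D1, D2.
  destruct (charge_fredholm (cfactor p) (kfactor p q) a1 a2 b a1L a1R)
    as ((d & e & d' & e' & B1 & B2 & Hd) & Hcl & K & Hco); try assumption; try tauto.
  split.
  - apply (fredholm_of_charge p q a1 a2 b Hpq Hq d e K); assumption.
  - exists d, d'; split; [|split].
    + apply (dim_eq_of_basis (iota_p (kfactor p q)) _ _ d e (iota_p_linear _) (iota_p_inj _)
        (kerHplus_iff p q a1 a2 b Hpq Hq Hok) B1).
    + apply (dim_eq_of_basis (iota_m (kfactor p q)) _ _ d' e' (iota_m_linear _) (iota_m_inj _)
        (kerHminus_iff p q a1 a2 b Hpq Hq Hok) B2).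
    + rewrite Hd, Es; symmetry; apply index_formula_tail_dim; assumption. }
split; [split; [exact HA1|]|].
- intros H; apply HX, H.
- intros HF; apply HX, HA1, HF.
Qed.
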